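(* Let $\alpha\ge1$ and consider on the mesh $\mathcal M$ with cells $\{\mathcal I_k\}$ the first-order scheme $$\bar{\mathbf U}_k^{n+1}=\bar{\mathbf U}_k^n-\frac{\Delta t_n}{|\mathcal I_k|}\sum_{j\in\mathcal N_k}|\mathcal E_{kj}|\,\hat{\mathbf F}_{kj},\qquad \hat{\mathbf F}_{kj}=\frac12\Big(\big\langle\boldsymbol\xi_{kj},\mathbf F(\bar{\mathbf U}_k^n)+\mathbf F(\bar{\mathbf U}_j^n)\big\rangle-\alpha(\bar{\mathbf U}_j^n-\bar{\mathbf U}_k^n)\Big).$$ If for all $k$ the state $\bar{\mathbf U}_k^n=(\bar D_k^n,\bar{\mathbf m}_k^n,\bar{\mathbf B}_k^n,\bar E_k^n)^\top$ belongs to $\mathcal G$ and satisfies the discrete divergence-free condition $$\mathrm{div}_k\bar{\mathbf B}^n:=\sum_{j\in\mathcal N_k}\Big\langle\boldsymbol\xi_{kj},\tfrac12\big(\bar{\mathbf B}_k^n+\bar{\mathbf B}_j^n\big)\Big\rangle|\mathcal E_{kj}|=0,$$ then under the CFL type condition $$0<\frac{\alpha\Delta t_n}{2|\mathcal I_k|}\sum_{j\in\mathcal N_k}|\mathcal E_{kj}|<1$$ the solution $\bar{\mathbf U}_k^{n+1}$ of the scheme belongs to $\mathcal G$ for all $k$.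
   Context: Units are such that the speed of light is $c=1$; $\mathbb R^+=(0,\infty)$; $d\in\{2,3\}$. Equation of state (EOS): the specific enthalpy is a function $h=h(p,\rho)$, differentiable on $\mathbb R^+\times\mathbb R^+$, satisfying for all $p,\rho>0$ (i) $h(p,\rho)\ge\sqrt{1+p^2/\rho^2}+p/\rho$; (ii) $h\big(\tfrac1\rho-\tfrac{\partial h}{\partial p}\big)<\tfrac{\partial h}{\partial\rho}<0$; (iii) $\lim_{p\to0^+}h(p,\rho)=1$ for each fixed $\rho>0$. Conservative variables: given $\rho>0$, $p>0$, $\mathbf v\in\mathbb R^3$ with $|\mathbf v|<1$, $\mathbf B\in\mathbb R^3$, put $W=(1-|\mathbf v|^2)^{-1/2}$, $h=h(p,\rho)$, $p_m=\frac12\big(W^{-2}|\mathbf B|^2+(\mathbf v\cdot\mathbf B)^2\big)$, $p_{tot}=p+p_m$, and $$D=\rho W,\quad \mathbf m=\rho hW^2\mathbf v+|\mathbf B|^2\mathbf v-(\mathbf v\cdot\mathbf B)\mathbf B,\quad E=\rho hW^2-p_{tot}+|\mathbf B|^2,\quad \mathbf U=(D,\mathbf m,\mathbf B,E)^\top\in\mathbb R^8.$$ The admissible state set $\mathcal G\subset\mathbb R^8$ is the set of all $\mathbf U$ obtained in this way (i.e. $\rho(\mathbf U)>0$, $p(\mathbf U)>0$, $|\mathbf v(\mathbf U)|<1$). Fluxes: for $\mathbf U\in\mathcal G$ and $\ell=1,\dots,d$, with $\mathbf e_\ell$ the $\ell$-th row of the $3\times3$ identity matrix, $$\mathbf F_\ell(\mathbf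 U)=\Big(Dv_\ell,\ v_\ell\mathbf m-B_\ell\big(W^{-2}\mathbf B+(\mathbf v\cdot\mathbf B)\mathbf v\big)+p_{tot}\mathbf e_\ell,\ v_\ell\mathbf B-B_\ell\mathbf v,\ m_\ell\Big)^\top.$$ For $\boldsymbol\xi\in\mathbb R^d$: $\langle\boldsymbol\xi,\mathbf B\rangle=\sum_{\ell=1}^d\xi_\ell B_\ell$ and $\langle\boldsymbol\xi,\mathbf F(\mathbf U)\rangle=\sum_{\ell=1}^d\xi_\ell\mathbf F_\ell(\mathbf U)$ (extended linearly to sums of fluxes). Mesh: the $d$-dimensional spatial domain is divided into cells $\mathcal I_k$ that are non-self-intersecting $d$-polytopes (possibly unstructured). $\mathcal N_k$ is the index set of neighboring cells of $\mathcal I_k$; for $j\in\mathcal N_k$, $\mathcal E_{kj}=\partial\mathcal I_k\cap\partial\mathcal I_j$ is the common (flat) edge/face, and $\boldsymbol\xi_{kj}\in\mathbb R^d$ is its unit normal pointing from $\mathcal I_k$ to $\mathcal I_j$; $\partial\mathcal I_k$ is the union of the $\mathcal E_{kj}$, $j\in\mathcal N_k$. $|\mathcal I_k|$ and $|\mathcal E_{kj}|$ are the $d$- and $(d-1)$-dimensional Hausdorff measures. $\Delta t_n>0$ is the time step. The CFL condition is imposed for all $k$. *)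

(* Defs.v *)
From HB Require Import structures.
From mathcomp Require Import all_boot all_order all_algebra.
From mathcomp Require Import all_classical all_reals all_analysis.

Set Implicit Arguments.
Unset Strict Implicit.
Unset Printing Implicit Defensive.

Import Order.TTheory GRing.Theory Num.Theory.
Import numFieldNormedType.Exports.

Local Open Scope classical_set_scope.
Local Open Scope ring_scope.

(* The library norm on ['rV_n] is the sup norm; lengths and angles below are
   always measured with the Euclidean structure [dot], [enorm].  Both norms
   induce the library topology used for [interior], [closure] and limits. *)

Definition dot (R : realType) (n : nat) (x y : 'rV[R]_n) : R :=
  \sum_(i < n) x 0 i * y 0 i.

Definition enorm (R : realType) (n : nat) (x : 'rV[R]_n) : R :=
  Num.sqrt (dot x x).

(* ---------------------------------------------------------------------- *)

(* Arguments in the order pressure, density; only the values at positive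
   arguments matter. *)
Record eos (R : realType) (h : R -> R -> R) : Prop := Eos {
  eos_differentiable : forall p rho : R, 0 < p -> 0 < rho ->
    differentiable (fun x : R * R => h x.1 x.2) (p, rho);
  eos_lower : forall p rho : R, 0 < p -> 0 < rho ->
    Num.sqrt (1 + p ^+ 2 / rho ^+ 2) + p / rho <= h p rho;
  eos_deriv_lt : forall p rho : R, 0 < p -> 0 < rho ->
    h p rho * (rho^-1 - derive1 (fun q => h q rho) p) < derive1 (fun r => h p r) rho;
  eos_deriv_neg : forall p rho : R, 0 < p -> 0 < rho ->
    derive1 (fun r => h p r) rho < 0;
  eos_cold : forall rho : R, 0 < rho -> h p rho @[p --> 0^'+] --> (1 : R)
}.

(* ---------------------------------------------------------------------- *)

(* R^8, with coordinates in the order (D, m, B, E). *)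
Notation state R := 'rV[R]_(1 + (3 + (3 + 1))).

Definition mkstate (R : realType) (D : R) (m B : 'rV[R]_3) (E : R) : state R :=
  row_mx D%:M (row_mx m (row_mx B E%:M)).

Definition stD (R : realType) (U : state R) : R := lsubmx U 0 0.
Definition stm (R : realType) (U : state R) : 'rV[R]_3 := lsubmx (rsubmx U).
Definition stB (R : realType) (U : state R) : 'rV[R]_3 :=
  lsubmx (rsubmx (rsubmx U)).

Definition lorentz (R : realType) (v : 'rV[R]_3) : R :=
  (Num.sqrt (1 - enorm v ^+ 2))^-1.

Definition ptot (R : realType) (p : R) (v B : 'rV[R]_3) : R :=
  p + 2^-1 * ((lorentz v) ^- 2 * enorm B ^+ 2 + dot v B ^+ 2).

Definition cons_of_prim (R : realType) (h : R -> R -> R)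
    (rho p : R) (v B : 'rV[R]_3) : state R :=
  let W := lorentz v in
  mkstate (rho * W)
    ((rho * h p rho * W ^+ 2) *: v + (enorm B ^+ 2) *: v - dot v B *: B)
    B
    (rho * h p rho * W ^+ 2 - ptot p v B + enorm B ^+ 2).

(* [(rho, p, v)] are physical primitive variables of the state [U]; its
   magnetic field is read off directly. *)
Definition is_prim (R : realType) (h : R -> R -> R) (U : state R)
    (w : R * R * 'rV[R]_3) : Prop :=
  let: (rho, p, v) := w in
  [/\ 0 < rho, 0 < p, enorm v < 1 & U = cons_of_prim h rho p v (stB U)].

Definition admissible (R : realType) (h : R -> R -> R) : set (state R) :=
  [set U | exists w, is_prim h U w].

(* The functions rho(U), p(U), v(U); a dummy value outside [admissible h]. *)
Definition prim_of (R : realType) (h : R -> R -> R) (U : state R) :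
    R * R * 'rV[R]_3 :=
  xget (1, 1, 0) (is_prim h U).

Definition flux (R : realType) (h : R -> R -> R) (l : 'I_3) (U : state R) :
    state R :=
  let: (rho, p, v) := prim_of h U in
  let B := stB U in
  mkstate (stD U * v 0 l)
    (v 0 l *: stm U
       - B 0 l *: ((lorentz v) ^- 2 *: B + dot v B *: v)
       + ptot p v B *: delta_mx 0 l)
    (v 0 l *: B - B 0 l *: v)
    (stm U 0 l).

(* The spatial dimension d is 2 or 3, so [inord l : 'I_3] has the same value
   as [l : 'I_d]. *)
Definition dirB (R : realType) (d : nat) (xi : 'rV[R]_d) (B : 'rV[R]_3) : R :=
  \sum_(l < d) xi 0 l * B 0 (inord l).

Definition dirF (R : realType) (d : nat) (h : R -> R -> R) (xi : 'rV[R]_d)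
    (U : state R) : state R :=
  \sum_(l < d) xi 0 l *: flux h (inord l) U.

Definition num_flux (R : realType) (d : nat) (h : R -> R -> R) (alpha : R)
    (xi : 'rV[R]_d) (Uk Uj : state R) : state R :=
  2^-1 *: (dirF h xi Uk + dirF h xi Uj - alpha *: (Uj - Uk)).

(* ---------------------------------------------------------------------- *)

(* Euclidean diameter; the added 0 gives the empty set diameter 0. *)
Definition ediam (R : realType) (n : nat) (A : set 'rV[R]_n) : \bar R :=
  ereal_sup (0%E |` [set (enorm (x - y))%:E | x in A & y in A]).

(* Volume of the Euclidean unit ball of R^s. *)
Fixpoint unit_ball_volume (R : realType) (s : nat) : R :=
  match s with
  | 0 => 1
  | 1 => 2
  | s'.+2 => 2 * pi / s%:R * unit_ball_volume R s'
  end.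

Definition hausdorff_pre (R : realType) (n s : nat) (delta : R)
    (A : set 'rV[R]_n) : \bar R :=
  ereal_inf
    [set (\sum_(0 <= i <oo)
            ((unit_ball_volume R s / 2 ^+ s)%:E * ediam (C i) ^+ s))%E
    | C in [set C : nat -> set 'rV[R]_n |
              (forall i, (ediam (C i) <= delta%:E)%E) /\
              A `<=` \bigcup_i C i]].

(* Normalized so that the s-dimensional measure is Lebesgue measure on R^s.
   Only used for 0 < s. *)
Definition hausdorff (R : realType) (n s : nat) (A : set 'rV[R]_n) : \bar R :=
  ereal_sup [set hausdorff_pre s delta A | delta in [set delta : R | 0 < delta]].

(* ---------------------------------------------------------------------- *)

Definition boundary (T : topologicalType) (A : set T) : set T :=
  closure A `\` A°.

Definition hull (R : realType) (d : nat) (s : seq 'rV[R]_d) : set 'rV[R]_d :=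
  [set x | exists w : 'I_(size s) -> R,
     [/\ forall i, 0 <= w i, \sum_i w i = 1 & x = \sum_i w i *: s`_i]].

(* M is an embedded topological n-manifold without boundary: every point has
   a neighbourhood in M homeomorphic to R^n. *)
Definition embedded_manifold (R : realType) (d n : nat) (M : set 'rV[R]_d) :
    Prop :=
  forall x, M x -> exists V : set 'rV[R]_d, [/\ open V, V x &
    exists (f : 'rV[R]_d -> 'rV[R]_n) (g : 'rV[R]_n -> 'rV[R]_d),
      [/\ {within M `&` V, continuous f}, continuous g,
          (forall y, (M `&` V) (g y)), cancel g f &
          forall z, (M `&` V) z -> g (f z) = z]].

(* A d-polytope of R^d, not necessarily convex: a finite union of convex
   d-polytopes, in one piece.  It is non-self-intersecting in that its boundary
   is an embedded closed (d-1)-manifold; for d = 2 this means that the boundary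
   consists of simple closed polygonal curves. *)
Definition polytope (R : realType) (d : nat) (A : set 'rV[R]_d) : Prop :=
  [/\ exists2 ss : seq (seq 'rV[R]_d),
        (forall s, s \in ss -> (hull s)° !=set0)
        & A = \bigcup_(s in [set` ss]) hull s,
      A° !=set0,
      connected A° &
      embedded_manifold d.-1 (boundary A)].

Definition common_face (R : realType) (d : nat) (K : Type)
    (cell : K -> set 'rV[R]_d) (k j : K) : set 'rV[R]_d :=
  boundary (cell k) `&` boundary (cell j).

(* The sets A and A' lie on the sides -xi, resp. +xi, of the flat face F, which
   is contained in a hyperplane orthogonal to the unit vector xi.  The side is
   tested at the points of F interior to F relatively to that hyperplane, since
   A and A' need not be convex. *)
Definition unit_normal (R : realType) (d : nat) (A A' F : set 'rV[R]_d)
    (xi : 'rV[R]_d) : Prop :=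
  [/\ enorm xi = 1,
      (forall x y, F x -> F y -> dot xi x = dot xi y) &
      forall x, F x -> (\forall y \near x, dot xi y = dot xi x -> F y) ->
        \forall t \near (0 : R)^'+, A (x - t *: xi) /\ A' (x + t *: xi)].

(* The index type K may be infinite: since the faces shared with neighbours
   cover the whole boundary of every cell, a mesh without (or periodically
   continued across) domain boundaries is described. *)
Record is_mesh (R : realType) (d : nat) (K : eqType)
    (cell : K -> set 'rV[R]_d) (nbr : K -> seq K)
    (xi : K -> K -> 'rV[R]_d) : Prop := IsMesh {
  mesh_polytope : forall k, polytope (cell k);
  mesh_disjoint : forall k j, k != j -> (cell k)° `&` (cell j)° = set0;
  mesh_nbr_uniq : forall k, uniq (nbr k);
  mesh_nbr : forall k j, j \in nbr k <->
    j != k /\ (0 < hausdorff d.-1 (common_face cell k j))%E;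
  mesh_normal : forall k j, j \in nbr k ->
    unit_normal (cell k) (cell j) (common_face cell k j) (xi k j);
  mesh_boundary : forall k,
    boundary (cell k) = \bigcup_(j in [set` nbr k]) common_face cell k j
}.

Definition cell_size (R : realType) (d : nat) (K : Type)
    (cell : K -> set 'rV[R]_d) (k : K) : R :=
  fine (hausdorff d (cell k)).

Definition face_size (R : realType) (d : nat) (K : Type)
    (cell : K -> set 'rV[R]_d) (k j : K) : R :=
  fine (hausdorff d.-1 (common_face cell k j)).

Definition discrete_div (R : realType) (d : nat) (K : eqType)
    (cell : K -> set 'rV[R]_d) (nbr : K -> seq K) (xi : K -> K -> 'rV[R]_d)
    (B : K -> 'rV[R]_3) (k : K) : R :=
  \sum_(j <- nbr k)
    dirB (xi k j) (2^-1 *: (B k + B j)) * face_size cell k j.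

(* Main.v *)
(* [G] is cut out by linear inequalities: a state with [D > 0] is admissible as soon as,
   for every velocity [vs] with |vs| < 1 and every field [Bs], the functional

     E - vs.m - sqrt(1 - |vs|^2) D - ((1 - |vs|^2) Bs + (vs.Bs) vs).B,

   linear in the state, exceeds -[pmag vs Bs], the magnetic pressure of [(vs, Bs)]; choosing
   [Bs = B], the primitive variables are recovered by the intermediate value theorem.
   By linearity the functional of the updated state is a sum of a positive multiple of that
   of the old state and of contributions of the neighbours.  For a unit vector [xi] and
   [alpha >= 1] the contribution U - F_xi(U) / alpha is bounded from below by

     - pmag vs Bs + (pmag vs Bs (xi.vs) - (xi.B) (vs.Bs)) / alpha,

   which follows from the causality of the stress-energy tensors of the fluid and of the
   magnetic field.  The terms in 1 / alpha add up to zero: the first because the faces of a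
   cell close up, sum_j |E_kj| xi_kj = 0, the second by the discrete divergence condition.

   The closure relation is proved for Hausdorff measures and cells that need not be convex
   by projecting the faces along each coordinate axis.  The projection multiplies the
   area of a flat face by |xi_l|, both measures being compared to the unique translation
   invariant one.  Almost every line parallel to the axis meets the boundary of the cell
   only in points where all nearby faces are coplanar and not parallel to the line; there
   it enters and leaves the cell alternately, so that the signs of the xi_l add up to zero
   along the line. *)

Require Import Defs.
From HB Require Import structures.
From mathcomp Require Import all_boot all_order all_algebra.
From mathcomp Require Import all_classical all_reals all_analysis.
From mathcomp Require Import ring lra.
From mathcomp Require Import zify perm.

Set Implicit Arguments.
Unset Strict Implicit.
Unset Printing Implicit Defensive.

Import Order.TTheory GRing.Theory Num.Theory.
Import numFieldNormedType.Exports.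

Local Open Scope classical_set_scope.
Local Open Scope ring_scope.

(** * Euclidean structure *)

(** The Hausdorff measure is given by covers, and its value on a cube is never computed. Only ratios
    matter: a translation invariant metric outer measure is fixed on compact sets by its mass on the
    unit cube, and the area factor of a tilted hyperplane follows from symmetry alone (isometries,
    dilations, permutations of the axes, one reflection). If the unit cube has mass zero, both sides
    of the projection formula vanish. Points are called generic with respect to the faces of the
    neighbours as well, since the side on which a neighbour lies is read off from its own boundary.
    The hypothesis [1 <= alpha] says that [n = - xi / alpha] has length at most one, so that
    [(1, - n)] is a causal vector, and stress-energy currents pair with it without changing sign.
    For the fluid, bound (i) of the equation of state is what a Cauchy-Schwarz inequality for the
    pair (pressure, density) requires. For the magnetic field, the quadratic expression is the
    stress-energy of the difference of two ideal fields. In the recovery, the state without pressure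
    and with the same [D], [m], [B] is the reference: the functional at its velocity shows that its
    energy lies below [E]. *)

Lemma normr_coord {R : realType} {n : nat} (x : 'rV[R]_n) i : `|x 0 i| <= `|x|.
Proof.
rewrite [leRHS]/Num.norm/= mx_normrE.
exact: (le_bigmax _ (fun ij => `|x ij.1 ij.2|) (0, i)).
Qed.

Lemma ler_norm_rV {R : realType} {n : nat} (x : 'rV[R]_n) e :
  0 <= e -> (forall i, `|x 0 i| <= e) -> `|x| <= e.
Proof.
move=> e0 xe; rewrite [leLHS]/Num.norm/= mx_normrE.
by apply: bigmax_le => // -[i j] _; rewrite ord1.
Qed.

Section euclid.
Context {R : realType} {n : nat}.
Implicit Types (x y z : 'rV[R]_n) (c : R).

Lemma dotC x y : dot x y = dot y x.
Proof. by apply: eq_bigr => i _; rewrite mulrC. Qed.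

Lemma dotDl x y z : dot (x + y) z = dot x z + dot y z.
Proof. by rewrite -big_split; apply: eq_bigr => i _; rewrite mxE mulrDl. Qed.

Lemma dotZl c x y : dot (c *: x) y = c * dot x y.
Proof. by rewrite /dot mulr_sumr; apply: eq_bigr => i _; rewrite mxE mulrA. Qed.

Lemma dotDr x y z : dot z (x + y) = dot z x + dot z y.
Proof. by rewrite !(dotC z) dotDl. Qed.

Lemma dotZr c x y : dot x (c *: y) = c * dot x y.
Proof. by rewrite !(dotC x) dotZl. Qed.

Lemma dotNl x y : dot (- x) y = - dot x y.
Proof. by rewrite -scaleN1r dotZl mulN1r. Qed.

Lemma dotNr x y : dot x (- y) = - dot x y.
Proof. by rewrite !(dotC x) dotNl. Qed.

Lemma dot0l x : dot 0 x = 0.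
Proof. by rewrite -(scale0r 0) dotZl mul0r. Qed.

Lemma dot_ge0 x : 0 <= dot x x.
Proof. by apply: sumr_ge0 => i _; rewrite -expr2 sqr_ge0. Qed.

Lemma dot_eq0 x : (dot x x == 0) = (x == 0).
Proof.
apply/idP/eqP => [|->]; last by rewrite dot0l.
rewrite psumr_eq0; last by move=> i _; rewrite -expr2 sqr_ge0.
move=> /allP x0; apply/rowP => i; rewrite mxE; apply/eqP.
by have := x0 i (mem_index_enum i); rewrite mulf_eq0 orbb.
Qed.

Lemma cauchy_dot x y : dot x y ^+ 2 <= dot x x * dot y y.
Proof.
have [/eqP|y0] := eqVneq (dot y y) 0.
  by rewrite dot_eq0 => /eqP->; rewrite dotC !dot0l expr0n/= mulr0.
have yy : 0 < dot y y by rewrite lt_def y0 dot_ge0.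
have := dot_ge0 (dot y y *: x - dot x y *: y).
rewrite !(dotDl, dotDr, dotNl, dotNr, dotZl, dotZr) (dotC y x) => h.
rewrite -subr_ge0 -(pmulr_rge0 _ yy); apply: le_trans h _.
by rewrite le_eqVlt; apply/orP; left; apply/eqP; ring.
Qed.

Lemma enorm_ge0 x : 0 <= enorm x. Proof. exact: sqrtr_ge0. Qed.

Lemma sqr_enorm x : enorm x ^+ 2 = dot x x.
Proof. by rewrite sqr_sqrtr// dot_ge0. Qed.

Lemma enormZ c x : enorm (c *: x) = `|c| * enorm x.
Proof. by rewrite /enorm dotZl dotZr mulrA -expr2 sqrtrM ?sqr_ge0// sqrtr_sqr. Qed.

Lemma enorm0 : enorm (0 : 'rV[R]_n) = 0.
Proof. by rewrite /enorm dot0l sqrtr0. Qed.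

Lemma norm_le_enorm x : `|x| <= enorm x.
Proof.
apply: ler_norm_rV => [|j]; first exact: enorm_ge0.
rewrite -ler_sqr ?nnegrE ?enorm_ge0//.
rewrite sqr_enorm real_normK ?num_real// /dot (bigD1 j)//= -expr2 lerDl.
by apply: sumr_ge0 => k _; rewrite -expr2 sqr_ge0.
Qed.

Lemma enorm_le_norm x : enorm x <= Num.sqrt n%:R * `|x|.
Proof.
have -> : `|x| = Num.sqrt (`|x| ^+ 2) by rewrite sqrtr_sqr ger0_norm.
rewrite -sqrtrM ?ler0n// ler_wsqrtr// /dot.
have -> : n%:R * `|x| ^+ 2 = \sum_(i < n) `|x| ^+ 2.
  by rewrite big_const_ord iter_addr addr0 mulr_natl.
apply: ler_sum => i _; rewrite -expr2 -real_normK ?num_real// ler_sqr ?nnegrE//.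
exact: normr_coord.
Qed.

End euclid.

(** * Hausdorff measure *)

Section ediam.
Context {R : realType} {n : nat}.
Implicit Types A B : set 'rV[R]_n.

Lemma ediam_ge0 A : (0 <= ediam A)%E.
Proof. by apply: ereal_sup_ubound; left. Qed.

Lemma ediam_le A (e : \bar R) : (0 <= e)%E ->
  (forall x y, A x -> A y -> ((enorm (x - y))%:E <= e)%E) -> (ediam A <= e)%E.
Proof. by move=> e0 Ae; apply: ge_ereal_sup => _ [->//|[x Ax [y Ay <-]]]; exact: Ae. Qed.

Lemma enorm_le_ediam A x y : A x -> A y -> ((enorm (x - y))%:E <= ediam A)%E.
Proof. by move=> Ax Ay; apply: ereal_sup_ubound; right; exists x => //; exists y. Qed.

Lemma ediam0 : ediam (@set0 'rV[R]_n) = 0%E.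
Proof. by apply/eqP; rewrite eq_le ediam_ge0 andbT; apply: ediam_le. Qed.

End ediam.

Lemma unit_ball_volume_gt0 (R : realType) s : 0 < unit_ball_volume R s.
Proof.
suff: 0 < unit_ball_volume R s /\ 0 < unit_ball_volume R s.+1 by case.
elim: s => [|s [IH1 IH2]] //=; split=> //.
by rewrite mulr_gt0// divr_gt0 ?ltr0n// mulr_gt0// pi_gt0.
Qed.

Section hausdorff_outer.
Context {R : realType} (n s : nat).
Hypothesis s0 : (0 < s)%N.
Implicit Types (X : set 'rV[R]_n) (d : R).

Let T := g_sigma_algebraType [set: set 'rV[R]_n].
Let c : R := unit_ball_volume R s / 2 ^+ s.

Let c_ge0 : 0 <= c.
Proof. by rewrite divr_ge0 ?exprn_ge0// ltW// unit_ball_volume_gt0. Qed.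

(** The value [+oo] on sets of diameter above [d] moves the restriction on covers into the weight,
    so that the general construction [mu_ext] applies. [T] makes every subset measurable because the
    covers are arbitrary. *)
Definition hausdorff_gauge d X : \bar R :=
  if (ediam X <= d%:E)%E then (c%:E * ediam X ^+ s)%E else +oo%E.

(** Here [0 < s] enters: in dimension zero the power [ediam set0 ^+ 0] would be 1. *)
Lemma hausdorff_gauge0 d : 0 < d -> hausdorff_gauge d set0 = 0%E.
Proof.
move=> d0; rewrite /hausdorff_gauge ediam0 lee_fin ltW//.
by case: s s0 => // k _; rewrite expeS mul0e mule0.
Qed.

Lemma hausdorff_gauge_ge0 d X : (0 <= hausdorff_gauge d X)%E.
Proof.
rewrite /hausdorff_gauge; case: ifP => // _.
by rewrite mule_ge0 ?lee_fin// expe_ge0// ediam_ge0.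
Qed.

Lemma hausdorff_preE d X : hausdorff_pre s d X =
  @mu_ext _ T R (hausdorff_gauge d) X.
Proof.
apply/eqP; rewrite eq_le; apply/andP; split; last first.
  apply: le_ereal_inf_tmp => _ [C [Cd XC]] <-.
  apply: ereal_inf_lbound; exists C.
    by split=> // i; exact: sub_gen_smallest.
  by apply: eq_eseriesr => i _; rewrite /hausdorff_gauge Cd.
apply: le_ereal_inf_tmp => _ [C [_ XC]] <-.
have [Cd|] := pselect (forall i, (ediam (C i : set 'rV[R]_n) <= d%:E)%E).
  apply: ereal_inf_lbound; exists C => //.
  by apply: eq_eseriesr => i _; rewrite /hausdorff_gauge Cd.
move=> /existsNP[i /negP Cd].
rewrite (@eseries_pinfty _ _ xpredT i) ?leey//.
  by move=> k _; rewrite gt_eqF// (lt_le_trans _ (hausdorff_gauge_ge0 _ _)).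
by rewrite /hausdorff_gauge (negbTE Cd).
Qed.

Lemma hausdorff_pre_ge0 d X : (0 <= hausdorff_pre s d X)%E.
Proof. by rewrite hausdorff_preE; apply: mu_ext_ge0; exact: hausdorff_gauge_ge0. Qed.

Lemma hausdorff_pre_sigma_subadditive d :
  sigma_subadditive (@hausdorff_pre R n s d).
Proof.
move=> F; rewrite hausdorff_preE.
under eq_eseriesr do rewrite hausdorff_preE.
apply: (@mu_ext_sigma_subadditive _ T) => X; exact: hausdorff_gauge_ge0.
Qed.

Lemma hausdorff_ge_pre d X : 0 < d -> (hausdorff_pre s d X <= hausdorff s X)%E.
Proof. by move=> d0; apply: ereal_sup_ubound; exists d. Qed.

Lemma hausdorff_set0 : hausdorff s (@set0 'rV[R]_n) = 0%E.
Proof.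
apply/eqP; rewrite eq_le; apply/andP; split.
  apply: ge_ereal_sup => _ [d /= d0 <-]; rewrite hausdorff_preE mu_ext0//.
    exact: hausdorff_gauge0.
  exact: hausdorff_gauge_ge0.
exact: (le_trans (hausdorff_pre_ge0 1 _) (hausdorff_ge_pre _ _)).
Qed.

Lemma hausdorff_ge0 X : (0 <= hausdorff s X)%E.
Proof. exact: (le_trans (hausdorff_pre_ge0 1 _) (hausdorff_ge_pre _ _)). Qed.

Lemma le_hausdorff : {homo (@hausdorff R n s) : A B / A `<=` B >-> (A <= B)%E}.
Proof.
move=> A B AB; apply: ge_ereal_sup => _ [d /= d0 <-].
apply: le_trans (hausdorff_ge_pre B d0); rewrite !hausdorff_preE.
exact: (@le_mu_ext _ T).
Qed.

Lemma hausdorff_sigma_subadditive : sigma_subadditive (@hausdorff R n s).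
Proof.
move=> F; apply: ge_ereal_sup => _ [d /= d0 <-].
apply: le_trans (hausdorff_pre_sigma_subadditive d F) _.
apply: lee_nneseries => [i _ _|i _]; first exact: hausdorff_pre_ge0.
exact: hausdorff_ge_pre.
Qed.

(* Below the scale [e] no set of a cover meets both [A] and [B]. *)
Lemma hausdorff_separated (A B : set 'rV[R]_n) (e : R) : 0 < e ->
  (forall x y, A x -> B y -> e <= enorm (x - y)) ->
  (hausdorff s A + hausdorff s B <= hausdorff s (A `|` B))%E.
Proof.
move=> e0 AB.
have pre d : 0 < d -> d < e ->
    (hausdorff_pre s d A + hausdorff_pre s d B <= hausdorff s (A `|` B))%E.
  move=> d0 de; apply: le_trans (hausdorff_ge_pre _ d0).
  apply: le_ereal_inf_tmp => _ [C [Cd ABC]] <-.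
  rewrite !hausdorff_preE.
  pose CA i := if `[< C i `&` A !=set0 >] then C i else set0.
  pose CB i := if `[< C i `&` A !=set0 >] then set0 else C i.
  have -> : (\sum_(0 <= i <oo)
            (unit_ball_volume R s / 2 ^+ s)%:E * ediam (C i) ^+ s)%E =
    (\sum_(0 <= i <oo) hausdorff_gauge d (CA i) +
     \sum_(0 <= i <oo) hausdorff_gauge d (CB i))%E.
    rewrite -nneseriesD; [|by move=> *; exact: hausdorff_gauge_ge0..].
    apply: eq_eseriesr => i _; rewrite /CA /CB.
    case: ifP => _; rewrite hausdorff_gauge0// ?adde0 ?add0e;
      by rewrite /hausdorff_gauge Cd.
  apply: leeD; apply: ereal_inf_lbound.
    exists CA => //; split=> [i|x Ax]; first exact: sub_gen_smallest.
    have [i _ Cix] := ABC x (or_introl Ax); exists i => //; rewrite /CA.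
    by case: asboolP => //; case; exists x.
  exists CB => //; split=> [i|y By]; first exact: sub_gen_smallest.
  have [i _ Ciy] := ABC y (or_intror By); exists i => //; rewrite /CB.
  case: asboolP => // -[x [Cix Ax]].
  have := le_trans (enorm_le_ediam Cix Ciy) (Cd i); rewrite lee_fin leNgt.
  by rewrite (lt_le_trans de)// AB.
have homo_pre X d d' : 0 < d -> d <= d' ->
    (hausdorff_pre s d' X <= hausdorff_pre s d X)%E.
  move=> d0 dd'; apply: le_ereal_inf_tmp => _ [C [Cd XC]] <-.
  apply: ereal_inf_lbound; exists C => //; split=> // i.
  by apply: le_trans (Cd i) _; rewrite lee_fin.
(* The two suprema run over independent scales; premeasures grow as the scale shrinks, so a common
   scale below [e], [d1] and [d2] serves both. *)
have key d1 d2 : 0 < d1 -> 0 < d2 ->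
    (hausdorff_pre s d1 A + hausdorff_pre s d2 B <= hausdorff s (A `|` B))%E.
  move=> d10 d20; pose d := Num.min (e / 2) (Num.min d1 d2).
  have d0 : 0 < d by rewrite !lt_min d10 d20 divr_gt0.
  have de : d < e by rewrite gt_min; apply/orP; left; lra.
  apply: le_trans (pre _ d0 de); apply: leeD; apply: homo_pre => //;
    by rewrite !ge_min lexx ?orbT.
case: (eqVneq (hausdorff s (A `|` B)) +oo%E) => [->|fin]; first by rewrite leey.
have finS Y : Y `<=` A `|` B -> hausdorff s Y \is a fin_num.
  move=> YAB; rewrite ge0_fin_numE ?hausdorff_ge0//.
  by apply: le_lt_trans (le_hausdorff YAB) _; rewrite ltey.
have finA : hausdorff s A \is a fin_num by apply: finS => x; left.
have finB : hausdorff s B \is a fin_num by apply: finS => x; right.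
rewrite -leeBrDr//; apply: ge_ereal_sup => _ [d1 /= d10 <-].
rewrite leeBrDr// addeC.
have finP : hausdorff_pre s d1 A \is a fin_num.
  rewrite ge0_fin_numE ?hausdorff_pre_ge0//.
  by rewrite (le_lt_trans (hausdorff_ge_pre _ d10))// -ge0_fin_numE ?hausdorff_ge0.
rewrite -leeBrDr//; apply: ge_ereal_sup => _ [d2 /= d20 <-].
by rewrite leeBrDr// addeC key.
Qed.

End hausdorff_outer.

Lemma lee_expeM (R : realType) (L : R) (x y : \bar R) k : 0 <= L -> (0 <= x)%E ->
  (0 <= y)%E -> (x <= L%:E * y)%E -> (x ^+ k <= (L ^+ k)%:E * y ^+ k)%E.
Proof.
move=> L0 x0 y0 xy; elim: k => [|k IH]; first by rewrite !expe0 mul1e.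
by rewrite !expeS exprS EFinM muleACA lee_pmul// expe_ge0.
Qed.

Lemma lipschitz_hausdorff (R : realType) (T : Type) (n m s : nat) (s0 : (0 < s)%N)
    (f : T -> 'rV[R]_n) (g : T -> 'rV[R]_m) (L : R) (X : set T) : 0 < L ->
  (forall x y, X x -> X y -> enorm (g x - g y) <= L * enorm (f x - f y)) ->
  (hausdorff s (g @` X) <= (L ^+ s)%:E * hausdorff s (f @` X))%E.
Proof.
move=> L0 fg; apply: ge_ereal_sup => _ [d /= d0 <-].
have dL0 : 0 < d / L by rewrite divr_gt0.
apply: (@le_trans _ _ ((L ^+ s)%:E * hausdorff_pre s (d / L) (f @` X))%E); last first.
  by rewrite lee_wpmul2l ?lee_fin ?exprn_ge0 ?(ltW L0)//; exact: hausdorff_ge_pre.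
rewrite -lee_pdivrMl ?exprn_gt0//; apply: le_ereal_inf_tmp => _ [C [Cd XC]] <-.
rewrite lee_pdivrMl ?exprn_gt0//.
rewrite -nneseriesZl; last first.
  move=> i _; rewrite mule_ge0 ?expe_ge0 ?ediam_ge0// lee_fin divr_ge0 ?exprn_ge0//.
  exact/ltW/unit_ball_volume_gt0.
pose C' i := g @` (X `&` f @^-1` (C i)).
have C'd i : (ediam (C' i) <= L%:E * ediam (C i))%E.
  apply: ediam_le => [|_ _ [x [Xx Cx] <-] [y [Xy Cy] <-]].
    by rewrite mule_ge0 ?ediam_ge0// lee_fin ltW.
  apply: (@le_trans _ _ (L * enorm (f x - f y))%:E); first by rewrite lee_fin fg.
  rewrite EFinM lee_wpmul2l ?lee_fin ?(ltW L0)//; exact: enorm_le_ediam.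
apply: (@le_trans _ _ (\sum_(0 <= i <oo)
            (unit_ball_volume R s / 2 ^+ s)%:E * ediam (C' i) ^+ s)%E).
  apply: ereal_inf_lbound; exists C' => //; split=> [i|_ [x Xx <-]].
    apply: le_trans (C'd i) _.
    by rewrite -lee_pdivlMl// -EFinM mulrC Cd.
  have [i _ Ci] := XC _ (imageP f Xx); exists i => //; exists x => //.
apply: lee_nneseries => [i _ _|i _].
  rewrite mule_ge0 ?expe_ge0 ?ediam_ge0// lee_fin divr_ge0 ?exprn_ge0//.
  exact/ltW/unit_ball_volume_gt0.
rewrite muleCA lee_wpmul2l//.
  rewrite lee_fin divr_ge0 ?exprn_ge0//; exact/ltW/unit_ball_volume_gt0.
apply: lee_expeM; rewrite ?ediam_ge0//; exact: ltW.
Qed.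

Definition metric_outer {R : realType} {V : normedModType R} (mu : set V -> \bar R) :=
  forall (A B : set V) (e : R), 0 < e -> (forall x y, A x -> B y -> e <= `|x - y|) ->
  (mu A + mu B <= mu (A `|` B))%E.

(** * Closed sets are measurable for metric outer measures *)

Section caratheodory_criterion.
Context {R : realType} {V : normedModType R} (mu : {outer_measure set V -> \bar R}).
Hypothesis mu_metric : metric_outer mu.

Let r (k : nat) : R := k.+1%:R^-1.

Let r_le k l : (k <= l)%N -> r l <= r k.
Proof. by move=> kl; rewrite lef_pV2 ?posrE// ler_nat ltnS. Qed.

(* The part of [X] at distance at least [1/(k+1)] from [F] captures [X \ F] up to
   the tail of a convergent series of annuli. *)
Lemma closed_caratheodory (F : set V) : closed F -> caratheodory_measurable mu F.
Proof.
move=> Fcl; apply: le_caratheodory_measurable => X.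
have [->|Xfin] := eqVneq (mu X) +oo%E; first by rewrite leey.
have {}Xfin : (mu X < +oo)%E by rewrite ltey.
pose Y k := [set x | X x /\ forall f, F f -> r k <= `|x - f|].
pose Z k := Y k.+1 `\` Y k.
have YX k : Y k `<=` X by move=> x [].
have Yle k l : (k <= l)%N -> Y k `<=` Y l.
  by move=> kl x [Xx xF]; split=> // f Ff; exact: le_trans (r_le kl) (xF f Ff).
have cover k : X `&` ~` F `<=` Y k `|` \bigcup_(i in ~` `I_k) Z i.
  move=> x [Xx Fx].
  have /nbhs_ballP[e /= e0 xe] : nbhs x (~` F) by apply: open_nbhs_nbhs; split=> //; exact: closed_openC.
  have [m me] : exists m, r m < e.
    have [m] := @ltr_add_invr R 0 e e0; rewrite add0r => me.
    by exists m.
  have Ym : exists m, `[< Y m x >].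
    exists m; apply/asboolP; split=> // f Ff; rewrite leNgt; apply/negP => xf.
    have : ball x e f by rewrite -ball_normE /ball_/=; exact: lt_trans xf me.
    by move/xe; apply.
  case: (ex_minnP Ym) => -[|l] /asboolP Ylx lmin; first by left; exact: Yle Ylx.
  have [lk|kl] := ltnP l k; first by left; exact: Yle Ylx.
  right; exists l; first by apply/negP; rewrite -leqNgt.
  by split=> // /asboolP/lmin; rewrite ltnn.
have FY k : (mu (X `&` F) + mu (Y k) <= mu X)%E.
  apply: (@le_trans _ _ (mu ((X `&` F) `|` Y k))).
    apply: (@mu_metric _ _ (r k)); first by rewrite invr_gt0.
    by move=> f y [_ Ff] [_ yF]; rewrite distrC yF.
  by apply: le_outer_measure => x [[]//|[]].
(* [b] is the parity. Annuli whose indices differ by at least two are at positive distance, whereas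
   consecutive ones may touch, so the two parities are summed separately. *)
have annuli b N : (\sum_(i < N) mu (Z (i.*2 + b)%N) <= mu X)%E.
  case: N => [|N]; first by rewrite big_ord0 outer_measure_ge0.
  apply: le_trans (le_outer_measure mu _ _ (YX (N.*2 + b).+1)).
  elim: N => [|N IH].
    by rewrite big_ord1; apply: le_outer_measure => x [].
  rewrite big_ord_recr/=; apply: le_trans (leeD IH (lexx _)) _.
  apply: (@le_trans _ _ (mu (Y (N.*2 + b).+1 `|` Z (N.+1.*2 + b)%N))).
    apply: (@mu_metric _ _ (r (N.*2 + b).+1 - r (N.+1.*2 + b)%N)).
      by rewrite subr_gt0 doubleS !addSn ltf_pV2 ?posrE// ltr_nat.
    move=> x y [_ xF] [[Xy yF]] nY.
    have [f [Ff yf]] : exists f, F f /\ `|y - f| < r (N.+1.*2 + b)%N.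
      apply: contrapT => /forallNP h; apply: nY; split=> // f Ff.
      by rewrite leNgt; apply/negP => hf; apply: (h f).
    have := ler_distD y x f; have := xF f Ff; lra.
  apply: le_outer_measure => x [|[]//].
  by apply: Yle; rewrite doubleS !addSn ltnS; do !apply: leqW.
have sumZ : (\sum_(0 <= k <oo) mu (Z k) < +oo)%E.
  apply: (@le_lt_trans _ _ (mu X + mu X)%E); last exact: lte_add_pinfty.
  apply: lime_le.
    by apply: is_cvg_nneseries => *; exact: outer_measure_ge0.
  apply: nearW => N.
  apply: (@le_trans _ _ (\sum_(0 <= k < N.*2) mu (Z k))%E).
    apply: lee_sum_nneg_natr => [*|]; first exact: outer_measure_ge0.
    by rewrite -addnn leq_addr.
  have -> : (\sum_(0 <= k < N.*2) mu (Z k) =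
      \sum_(i < N) mu (Z (i.*2 + 0)%N) + \sum_(i < N) mu (Z (i.*2 + 1)%N))%E.
    elim: N => [|N IH]; first by rewrite !big_ord0 big_geq// adde0.
    rewrite doubleS !big_nat_recr//= IH !big_ord_recr/= addn0 addn1.
    by rewrite -!addeA; congr (_ + _)%E; rewrite addeCA.
  exact: leeD.
have tail := nneseries_tail_cvg sumZ (fun _ _ => outer_measure_ge0 mu _).
apply/lee_addgt0Pr => e e0.
have [k _ ke] : \forall k \near \oo, (\sum_(k <= i <oo) mu (Z i) <= e%:E)%E.
  apply: (tail [set x | (x <= e%:E)%E]).
  by apply: filterS (@nbhs_open_ereal_lt R 0 (fun=> e) e0) => x /ltW.
have {}ke := ke k (leqnn k).
have sub : (mu (X `&` ~` F) <= mu (Y k) + \sum_(k <= i <oo) mu (Z i))%E.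
  apply: le_trans (le_outer_measure mu _ _ (cover k)) _.
  apply: le_trans (outer_measureU2 _ _ _) _.
  by rewrite leeD2l// outer_measure_sigma_subadditive_tail.
apply: le_trans (leeD2l _ sub) _.
by rewrite addeA; apply: leeD.
Qed.

End caratheodory_criterion.

(** * Translation invariant metric outer measures *)

Section floorv.
Context {R : realType} {n : nat}.
Implicit Types (x y : 'rV[R]_n) (z : 'rV[int]_n) (m : nat).

(** The index of the grid cube of side [2^-m] that contains [x]. The cubes are half-open, hence
    partition the space, and measures of unions of cubes are obtained by counting. *)
Definition floorv m x : 'rV[int]_n := \row_i Num.floor (2 ^+ m * x 0 i).

Definition dyadic_cube m z : set 'rV[R]_n := floorv m @^-1` [set z].

Definition unit_cube : set 'rV[R]_n := dyadic_cube 0 0.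

Lemma dyadic_cubeP m z x : dyadic_cube m z x <->
  forall i, (z 0 i)%:~R <= 2 ^+ m * x 0 i < (z 0 i + 1)%:~R.
Proof.
split=> [<- i|xz]; first by rewrite mxE floor_itv.
by apply/rowP => i; rewrite mxE; apply/eqP; rewrite floor_eq.
Qed.

Lemma floor_double (a b : R) : Num.floor (2 * a) = Num.floor (2 * b) ->
  Num.floor a = Num.floor b.
Proof.
move=> ab; apply/esym/floor_def.
have /andP[a1 a2] := floor_itv a; have /andP[b1 b2] := floor_itv (2 * b).
have /andP[c1 c2] := floor_itv (2 * a); rewrite -ab in b1 b2.
set j := Num.floor a in a1 a2 *; set k := Num.floor (2 * a) in b1 b2 c1 c2 *.
have jk : 2 * j <= k.
  by rewrite floor_ge_int -?ler_int; rewrite intrM; lra.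
have kj : k + 1 <= 2 * (j + 1).
  by rewrite lezD1 -(@ltr_int R) intrM; lra.
move: jk kj; rewrite -!(ler_int R) !intrM !intrD => jk kj.
by apply/andP; split; lra.
Qed.

Lemma floorvS m x y : floorv m.+1 x = floorv m.+1 y -> floorv m x = floorv m y.
Proof.
move=> /rowP xy; apply/rowP => i; have := xy i; rewrite !mxE !exprS -!mulrA.
exact: floor_double.
Qed.

Lemma floorv_homo m l x y : (m <= l)%N -> floorv l x = floorv l y ->
  floorv m x = floorv m y.
Proof.
move=> /subnK <-; elim: (l - m)%N => // k IH; rewrite addSn => /floorvS; exact: IH.
Qed.

Lemma floorv_dist m x y : floorv m x = floorv m y -> `|x - y| <= 2 ^- m.
Proof.
move=> /rowP xy; apply: ler_norm_rV => [|i]; first by rewrite invr_ge0 exprn_ge0.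
have /andP[a1 a2] := floor_itv (2 ^+ m * x 0 i).
have /andP[b1 b2] := floor_itv (2 ^+ m * y 0 i).
have := xy i; rewrite !mxE => e; rewrite e in a1 a2.
rewrite -[leRHS]mul1r ler_pdivlMr ?exprn_gt0// -[X in _ * X <= _]ger0_norm ?exprn_ge0//.
rewrite -normrM mulrBl ler_norml; move: a1 a2 b1 b2; rewrite intrD.
by move=> *; apply/andP; split; lra.
Qed.

Lemma dyadic_cube_shift m z :
  dyadic_cube m z = (fun x => 2 ^- m *: map_mx intr z + x) @` dyadic_cube m 0.
Proof.
have e (a b : R) : 2 ^+ m * (2 ^- m * a + b) = a + 2 ^+ m * b.
  by rewrite mulrDr mulrA divff ?mul1r// expf_neq0.
apply/seteqP; split=> [x /dyadic_cubeP xz|_ [x /dyadic_cubeP x0 <-]].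
  exists (x - 2 ^- m *: map_mx intr z); last by rewrite addrC subrK.
  apply/dyadic_cubeP => i; have := xz i; rewrite !mxE -mulrN addrC e intrD.
  by move=> /andP[? ?]; apply/andP; split; lra.
apply/dyadic_cubeP => i; have := x0 i; rewrite !mxE e !intrD.
by move=> /andP[? ?]; apply/andP; split; lra.
Qed.

(** The indices of the subcubes of half the side of the cube at the origin. *)
Definition bits : seq 'rV[int]_n :=
  [seq \row_i ((f : {ffun 'I_n -> bool}) i : int) | f : {ffun 'I_n -> bool}].

Lemma uniq_bits : uniq bits.
Proof.
rewrite map_inj_uniq ?enum_uniq// => f g /rowP fg; apply/ffunP => i.
by have := fg i; rewrite !mxE; case: (f i); case: (g i).
Qed.

Lemma size_bits : size bits = (2 ^ n)%N.
Proof. by rewrite size_map -cardE card_ffun card_bool card_ord. Qed.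

Lemma dyadic_cube_split m : dyadic_cube m 0 = floorv m.+1 @^-1` [set` bits].
Proof.
apply/seteqP; split=> x.
  move=> /dyadic_cubeP x0; apply/mapP.
  exists [ffun i => Num.floor (2 ^+ m.+1 * x 0 i) == 1]; first by rewrite mem_enum.
  apply/rowP => i; rewrite !mxE ffunE.
  have /andP[] := x0 i; rewrite mxE add0r => a b.
  have /andP[] := floor_itv (2 ^+ m.+1 * x 0 i).
  rewrite exprS -mulrA; set k := Num.floor _; rewrite intrD => c1 c2.
  have k0 : 0 <= k by rewrite -ltzD1 -(@ltr_int R) intrD; lra.
  have k1 : k <= 1 by rewrite -ltzD1 -(@ltr_int R) intrD; lra.
  by move: k0 k1; case: eqP => //=; lia.
move=> /mapP[f _ /rowP xf]; apply/dyadic_cubeP => i; have := xf i; rewrite !mxE.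
move=> e; have /andP[] := floor_itv (2 ^+ m.+1 * x 0 i); rewrite e exprS -mulrA.
rewrite add0r intrD; case: (f i) => /= a b.
  have {}a : 1 <= 2 * (2 ^+ m * x 0 i) :> R by [].
  have {}b : 2 * (2 ^+ m * x 0 i) < 1 + 1 :> R by [].
  have: (0 : R) <= 2 ^+ m * x 0 i < 1 by apply/andP; split; lra.
  by [].
have {}a : 0 <= 2 * (2 ^+ m * x 0 i) :> R by [].
have {}b : 2 * (2 ^+ m * x 0 i) < 0 + 1 :> R by [].
have: (0 : R) <= 2 ^+ m * x 0 i < 1 by apply/andP; split; lra.
by [].
Qed.

Lemma finite_floorv m (X : set 'rV[R]_n) K :
  (forall x, X x -> `|x| <= K) -> finite_set (floorv m @` X).
Proof.
move=> XK; have K0 : K <= `|K| by rewrite ler_norm.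
pose N := (Num.truncn (2 ^+ m * `|K|)).+1.
have NK : 2 ^+ m * `|K| < N%:R by rewrite truncnS_gt.
apply: (@sub_finite_set _ _ [set` [seq (\row_i ((f i : nat)%:Z - N%:Z) : 'rV[int]_n)
    | f : {ffun 'I_n -> 'I_(N + N)}]]); last by apply/finite_seqP; eexists.
move=> _ [x Xx <-]; apply/mapP.
have fl i : - N%:Z <= Num.floor (2 ^+ m * x 0 i) < N%:Z.
  have := normr_coord x i; have := XK x Xx => h1 h2.
  have : `|2 ^+ m * x 0 i| < N%:R.
    apply: le_lt_trans NK; rewrite normrM ger0_norm ?exprn_ge0//.
    by rewrite ler_wpM2l ?exprn_ge0//; lra.
  rewrite ltr_norml => /andP[a b].
  rewrite floor_ge_int rmorphN/= (ltW a)/= -(@ltr_int R).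
  by apply: le_lt_trans b; exact: floor_le.
have lt (i : 'I_n) : (absz (Num.floor (2 ^+ m * x 0 i) + N%:Z)%R < N + N)%N.
  by have := fl i; lia.
exists [ffun i => Ordinal (lt i)]; first by rewrite mem_enum.
by apply/rowP => i; rewrite !mxE ffunE/=; have := fl i; lia.
Qed.

End floorv.

(** The zero measure qualifies too, which is why comparisons of two such measures are
    cross-multiplied by the masses of [unit_cube]. *)
Record haar_outer {R : realType} {n : nat} (mu : set 'rV[R]_n -> \bar R) : Prop := HaarOuter {
  haar_metric : metric_outer mu;
  haar_shift : forall a X, mu ((fun x => a + x) @` X) = mu X;
  haar_unit_cube : (mu unit_cube < +oo)%E }.

Definition cells {R : realType} {n : nat} m (G : set 'rV[R]_n) : set 'rV[R]_n :=
  floorv m @^-1` (floorv m @` G).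

Lemma cellsE {R : realType} {n : nat} m (G : set 'rV[R]_n) K :
  (forall x, G x -> `|x| <= K) ->
  exists2 s : seq 'rV[int]_n, uniq s & cells m G = floorv m @^-1` [set` s].
Proof.
move=> /finite_floorv-/(_ m)/finite_seqP[s sE]; exists (undup s).
  exact: undup_uniq.
by rewrite /cells sE; apply/seteqP; split=> x /=; rewrite mem_undup.
Qed.

Section haar_outer.
Context {R : realType} {n : nat} (mu : {outer_measure set 'rV[R]_n -> \bar R}).
Hypothesis mu_haar : haar_outer mu.

Let T := caratheodory_type mu.

Lemma closed_cara (F : set 'rV[R]_n) : closed F -> mu.-cara.-measurable (F : set T).
Proof. exact: (closed_caratheodory (haar_metric mu_haar)). Qed.

Lemma closed_coord_ge i (a : R) : closed [set x : 'rV[R]_n | a <= x 0 i].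
Proof.
apply: (@closed_comp _ _ (fun x : 'rV[R]_n => x 0 i) [set r : R | a <= r]).
  by move=> x _; exact: coord_continuous.
exact: closed_ge.
Qed.

Lemma dyadic_cube_cara m z : mu.-cara.-measurable (dyadic_cube m z : set T).
Proof.
pose F i (a : R) : set T := [set x : 'rV[R]_n | a <= x 0 i].
have -> : dyadic_cube m z = \bigcap_(i in [set: 'I_n])
    (F i (2 ^- m * (z 0 i)%:~R) `\` F i (2 ^- m * (z 0 i + 1)%:~R)).
  apply/seteqP; split=> x.
    move=> /dyadic_cubeP xz i _; have /andP[a b] := xz i.
    split; first by rewrite /F/= ler_pdivrMl ?exprn_gt0.
    by apply/negP; rewrite -ltNge ltr_pdivlMl ?exprn_gt0.
  move=> xz; apply/dyadic_cubeP => i; have [] := xz i I.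
  rewrite /F/= ler_pdivrMl ?exprn_gt0// => -> /negP.
  by rewrite -ltNge ltr_pdivlMl ?exprn_gt0.
apply: fin_bigcap_measurable; first exact: finite_finset.
by move=> i _; apply: measurableD; apply: closed_cara; exact: closed_coord_ge.
Qed.

Lemma dyadic_cube_mu m z : mu (dyadic_cube m z) = mu (dyadic_cube m 0).
Proof. by rewrite dyadic_cube_shift (haar_shift mu_haar). Qed.

Lemma cells_cara m (s : seq 'rV[int]_n) :
  mu.-cara.-measurable (floorv m @^-1` [set` s] : set T).
Proof.
elim: s => [|z s IH].
  by rewrite (_ : _ @^-1` _ = set0); [exact: measurable0|apply/seteqP; split].
rewrite (_ : _ @^-1` _ = dyadic_cube m z `|` floorv m @^-1` [set` s]).
  by apply: measurableU => //; exact: dyadic_cube_cara.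
apply/seteqP; split=> x /=; rewrite inE.
  by case/orP => [/eqP|]; [left|right].
by case=> [->|->]; rewrite ?eqxx ?orbT.
Qed.

Lemma cells_mu m (s : seq 'rV[int]_n) : uniq s ->
  mu (floorv m @^-1` [set` s]) = ((size s)%:R%:E * mu (dyadic_cube m 0))%E.
Proof.
elim: s => [_|z s IH /= /andP[zs us]].
  rewrite mul0e (_ : _ @^-1` _ = set0) ?outer_measure0//.
  by apply/seteqP; split.
rewrite (_ : _ @^-1` _ = dyadic_cube m z `|` floorv m @^-1` [set` s]); last first.
  apply/seteqP; split=> x /=; rewrite inE.
    by case/orP => [/eqP|]; [left|right].
  by case=> [->|->]; rewrite ?eqxx ?orbT.
have := @measureU _ _ _ (mu : {measure set T -> \bar R}).
move=> /(_ _ _ (dyadic_cube_cara m z) (cells_cara m s)) ->.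
  rewrite [X in (X + _)%E](_ : _ = mu (dyadic_cube m z))//.
  rewrite [X in (_ + X)%E](_ : _ = mu (floorv m @^-1` [set` s]))// IH//.
  by rewrite dyadic_cube_mu -{1}[mu _]mul1e -ge0_muleDl// -EFinD nat1r.
apply/seteqP; split=> // x [/= -> ]; exact/negP.
Qed.

Let dyadic_cubeS_mu m :
  mu (dyadic_cube m 0) = ((2 ^+ n)%:E * mu (dyadic_cube m.+1 0))%E.
Proof. by rewrite dyadic_cube_split cells_mu ?uniq_bits// size_bits natrX. Qed.

Lemma dyadic_cube_mu0 m : mu (dyadic_cube m 0) =
  ((2 ^+ n) ^- m * fine (mu unit_cube))%:E.
Proof.
have fin k : mu (dyadic_cube k 0) \is a fin_num.
  rewrite ge0_fin_numE ?outer_measure_ge0//; elim: k => [|k].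
    exact: haar_unit_cube.
  rewrite dyadic_cubeS_mu; apply: contraTT; rewrite -!leNgt !leye_eq => /eqP ->.
  by rewrite gt0_muley ?lte_fin ?exprn_gt0.
suff -> : fine (mu unit_cube) = (2 ^+ n) ^+ m * fine (mu (dyadic_cube m 0)).
  by rewrite mulrA mulVf ?mul1r ?fineK// !expf_neq0.
elim: m => [|m ->]; first by rewrite mul1r.
by rewrite dyadic_cubeS_mu fineM//= exprS mulrCA mulrA.
Qed.

Lemma haar_bounded (G : set 'rV[R]_n) K : (forall x, G x -> `|x| <= K) ->
  (mu G < +oo)%E.
Proof.
move=> GK; have [s us sE] := cellsE 0 GK.
apply: (@le_lt_trans _ _ (mu (cells 0 G))); last first.
  by rewrite sE cells_mu// dyadic_cube_mu0 -EFinM ltey.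
by apply: le_outer_measure => x Gx; exists x.
Qed.

(** A closed set is the decreasing intersection of its grid covers, and a bounded one has grid
    covers of finite mass, so continuity from above applies. *)
Lemma cells_cvg (G : set 'rV[R]_n) K : closed G -> (forall x, G x -> `|x| <= K) ->
  mu (cells m G) @[m --> \oo] --> mu G.
Proof.
move=> Gcl GK.
have GE : \bigcap_m cells m G = G.
  apply/seteqP; split=> [x xG|x Gx m _]; last by exists x.
  apply: Gcl => B /nbhs_ballP[e /= e0 eB].
  have [m me] : exists m, 2 ^- m < e.
    exists (Num.truncn e^-1).+1.
    rewrite -[ltRHS]invrK ltf_pV2 ?posrE ?invr_gt0 ?exprn_gt0//.
    apply: lt_trans (truncnS_gt _) _.
    by rewrite -natrX ltr_nat ltn_expl.
  have [g Gg gx] := xG m I; exists g; split=> //; apply: eB.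
  by rewrite -ball_normE/=; apply: le_lt_trans me; apply: floorv_dist.
have := @nonincreasing_cvg_mu _ T R mu (fun m => cells m G).
rewrite GE; apply.
- apply: (@haar_bounded _ (K + 1)) => x [g Gg /floorv_dist]; rewrite expr0 invr1.
  by have := GK g Gg; have := ler_distD g x 0; rewrite !subr0 (distrC x); lra.
- move=> m; have [s _ ->] := cellsE m GK; exact: cells_cara.
- exact: closed_cara.
- move=> m l ml; apply/subsetPset => x [g Gg gx]; exists g => //.
  exact: floorv_homo ml gx.
Qed.

End haar_outer.

(** On a grid cover both measures are the same number of cubes times the mass of one cube, and that
    mass is the same power of two times the mass of [unit_cube]. The identity passes to the limit of
    the covers. *)
Lemma haar_unique {R : realType} {n : nat}
    (mu nu : {outer_measure set 'rV[R]_n -> \bar R}) (G : set 'rV[R]_n) K :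
  haar_outer mu -> haar_outer nu -> closed G -> (forall x, G x -> `|x| <= K) ->
  fine (mu unit_cube) * fine (nu G) = fine (nu unit_cube) * fine (mu G).
Proof.
move=> hmu hnu Gcl GK.
have muG := cells_cvg hmu Gcl GK; have nuG := cells_cvg hnu Gcl GK.
have fm : mu G \is a fin_num.
  by rewrite ge0_fin_numE ?outer_measure_ge0//; exact: haar_bounded GK.
have fn : nu G \is a fin_num.
  by rewrite ge0_fin_numE ?outer_measure_ge0//; exact: haar_bounded GK.
have {}muG : fine (nu unit_cube) * fine (mu (cells m G)) @[m --> \oo] -->
    fine (nu unit_cube) * fine (mu G).
  by apply: cvgMl_tmp; apply: fine_cvg; rewrite fineK.
have {}nuG : fine (mu unit_cube) * fine (nu (cells m G)) @[m --> \oo] -->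
    fine (mu unit_cube) * fine (nu G).
  by apply: cvgMl_tmp; apply: fine_cvg; rewrite fineK.
have E : (fun m => fine (nu unit_cube) * fine (mu (cells m G))) =
         (fun m => fine (mu unit_cube) * fine (nu (cells m G))).
  apply/funext => m; have [s us ->] := cellsE m GK.
  have comm (a b c e : R) : a * (c * (e * b)) = b * (c * (e * a)) by ring.
  rewrite (cells_mu hmu _ us) (cells_mu hnu _ us) (dyadic_cube_mu0 hmu).
  by rewrite (dyadic_cube_mu0 hnu) -!EFinM/= comm.
by rewrite -(cvg_lim (@Rhausdorff R) nuG) -(cvg_lim (@Rhausdorff R) muG) E.
Qed.

(** * Hausdorff measure of linear images and of flat sets *)

Section hausdorff_unit_cube.
Context {R : realType} {n : nat}.
Hypothesis n0 : (0 < n)%N.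

Lemma unit_cube_sub m : exists2 s : seq 'rV[int]_n, size s = ((2 ^ m) ^ n)%N &
  (unit_cube : set 'rV[R]_n) `<=` floorv m @^-1` [set` s].
Proof.
exists [seq (\row_i (f i : nat)%:Z : 'rV[int]_n) | f : {ffun 'I_n -> 'I_(2 ^ m)}].
  by rewrite size_map -cardE card_ffun !card_ord.
move=> x /dyadic_cubeP x0; apply/mapP.
have fl i : 0 <= Num.floor (2 ^+ m * x 0 i) < (2 ^ m)%N%:Z.
  have /andP[] := x0 i; rewrite mxE add0r mul1r => a b.
  rewrite floor_ge0 mulr_ge0 ?exprn_ge0//= -(@ltr_int R).
  apply: le_lt_trans (floor_le _) _.
  by rewrite -pmulrn natrX gtr_pMr// exprn_gt0.
have lt (i : 'I_n) : (absz (Num.floor (2 ^+ m * x 0 i)%R) < 2 ^ m)%N.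
  by have := fl i; case: (Num.floor _).
exists [ffun i => Ordinal (lt i)]; first by rewrite mem_enum.
by apply/rowP => i; rewrite !mxE ffunE/= gez0_abs//; case/andP: (fl i).
Qed.

(** The cube is covered by [(2 ^ m) ^ n] cubes of diameter at most [sqrt n * 2^-m]; the powers of
    two cancel and leave a bound independent of [m]. *)
Lemma hausdorff_unit_cube : (hausdorff n (unit_cube : set 'rV[R]_n) < +oo)%E.
Proof.
pose c : R := unit_ball_volume R n / 2 ^+ n; pose q : R := Num.sqrt n%:R.
have c0 : 0 <= c by rewrite divr_ge0 ?exprn_ge0// ltW// unit_ball_volume_gt0.
apply: (@le_lt_trans _ _ (c * q ^+ n)%:E); last by rewrite ltey.
apply: ge_ereal_sup => _ [d /= d0 <-].
have one_expe : ((1 : \bar R) ^+ n = 1)%E by rewrite -EFin_expe expr1n.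
have [m md] : exists m, q * 2 ^- m <= d.
  exists (Num.truncn (q / d)).+1.
  rewrite ler_pdivrMr ?exprn_gt0// mulrC -ler_pdivrMr//.
  apply/ltW; apply: lt_trans (truncnS_gt _) _.
  by rewrite -natrX ltr_nat ltn_expl.
have [s sz sub] := unit_cube_sub m.
pose C i := if (i < size s)%N then dyadic_cube m (nth 0 s i) : set 'rV[R]_n else set0.
have Cd i : (ediam (C i) <= (q * 2 ^- m)%:E)%E.
  rewrite /C; case: ifP => _; last first.
    by rewrite ediam0 lee_fin mulr_ge0 ?sqrtr_ge0// invr_ge0 exprn_ge0.
  apply: ediam_le => [|x y xC yC].
    by rewrite lee_fin mulr_ge0 ?sqrtr_ge0// invr_ge0 exprn_ge0.
  rewrite lee_fin; apply: le_trans (enorm_le_norm _) _.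
  by rewrite ler_wpM2l ?sqrtr_ge0//; apply: floorv_dist; rewrite xC yC.
apply: (@le_trans _ _ (\sum_(0 <= i <oo) c%:E * ediam (C i) ^+ n)%E).
  apply: ereal_inf_lbound; exists C => //; split=> [i|x /sub/= xs].
    by apply: le_trans (Cd i) _; rewrite lee_fin.
  exists (index (floorv m x) s) => //; rewrite /C index_mem xs.
  by rewrite /dyadic_cube/= nth_index.
rewrite (nneseries_split _ (size s)); last first.
  by move=> k _; rewrite mule_ge0 ?lee_fin// expe_ge0// ediam_ge0.
rewrite add0n [X in (_ + X)%E]eseries0 ?adde0; last first.
  move=> k; rewrite leqNgt => /negbTE ks _; rewrite /C ks ediam0.
  by case: n n0 => // ? _; rewrite expeS mul0e mule0.
apply: (@le_trans _ _ (\sum_(0 <= i < size s) (c * (q ^+ n * (2 ^- m) ^+ n))%:E)%E).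
  apply: lee_sum => i _; rewrite (EFinM c) lee_wpmul2l ?lee_fin//.
  rewrite -exprMn -[leRHS]mule1 -[X in (_ * X)%E]one_expe.
  apply: lee_expeM; rewrite ?ediam_ge0// ?mule1//.
  by rewrite mulr_ge0 ?sqrtr_ge0// invr_ge0 exprn_ge0.
rewrite sumEFin lee_fin big_const_nat subn0 iter_addr addr0 sz -[leLHS]mulr_natr.
rewrite !natrX exprVn -!mulrA mulVf ?mulr1// !expf_neq0.
Qed.

End hausdorff_unit_cube.

Section linear_image.
Context {R : realType} {n d : nat}.
Implicit Types (M : 'M[R]_(n.+1, d)) (X : set 'rV[R]_n.+1).

(* The [n+1]-dimensional Hausdorff measure seen through the parametrization
   [x |-> x *m M] of an [n+1]-dimensional subspace. *)
Definition hausdorff_lin M X : \bar R := hausdorff n.+1 ((fun x => x *m M) @` X).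

Let hausdorff_lin0 M : hausdorff_lin M set0 = 0%E.
Proof. by rewrite /hausdorff_lin image_set0 hausdorff_set0. Qed.

Let hausdorff_lin_ge0 M X : (0 <= hausdorff_lin M X)%E.
Proof. exact: hausdorff_ge0. Qed.

Let le_hausdorff_lin M : {homo hausdorff_lin M : A B / A `<=` B >-> (A <= B)%E}.
Proof. by move=> A B AB; apply: le_hausdorff; apply: image_subset. Qed.

Let hausdorff_lin_sigma_subadditive M : sigma_subadditive (hausdorff_lin M).
Proof.
by move=> F; rewrite /hausdorff_lin image_bigcup; exact: hausdorff_sigma_subadditive.
Qed.

HB.instance Definition _ M := isOuterMeasure.Build R 'rV[R]_n.+1 (hausdorff_lin M)
  (hausdorff_lin0 M) (hausdorff_lin_ge0 M) (@le_hausdorff_lin M)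
  (@hausdorff_lin_sigma_subadditive M).

Lemma mulmx_bounded (a b : nat) (N : 'M[R]_(a, b)) :
  exists2 C : R, 0 < C & forall x : 'rV_a, `|x *m N| <= C * `|x|.
Proof.
pose C := 1 + \sum_i \sum_j `|N i j|.
have C0 : 0 < C by rewrite ltr_pwDl// !sumr_ge0// => i _; rewrite sumr_ge0.
exists C => // x; apply: ler_norm_rV => [|j]; first by rewrite mulr_ge0// ltW.
rewrite mxE (le_trans (ler_norm_sum _ _ _))//.
apply: (@le_trans _ _ (\sum_i `|N i j| * `|x|)).
  by apply: ler_sum => i _; rewrite normrM mulrC ler_wpM2l ?normr_coord.
rewrite -mulr_suml ler_wpM2r//; apply: (@le_trans _ _ (\sum_i \sum_j `|N i j|)).
  by apply: ler_sum => i _; rewrite (bigD1 j)//= lerDl sumr_ge0.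
by rewrite lerDr.
Qed.

(** A right inverse of [M] bounds distances of images from below, so separated sets stay separated.
    Shifts of the parameter are isometries of the image, and [M] is Lipschitz, which gives finite
    mass to the unit cube. *)
Lemma haar_hausdorff_lin M : row_free M -> haar_outer (hausdorff_lin M).
Proof.
move=> /row_freeP[N MN]; split.
- have [C C0 NC] := mulmx_bounded N.
  move=> A B e e0 AB; rewrite /hausdorff_lin image_setU.
  apply: (@hausdorff_separated _ _ _ _ _ _ (C^-1 * e)); rewrite ?mulr_gt0 ?invr_gt0//.
  move=> _ _ [x Ax <-] [y By <-]; rewrite -mulmxBl.
  apply: le_trans (norm_le_enorm _); rewrite ler_pdivrMl//.
  apply: le_trans (NC _); rewrite -mulmxA MN mulmx1; exact: AB.
- have shift_le (a : 'rV[R]_n.+1) X :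
      (hausdorff_lin M ((fun x => (a + x)%R) @` X) <= hausdorff_lin M X)%E.
    rewrite /hausdorff_lin image_comp -[leRHS]mul1e -(expr1n _ n.+1).
    apply: lipschitz_hausdorff => // x y _ _ /=.
    by rewrite mul1r -!mulmxBl opprD addrACA subrr add0r.
  move=> a X; apply/eqP; rewrite eq_le shift_le/=.
  have := shift_le (- a) ((fun x => a + x) @` X); rewrite image_comp.
  by rewrite (_ : _ \o _ = id) ?image_id//; apply/funext => x /=; rewrite addKr.
- have [C C0 MC] := mulmx_bounded M; pose L := Num.sqrt d%:R * C + 1.
  have L0 : 0 < L by rewrite ltr_wpDl// mulr_ge0 ?sqrtr_ge0// ltW.
  apply: (@le_lt_trans _ _ ((L ^+ n.+1)%:E * hausdorff n.+1 (id @` unit_cube))%E).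
    apply: lipschitz_hausdorff => // x y _ _; rewrite -mulmxBl.
    apply: le_trans (enorm_le_norm _) _.
    apply: (@le_trans _ _ (Num.sqrt d%:R * C * `|x - y|)).
      by rewrite -mulrA ler_wpM2l ?sqrtr_ge0.
    apply: ler_pM; rewrite ?norm_le_enorm// ?lerDl//.
    by rewrite mulr_ge0 ?sqrtr_ge0// ltW.
  by rewrite image_id lte_mul_pinfty ?lee_fin ?exprn_ge0 ?(ltW L0)// hausdorff_unit_cube.
Qed.

End linear_image.

Lemma mulmx_continuous {R : realType} {a b : nat} (M : 'M[R]_(a, b)) :
  continuous (fun x : 'rV[R]_a => x *m M).
Proof.
have [C C0 MC] := mulmx_bounded M.
move=> x A /nbhs_ballP[e /= e0 eA]; apply/nbhs_ballP; exists (e / C).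
  by rewrite /= divr_gt0.
move=> y; rewrite -ball_normE /= => xy; apply: eA; rewrite -ball_normE /=.
by rewrite -mulmxBl (le_lt_trans (MC _))// mulrC -ltr_pdivlMr.
Qed.

Lemma compact_mulmx {R : realType} {a b : nat} (M : 'M[R]_(a, b)) (G : set 'rV[R]_a) :
  compact G -> compact ((fun x => x *m M) @` G).
Proof.
move=> Gc; apply: continuous_compact => //; apply: continuous_subspaceT.
exact: mulmx_continuous.
Qed.

Lemma dot_continuous {R : realType} {n : nat} (a : 'rV[R]_n) : continuous (dot a).
Proof.
apply: continuous_big => [|j _ x]; first exact: add_continuous.
by apply: continuousM; [exact: cst_continuous|exact: coord_continuous].
Qed.

(** * Null sets of invariant outer measures *)

Section haar_null.
Context {R : realType} {n : nat} (mu : {outer_measure set 'rV[R]_n -> \bar R}).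
Hypothesis mu_haar : haar_outer mu.

Lemma haar_null_bounded (G : set 'rV[R]_n) K : fine (mu unit_cube) = 0 ->
  (forall x, G x -> `|x| <= K) -> mu G = 0%E.
Proof.
move=> mu0 GK; have [s us sE] := cellsE 0 GK.
apply/eqP; rewrite eq_le outer_measure_ge0 andbT.
apply: (@le_trans _ _ (mu (cells 0 G))).
  by apply: le_outer_measure => x Gx; exists x.
by rewrite sE (cells_mu mu_haar _ us) (dyadic_cube_mu0 mu_haar) mu0 mulr0 mule0.
Qed.

(* A bounded piece of a hyperplane has infinitely many disjoint translates in a
   bounded set. *)
Lemma haar_hyperplane (a : 'rV[R]_n) b K : a != 0 ->
  mu [set x | dot a x = b /\ `|x| <= K] = 0%E.
Proof.
move=> a0; set X := [set x | _].
have [i ai] : exists i, a 0 i != 0.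
  apply/existsP; apply: contraNT a0; rewrite negb_exists => /forallP a0.
  by apply/eqP/rowP => i; rewrite mxE; apply/eqP/negbNE/a0.
pose e : 'rV[R]_n := delta_mx 0 i.
have ae : dot a e = a 0 i.
  rewrite /dot (bigD1 i)//= mxE !eqxx mulr1 big1 ?addr0// => j ji.
  by rewrite mxE eqxx (negbTE ji) mulr0.
have e1 : `|e| <= 1.
  apply: ler_norm_rV => // j; rewrite mxE eqxx/=.
  by case: (_ == _); rewrite ?normr1 ?normr0.
have Xcl : closed X.
  apply: closedI.
    apply: (@closed_comp _ _ (dot a) [set r : R | r = b]) => [x _|].
      exact: dot_continuous.
    exact: closed_eq.
  apply: (@closed_comp _ _ (fun x : 'rV[R]_n => `|x|) [set r : R | r <= K]) => [x _|].
    exact: norm_continuous.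
  exact: closed_le.
pose Y (k : nat) := (fun x => k.+1%:R^-1 *: e + x) @` X.
have Ycl k : closed (Y k).
  rewrite (_ : Y k = (fun x => x - k.+1%:R^-1 *: e) @^-1` X).
    apply: (@closed_comp _ _ (fun x : 'rV[R]_n => x - k.+1%:R^-1 *: e) X) => // x _.
    exact: (cvgB cvg_id (cvg_cst _)).
  apply/seteqP; split=> [_ [x Xx <-]|x Xx]; first by rewrite /= addrC addKr.
  by exists (x - k.+1%:R^-1 *: e) => //; rewrite addrC subrK.
pose B := [set x : 'rV[R]_n | `|x| <= K + 1].
have XK : (mu B < +oo)%E by apply: (@haar_bounded _ _ _ mu_haar _ (K + 1)).
have XY N : (N%:R%:E * mu X <= mu B)%E.
  have := @measure_bigsetU_ord _ _ _ (mu : {measure set (caratheodory_type mu) -> \bar R})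
    N xpredT (fun k : 'I_N => Y k).
  move=> /(_ (fun k => closed_cara mu_haar (Ycl k))) mU.
  apply: (@le_trans _ _ (mu (\big[setU/set0]_(k < N) Y k))); last first.
    apply: le_outer_measure => x; rewrite -bigcup_mkord => -[k _ [y [_ yK] <-]] /=.
    apply: le_trans (ler_normD _ _) _; rewrite addrC lerD// normrZ.
    rewrite -[leRHS]mulr1 ler_pM// ger0_norm ?invr_ge0// invf_le1//.
    by rewrite ler1n.
  rewrite [leRHS]mU; last first.
    apply/trivIsetP => /= j k _ _ jk; apply/seteqP; split=> // x [[y [yb _] <-]].
    move=> [z [zb _]] /(congr1 (dot a)); rewrite !dotDr !dotZr yb zb ae => /addIr.
    move=> /(mulIf ai)/invr_inj/eqP; rewrite eqr_nat eqSS => /eqP kj.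
    by move/eqP : jk; apply; exact/val_inj.
  rewrite (eq_bigr (fun=> mu X)) => [|k _]; last exact: (haar_shift mu_haar).
  elim: {mU} N => [|N IH]; first by rewrite mul0e big_ord0.
  by rewrite big_ord_recr/= -natr1 EFinD ge0_muleDl ?lee_fin// mul1e leeD.
have Xfin : mu X \is a fin_num.
  by rewrite ge0_fin_numE ?outer_measure_ge0//; apply: (@haar_bounded _ _ _ mu_haar _ K) => x [].
have Kfin : mu B \is a fin_num.
  by rewrite ge0_fin_numE ?outer_measure_ge0.
rewrite -(fineK Xfin); congr (_ %:E); apply/eqP; apply: contraT => X0.
have {X0}Xpos : 0 < fine (mu X) by rewrite lt_def X0 fine_ge0// outer_measure_ge0.
pose N := (Num.truncn (fine (mu B) / fine (mu X))).+1.
have := XY N; rewrite -(fineK Xfin) -(fineK Kfin) -EFinM lee_fin leNgt => /negP[].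
by rewrite -ltr_pdivrMr// truncnS_gt.
Qed.

End haar_null.

(** * Area factors of linear parametrizations *)

Section hausdorff_lin_theory.
Context {R : realType} {n : nat}.
Local Notation N := n.+1.

Lemma dot_mulmx d (M : 'M[R]_(N, d)) (x y : 'rV[R]_N) :
  dot (x *m M) (y *m M) = (x *m (M *m M^T) *m y^T) 0 0.
Proof.
rewrite mulmxA -mulmxA -trmx_mul [RHS]mxE; apply: eq_bigr => i _.
by congr (_ * _); rewrite [RHS]mxE.
Qed.

(** The Gram matrix determines all distances between image points, so the two images are
    isometric. *)
Lemma hausdorff_lin_gram d d' (M : 'M[R]_(N, d)) (M' : 'M[R]_(N, d')) X :
  M *m M^T = M' *m M'^T -> hausdorff_lin M X = hausdorff_lin M' X.
Proof.
move=> MM'; have eqn x y : enorm (x *m M - y *m M) = enorm (x *m M' - y *m M').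
  by rewrite -!mulmxBl /enorm !dot_mulmx MM'.
apply/eqP; rewrite eq_le; apply/andP; split; rewrite /hausdorff_lin -[leRHS]mul1e
  -(expr1n R N); by apply: lipschitz_hausdorff => // x y _ _; rewrite mul1r eqn.
Qed.

Lemma hausdorff_lin_mul d (A : 'M[R]_N) (M : 'M[R]_(N, d)) X :
  hausdorff_lin (A *m M) X = hausdorff_lin M ((fun x => x *m A) @` X).
Proof.
rewrite /hausdorff_lin image_comp; congr (hausdorff _ _).
by apply: eq_imagel => x _ /=; rewrite mulmxA.
Qed.

(** A compact set containing the half-open [unit_cube], on which [vol_ratioP] can be evaluated and
    inverted. *)
Definition unit_box : set 'rV[R]_N := [set x | forall i, 0 <= x 0 i <= 1].

Lemma unit_boxE : unit_box = [set x | forall i, `[(0 : R), 1]%classic (x 0 i)].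
Proof. by apply/seteqP; split=> x xb i; have := xb i; rewrite /= in_itv. Qed.

Lemma unit_box_compact : compact unit_box.
Proof.
rewrite unit_boxE; apply: (@rV_compact _ _ (fun=> `[(0 : R), 1]%classic)) => i.
exact: segment_compact.
Qed.

Lemma compact_bound (G : set 'rV[R]_N) : compact G ->
  closed G /\ exists K, forall x, G x -> `|x| <= K.
Proof.
move=> Gc; split; first by apply: compact_closed Gc; exact: norm_hausdorff.
have [M [_ MG]] := compact_bounded Gc; exists (M + 1) => x Gx.
by apply: MG Gx; rewrite ltrDl.
Qed.

Local Notation c := (fine (hausdorff_lin (1%:M : 'M[R]_N) unit_cube)).

(** For a row-free [M] and nonzero mass of the unit cube this is the classical area factor, the
    square root of the Gram determinant of [M]. *)
Definition vol_ratio d (M : 'M[R]_(N, d)) : R := fine (hausdorff_lin M unit_cube) / c.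

Hypothesis c0 : c != 0.

Lemma vol_ratioP d (M : 'M[R]_(N, d)) G : row_free M -> compact G ->
  fine (hausdorff_lin M G) = vol_ratio M * fine (hausdorff_lin (1%:M : 'M[R]_N) G).
Proof.
move=> fM /compact_bound[Gcl [K GK]].
have h1 : haar_outer (hausdorff_lin (1%:M : 'M[R]_N)).
  by apply: haar_hausdorff_lin; rewrite row_free_unit unitmx1.
have := haar_unique h1 (haar_hausdorff_lin fM) Gcl GK.
by rewrite /vol_ratio mulrAC => <-; rewrite mulrAC divff// mul1r.
Qed.

Let box_neq0 : fine (hausdorff_lin (1%:M : 'M[R]_N) unit_box) != 0.
Proof.
have h1 : haar_outer (hausdorff_lin (1%:M : 'M[R]_N)).
  by apply: haar_hausdorff_lin; rewrite row_free_unit unitmx1.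
have [_ [K bK]] := compact_bound unit_box_compact.
have bfin := haar_bounded h1 bK.
rewrite gt_eqF//; apply: (@lt_le_trans _ _ c).
  by rewrite lt_def c0/= fine_ge0// outer_measure_ge0.
apply: fine_le; rewrite ?ge0_fin_numE ?outer_measure_ge0//.
  exact: haar_unit_cube h1.
apply: le_outer_measure => x /dyadic_cubeP x0 i; have := x0 i.
by rewrite mxE add0r mul1r => /andP[-> /ltW].
Qed.

Lemma vol_ratio_eq d (M : 'M[R]_(N, d)) r : row_free M ->
  fine (hausdorff_lin M unit_box) = r * fine (hausdorff_lin (1%:M : 'M[R]_N) unit_box) ->
  vol_ratio M = r.
Proof.
by move=> fM; rewrite (vol_ratioP fM unit_box_compact) => /(mulIf box_neq0).
Qed.

Lemma vol_ratio_mul d (A : 'M[R]_N) (M : 'M[R]_(N, d)) : A \in unitmx -> row_free M ->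
  vol_ratio (A *m M) = vol_ratio A * vol_ratio M.
Proof.
move=> uA fM; apply: vol_ratio_eq; first by rewrite /row_free mxrankMfree// mxrank_unit.
have fA : row_free A by rewrite row_free_unit.
rewrite hausdorff_lin_mul (vol_ratioP fM (compact_mulmx (M := A) unit_box_compact)).
rewrite -(hausdorff_lin_mul A 1%:M) mulmx1 (vol_ratioP fA unit_box_compact).
by rewrite mulrCA mulrA.
Qed.

Lemma vol_ratio_gram d d' (M : 'M[R]_(N, d)) (M' : 'M[R]_(N, d')) :
  M *m M^T = M' *m M'^T -> vol_ratio M = vol_ratio M'.
Proof. by move=> MM'; rewrite /vol_ratio (hausdorff_lin_gram _ MM'). Qed.

Lemma vol_ratio1 : vol_ratio (1%:M : 'M[R]_N) = 1.
Proof. by rewrite /vol_ratio divff. Qed.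

Lemma vol_ratio_orth (S : 'M[R]_N) : S *m S^T = 1%:M -> vol_ratio S = 1.
Proof. by move=> SS; rewrite -vol_ratio1; apply: vol_ratio_gram; rewrite SS trmx1 mulmx1. Qed.

(** Distances scale by exactly [t], so the Lipschitz estimate used for the dilation and for its
    inverse gives equality. *)
Lemma vol_ratio_scalar t : 0 < t -> vol_ratio (t%:M : 'M[R]_N) = t ^+ N.
Proof.
move=> t0.
have tu : (t%:M : 'M[R]_N) \in unitmx by rewrite -scalemx1 unitmxZ ?unitmx1// unitfE gt_eqF.
have h1 : haar_outer (hausdorff_lin (1%:M : 'M[R]_N)).
  by apply: haar_hausdorff_lin; rewrite row_free_unit unitmx1.
apply: vol_ratio_eq; first by rewrite row_free_unit.
suff -> : hausdorff_lin (t%:M : 'M[R]_N) unit_box =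
    ((t ^+ N)%:E * hausdorff_lin (1%:M : 'M[R]_N) unit_box)%E.
  rewrite fineM//; have [_ [K bK]] := compact_bound unit_box_compact.
  by rewrite ge0_fin_numE ?outer_measure_ge0//; exact: haar_bounded h1 _ _ bK.
have nt x y : enorm (x *m (t%:M : 'M[R]_N) - y *m t%:M) =
    t * enorm (x *m (1%:M : 'M[R]_N) - y *m 1%:M).
  by rewrite -!mulmxBl mulmx1 mul_mx_scalar enormZ gtr0_norm.
apply/eqP; rewrite eq_le; apply/andP; split.
  by apply: lipschitz_hausdorff => // x y _ _; rewrite nt.
rewrite -lee_pdivlMl ?exprn_gt0// -exprVn.
apply: lipschitz_hausdorff; rewrite ?invr_gt0// => x y _ _.
by rewrite nt mulKf// gt_eqF.
Qed.

Definition stretch (i : 'I_N) (t : R) : 'M[R]_N := diag_mx (\row_j if j == i then t else 1).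

Lemma stretch_unit i t : 0 < t -> stretch i t \in unitmx.
Proof.
move=> t0; rewrite unitmxE det_diag unitfE.
by apply/prodf_neq0 => j _; rewrite mxE; case: ifP => _; rewrite ?oner_neq0 ?gt_eqF.
Qed.

(** Stretches along different axes are conjugate by transpositions, which are isometries, so they
    share one factor. The product of all of them is the dilation by [t], whose factor is [t ^+ N];
    nonnegativity selects the root. *)
Lemma vol_ratio_stretch i t : 0 < t -> vol_ratio (stretch i t) = t.
Proof.
move=> t0.
have conj j : vol_ratio (stretch j t) = vol_ratio (stretch ord0 t).
  pose P : 'M[R]_N := tperm_mx j ord0.
  have PT : P^T = P by rewrite /P /tperm_mx tr_perm_mx tpermV.
  have PP : P *m P = 1%:M.
    by rewrite /P /tperm_mx -perm_mxM tperm2 perm_mx1.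
  have -> : stretch j t = P *m (stretch ord0 t *m P).
    have PE A : A *m P = col_perm (tperm j ord0) A by rewrite col_permE tpermV.
    rewrite PE /P /tperm_mx -row_permE; apply/matrixP => k l; rewrite !mxE.
    rewrite (inj_eq perm_inj); by rewrite -{2}(tpermL j ord0) (inj_eq perm_inj).
  have Pu : P \in unitmx by case/mulmx1_unit: PP.
  rewrite vol_ratio_mul ?row_free_unit ?unitmx_mul ?stretch_unit ?Pu//.
  rewrite vol_ratio_mul ?row_free_unit ?stretch_unit//.
  by rewrite vol_ratio_orth ?PT// mul1r mulr1.
pose D k : 'M[R]_N := diag_mx (\row_j if (j < k)%N then t else 1).
have Du k : D k \in unitmx.
  rewrite unitmxE det_diag unitfE.
  by apply/prodf_neq0 => j _; rewrite mxE; case: ifP => _; rewrite ?oner_neq0 ?gt_eqF.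
have Dk k : (k <= N)%N -> vol_ratio (D k) = vol_ratio (stretch ord0 t) ^+ k.
  elim: k => [_|k IH kN].
    rewrite expr0 (_ : D 0%N = 1%:M) ?vol_ratio1// -diag_const_mx; congr diag_mx.
    by apply/rowP => j; rewrite !mxE ltn0.
  rewrite (_ : D k.+1 = stretch (Ordinal kN) t *m D k).
    by rewrite vol_ratio_mul ?stretch_unit ?row_free_unit// conj IH 1?ltnW// exprS.
  rewrite mulmx_diag; congr diag_mx; apply/rowP => j; rewrite !mxE.
  rewrite -val_eqE/= ltnS; case: ltngtP => //; rewrite ?mulr1 ?mul1r//.
have := Dk N (leqnn N); rewrite (_ : D N = t%:M); last first.
  by rewrite -diag_const_mx; congr diag_mx; apply/rowP => j; rewrite !mxE ltn_ord.
rewrite vol_ratio_scalar// conj => /eqP; rewrite eqrXn2 ?(ltW t0)//.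
  by move=> /eqP.
by rewrite /vol_ratio divr_ge0// fine_ge0// outer_measure_ge0.
Qed.

(* A reflection exchanging [a] and [|a| e_0]. *)
Lemma householder (a : 'rV[R]_N) : exists S : 'M[R]_N,
  [/\ S *m S^T = 1%:M, S^T = S & a *m S = enorm a *: delta_mx 0 ord0].
Proof.
set e : 'rV[R]_N := _ *: delta_mx 0 ord0.
have [w wE] : {w | w = a - e} by exists (a - e).
have ee : dot e e = dot a a.
  rewrite dotZl dotZr mulrA -expr2 sqr_enorm -[RHS]mulr1; congr (_ * _).
  rewrite /dot (bigD1 ord0)//= mxE !eqxx mulr1 big1 ?addr0// => j j0.
  by rewrite mxE eqxx (negbTE j0) mulr0.
have [w0|w0] := eqVneq w 0.
  exists 1%:M; rewrite trmx1 mulmx1; split=> //; rewrite mulmx1.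
  by apply: subr0_eq; rewrite -wE.
have ww0 : dot w w != 0 by rewrite dot_eq0.
(* As [e] and [a] have equal length, the reflection in the hyperplane orthogonal to [w = a - e]
   sends [a] to [e]. *)
have ww : dot w w = 2 * dot a w.
  rewrite wE !(dotDl, dotDr, dotNl, dotNr) ee (dotC e); ring.
have dotE (x y : 'rV[R]_N) : x *m y^T = (dot x y)%:M.
  apply/rowP => j; rewrite !ord1 !mxE eqxx mulr1n.
  by apply: eq_bigr => i _; rewrite mxE.
pose S : 'M[R]_N := 1%:M - (2 / dot w w) *: (w^T *m w).
have ST : S^T = S.
  by rewrite /S linearB/= trmx1 linearZ/= trmx_mul trmxK.
exists S; rewrite ST; split=> //.
  rewrite /S mulmxBl mul1mx mulmxBr mulmx1 -scalemxAl -scalemxAr.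
  rewrite -mulmxA (mulmxA w) dotE mul_scalar_mx -scalemxAr !scalerA.
  have -> : 2 / dot w w * (2 / dot w w * dot w w) = 2 / dot w w + 2 / dot w w.
    by field.
  by rewrite scalerDl opprB addrA addrA subrK addrK.
rewrite /S mulmxBr mulmx1 -scalemxAr mulmxA dotE mul_scalar_mx scalerA.
have -> : 2 / dot w w * dot a w = 1 by rewrite mulrAC -ww divff.
by rewrite scale1r wE opprB addrC subrK.
Qed.

(** Once [a] is reflected onto the first axis, the Gram matrix is diagonal with entries
    [1 + dot a a, 1, ..., 1], the Gram matrix of a stretch by the claimed square root. *)
Lemma vol_ratio_graph d (M : 'M[R]_(N, d)) a : row_free M ->
  M *m M^T = 1%:M + a^T *m a -> vol_ratio M = Num.sqrt (1 + dot a a).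
Proof.
move=> fM MM; have [S [SS ST aS]] := householder a.
set t := Num.sqrt _; have t0 : 0 < t by rewrite sqrtr_gt0 ltr_pwDl// dot_ge0.
have Su : S \in unitmx by case/mulmx1_unit: SS.
rewrite -(vol_ratio_stretch ord0 t0) -[LHS]mul1r -(vol_ratio_orth SS).
rewrite -vol_ratio_mul//; apply: vol_ratio_gram.
have -> : S *m M *m (S *m M)^T = 1%:M + (a *m S)^T *m (a *m S).
  rewrite !trmx_mul ST -!mulmxA (mulmxA M) MM mulmxDl mul1mx mulmxDr -!mulmxA.
  by rewrite -{2}ST SS.
rewrite aS.
have -> : (enorm a *: (delta_mx 0 ord0 : 'rV[R]_N))^T = enorm a *: delta_mx ord0 0.
  by apply/matrixP => i j; rewrite !mxE andbC.
rewrite -scalemxAl -scalemxAr scalerA -expr2 sqr_enorm mul_delta_mx.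
rewrite tr_diag_mx mulmx_diag; apply/matrixP => i j; rewrite !mxE.
case: (eqVneq i j) => [->|ij]; rewrite ?mulr1n ?mulr0n.
  case: eqP => _ /=; rewrite ?mulr1 ?mulr0 ?addr0//.
  by rewrite -expr2 sqr_sqrtr// addr_ge0// dot_ge0.
case: (eqVneq i ord0) ij => [->|_ _]; rewrite ?mulr0 ?addr0//.
by rewrite eq_sym => /negbTE->; rewrite mulr0 addr0.
Qed.

End hausdorff_lin_theory.

(** * Projection of flat sets along a coordinate axis *)

Section flat.
Context {R : realType} {n : nat}.
Local Notation N := n.+1.

Lemma col'_continuous (l : 'I_N.+1) : continuous (col' l : 'rV[R]_N.+1 -> 'rV[R]_N).
Proof.
move=> x A /nbhs_ballP[e /= e0 eA]; apply/nbhs_ballP; exists e => //= y.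
rewrite -ball_normE/= => xy; apply: eA; rewrite -ball_normE/=; apply: le_lt_trans xy.
apply: ler_norm_rV => // j; have := normr_coord (x - y) (lift l j).
by rewrite !mxE.
Qed.

(** The parametrization of the hyperplane [x_l = - dot a y] by the other coordinates [y]. With
    [a = 0] it inserts a zero at position [l]. *)
Definition graph_mx (l : 'I_N.+1) (a : 'rV[R]_N) : 'M[R]_(N, N.+1) :=
  \matrix_(i, k) if unlift l k is Some j then (i == j)%:R else - a 0 i.

Lemma graph_mx_gram l a : graph_mx l a *m (graph_mx l a)^T = 1%:M + a^T *m a.
Proof.
apply/matrixP => i j; rewrite !mxE (bigD1_ord l)//= !mxE unlift_none mulrNN addrC.
rewrite big_ord1 !mxE; congr (_ + _); rewrite (bigD1 i)//= big1 ?addr0 => [|k ki].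
  by rewrite !mxE liftK eqxx mul1r eq_sym.
by rewrite !mxE liftK eq_sym (negbTE ki) mul0r.
Qed.

Lemma graph_mx_free l a : row_free (graph_mx l a).
Proof.
apply/row_freeP; exists (\matrix_(k, j) (k == lift l j)%:R).
apply/matrixP => i j; rewrite !mxE (bigD1 (lift l j))//= big1 ?addr0 => [|k kj].
  by rewrite !mxE liftK eqxx mulr1.
by rewrite !mxE (negbTE kj) mulr0.
Qed.

Lemma graph_mxE l a (y : 'rV[R]_N) k :
  (y *m graph_mx l a) 0 k = if unlift l k is Some j then y 0 j else - dot a y.
Proof.
rewrite mxE; case: unliftP => [j ->|->].
  rewrite (bigD1 j)//= big1 ?addr0 => [|i ij]; first by rewrite mxE liftK eqxx mulr1.
  by rewrite mxE liftK (negbTE ij) mulr0.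
rewrite /dot -sumrN; apply: eq_bigr => i _; rewrite mxE unlift_none mulrN mulrC //.
Qed.

Lemma hausdorff_lin_null (M : 'M[R]_(N, N.+1)) G : compact G ->
  fine (hausdorff_lin (1%:M : 'M[R]_N) unit_cube) = 0 -> hausdorff_lin M G = 0%E.
Proof.
move=> /compact_bound[_ [K GK]] c0.
have h1 : haar_outer (hausdorff_lin (1%:M : 'M[R]_N)).
  by apply: haar_hausdorff_lin; rewrite row_free_unit unitmx1.
have G0 := haar_null_bounded h1 c0 GK.
have [C C0 MC] := mulmx_bounded M.
pose L := Num.sqrt N.+1%:R * C; have L0 : 0 < L by rewrite mulr_gt0// sqrtr_gt0 ltr0n.
apply/eqP; rewrite eq_le hausdorff_ge0 andbT -(mule0 (L ^+ N)%:E) -G0.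
apply: lipschitz_hausdorff => // x y _ _; rewrite -!mulmxBl mulmx1.
apply: le_trans (enorm_le_norm _) _; rewrite -mulrA ler_wpM2l ?sqrtr_ge0//.
by apply: le_trans (MC _) _; rewrite ler_wpM2l ?norm_le_enorm// ltW.
Qed.

(** Up to a translation [F] is a graph over its projection, with slope [a = col' l nu / nu_l]. Since
    [nu] is a unit vector, the area factor [sqrt (1 + dot a a)] equals [1 / |nu_l|]. *)
Lemma hausdorff_flat (l : 'I_N.+1) (nu : 'rV[R]_N.+1) b F : compact F ->
  enorm nu = 1 -> nu 0 l != 0 -> (forall x, F x -> dot nu x = b) ->
  fine (hausdorff N F) * `|nu 0 l| =
    fine (hausdorff_lin (1%:M : 'M[R]_N) (col' l @` F)).
Proof.
move=> Fc nu1 nul Fb; set G := _ @` F.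
have Gc : compact G.
  apply: continuous_compact => //; apply: continuous_subspaceT.
  exact: col'_continuous.
pose a : 'rV[R]_N := (nu 0 l)^-1 *: col' l nu; pose M := graph_mx l a.
have dot_split (x : 'rV[R]_N.+1) : dot nu x = nu 0 l * (x 0 l + dot a (col' l x)).
  rewrite /a dotZl mulrDr mulVKf// /dot (bigD1_ord l)//=; congr (_ + _).
  by apply: eq_bigr => j _; rewrite !mxE.
have FE : F = (fun x => (b / nu 0 l) *: delta_mx 0 l + x) @` ((fun y => y *m M) @` G).
  have rec x : F x -> x = (b / nu 0 l) *: delta_mx 0 l + col' l x *m M.
    move=> Fx; apply/rowP => k; rewrite [RHS]mxE graph_mxE !mxE eqxx/=.
    case: unliftP => [j ->|->]; first by rewrite eq_sym eq_liftF mulr0 add0r mxE.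
    rewrite eqxx mulr1 -(Fb x Fx) dot_split mulrAC divff// mul1r.
    by rewrite addrK.
  apply/seteqP; split=> [x Fx|_ [_ [_ [x Fx <-] <-] <-]]; last by rewrite -rec.
  by exists (col' l x *m M); [exists (col' l x) => //; exists x|rewrite -rec].
have HF : hausdorff N F = hausdorff_lin M G.
  set X := (fun y => y *m M) @` G in FE.
  have X_id : X = id @` X by rewrite image_id.
  rewrite /hausdorff_lin -/X FE; apply/eqP; rewrite eq_le; apply/andP; split.
    rewrite [in leRHS]X_id -[leRHS]mul1e -(expr1n R N).
    apply: lipschitz_hausdorff => // x y _ _; rewrite mul1r.
    by rewrite opprD addrACA subrr add0r.
  rewrite [in leLHS]X_id -[leRHS]mul1e -(expr1n R N).
  apply: lipschitz_hausdorff => // x y _ _; rewrite mul1r.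
  by rewrite [in leRHS]opprD addrACA subrr add0r.
(* If the unit cube had mass zero, then so would all bounded sets and their Lipschitz images, and
   both sides are zero. *)
have [c0|c0] := eqVneq (fine (hausdorff_lin (1%:M : 'M[R]_N) unit_cube)) 0.
  rewrite HF hausdorff_lin_null// mul0r.
  have h1 : haar_outer (hausdorff_lin (1%:M : 'M[R]_N)).
    by apply: haar_hausdorff_lin; rewrite row_free_unit unitmx1.
  by have [_ [K GK]] := compact_bound Gc; rewrite (haar_null_bounded h1 c0 GK).
rewrite HF (vol_ratioP c0 (graph_mx_free l a) Gc).
rewrite (vol_ratio_graph c0 (graph_mx_free l a) (graph_mx_gram l a)) mulrAC.
suff -> : Num.sqrt (1 + dot a a) * `|nu 0 l| = 1 by rewrite mul1r.
rewrite -sqrtr_sqr -sqrtrM ?addr_ge0 ?dot_ge0//.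
have : enorm nu ^+ 2 = 1 by rewrite nu1 expr1n.
rewrite sqr_enorm dot_split.
have -> : col' l nu = nu 0 l *: a by rewrite /a scalerA divff// scale1r.
rewrite dotZr => h.
have -> : (1 + dot a a) * nu 0 l ^+ 2 = nu 0 l * (nu 0 l + nu 0 l * dot a a) by ring.
by rewrite h sqrtr1.
Qed.

End flat.

(** * Local structure of polytopes *)

Section hull.
Context {R : realType} {d : nat}.
Implicit Types (s : seq 'rV[R]_d) (A : set 'rV[R]_d).

Lemma hull_compact s : compact (hull s).
Proof.
pose M : 'M[R]_(size s, d) := \matrix_(i < size s) s`_i.
pose K : set 'rV[R]_(size s) := [set w : 'rV[R]_(size s) | forall i, `[(0 : R), 1]%classic (w 0 i)] `&`
  [set w : 'rV[R]_(size s) | dot (const_mx 1) w = 1].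
suff -> : hull s = (fun w => w *m M) @` K.
  apply: compact_mulmx; apply: compact_closedI.
    by apply: (@rV_compact _ _ (fun=> `[(0 : R), 1]%classic)) => i; exact: segment_compact.
  apply: (@closed_comp _ _ (dot (const_mx 1)) [set r : R | r = 1]) => [x _|].
    exact: dot_continuous.
  exact: closed_eq.
have ME (w : 'rV[R]_(size s)) : w *m M = \sum_i w 0 i *: s`_i.
  by rewrite mulmx_sum_row; apply: eq_bigr => i _; rewrite rowK.
have dot1 (w : 'rV[R]_(size s)) : dot (const_mx 1) w = \sum_i w 0 i.
  by apply: eq_bigr => i _; rewrite mxE mul1r.
apply/seteqP; split=> [x [w [w0 w1 ->]]|_ [w [wK w1] <-]].
  exists (\row_i w i); last by rewrite ME; apply: eq_bigr => i _; rewrite mxE.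
  split=> [i|]; last by rewrite /= dot1 -w1; apply: eq_bigr => i _; rewrite mxE.
  rewrite mxE /= in_itv /= w0 -w1 (bigD1 i)//= lerDl; exact: sumr_ge0.
exists (fun i => w 0 i); split=> [i||]; last by rewrite ME.
  by have := wK i; rewrite /= in_itv => /andP[].
by rewrite -dot1.
Qed.

Lemma hull_convex s x y t : hull s x -> hull s y -> 0 <= t <= 1 ->
  hull s (x + t *: (y - x)).
Proof.
move=> [w [w0 w1 ->]] [v [v0 v1 ->]] /andP[t0 t1].
exists (fun i => w i + t * (v i - w i)); split=> [i||].
- rewrite (_ : _ + _ = (1 - t) * w i + t * v i); last by ring.
  by rewrite addr_ge0// mulr_ge0// subr_ge0.
- by rewrite big_split/= -mulr_sumr sumrB w1 v1 subrr mulr0 addr0.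
- rewrite -sumrB scaler_sumr -big_split/=; apply: eq_bigr => i _.
  by rewrite -scalerBl scalerA -scalerDl.
Qed.

(** The homothety with centre [x] and small ratio [t] maps a ball around an interior point to a ball
    that lies in the hull by convexity and comes arbitrarily close to [x]. *)
Lemma hull_regular s : (hull s)° !=set0 -> hull s `<=` closure (hull s)°.
Proof.
move=> [z /nbhs_ballP[e /= e0 ez]] x sx B /nbhs_ballP[r /= r0 rB].
pose t := Num.min 1 (r / (2 * (`|z - x| + 1))).
have zx : 0 < `|z - x| + 1 by rewrite ltr_pwDr.
have t0 : 0 < t by rewrite lt_min ltr01 divr_gt0// mulr_gt0.
have t1 : t <= 1 by rewrite ge_min lexx.
exists (x + t *: (z - x)); split.
  apply/nbhs_ballP; exists (t * e); rewrite /= ?mulr_gt0// => y.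
  rewrite -ball_normE/= => hy.
  have -> : y = x + t *: ((x + t^-1 *: (y - x)) - x).
    by rewrite [x + t^-1 *: _]addrC addrK scalerA divff ?gt_eqF// scale1r addrC subrK.
  apply: hull_convex; rewrite ?(ltW t0)//; apply: ez; rewrite -ball_normE/=.
  have E : t *: (z - (x + t^-1 *: (y - x))) = x + t *: (z - x) - y.
    by apply/rowP => i; rewrite !mxE; field; rewrite gt_eqF.
  by rewrite -(ltr_pM2l t0) -{1}(gtr0_norm t0) -normrZ E.
apply: rB; rewrite -ball_normE/= opprD addNKr normrN normrZ gtr0_norm//.
apply: (@le_lt_trans _ _ (r / (2 * (`|z - x| + 1)) * (`|z - x| + 1))).
  by apply: ler_pM; rewrite ?(ltW t0)// ?ge_min ?lexx ?orbT// lerDl.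
by rewrite invfM mulrA divfK ?gt_eqF// ltr_pdivrMr// ltr_pMr// ltr1n.
Qed.

Lemma polytope_solid A : polytope A ->
  [/\ compact A, closed A & A `<=` closure A°].
Proof.
move=> [[ss ssi ->] _ _ _].
have cA : compact (\bigcup_(s in [set` ss]) hull s).
  elim: ss {ssi} => [|s ss IH].
    rewrite (_ : [set` [::]] = set0); last by apply/seteqP; split.
    by rewrite bigcup_set0; exact: compact0.
  rewrite (_ : [set` s :: ss] = s |` [set` ss]).
    by rewrite bigcup_setU1; apply: compactU => //; exact: hull_compact.
  by apply/seteqP; split=> u /=; rewrite inE => /predU1P.
split=> //; first by apply: compact_closed cA; exact: norm_hausdorff.
move=> x [s /= sss /(hull_regular (ssi s sss))].
by apply: closureS; apply: interiorS; exact: bigcup_sup.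
Qed.

End hull.

Lemma convex_gt0 {R : realType} (t a b : R) : 0 <= t <= 1 -> 0 < a -> 0 < b ->
  0 < (1 - t) * a + t * b.
Proof.
move=> /andP[t0 t1] a0 b0; have [->|tn0] := eqVneq t 0; first by rewrite subr0 mul1r mul0r addr0.
by rewrite ltr_wpDl ?mulr_ge0 ?subr_ge0 ?(ltW a0)// mulr_gt0// lt_def tn0.
Qed.

Section local_analysis.
Context {R : realType} {d : nat}.
Implicit Types (A : set 'rV[R]_d) (x y p q u xi : 'rV[R]_d) (r t s : R).

Lemma near_line A x u : nbhs x A ->
  exists2 e, 0 < e & forall t, `|t| <= e -> A (x + t *: u).
Proof.
move=> /nbhs_ballP[e /= e0 eA]; have u0 : 0 < `|u| + 1 by rewrite ltr_pwDr.
exists (e / 2 / (`|u| + 1)) => [|t te]; first by rewrite !divr_gt0.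
apply: eA; rewrite -ball_normE/= opprD addNKr normrN normrZ.
apply: (@le_lt_trans _ _ (e / 2 / (`|u| + 1) * (`|u| + 1))).
  by rewrite ler_pM// lerDl.
by rewrite divfK ?gt_eqF// ltr_pdivrMr// ltr_pMr// ltr1n.
Qed.

Lemma line_continuous p u : continuous (fun t : R => p + t *: u).
Proof.
move=> t; apply: cvgD; first exact: cvg_cst.
by apply: cvgZr_tmp; exact: cvg_id.
Qed.

(** On a segment that avoids the boundary, being in the interior is the same as being in the
    closure, so it is an open and closed condition on the connected interval [0, 1]. *)
Lemma segment_interior A p q :
  (forall t, 0 <= t <= 1 -> ~ boundary A (p + t *: (q - p))) -> A° p -> A° q.
Proof.
move=> pq Ap; pose g t := p + t *: (q - p).
have gc : continuous g by exact: line_continuous.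
pose I := `[(0 : R), 1]%classic; pose B := I `&` g @^-1` A°.
have BI : B = I.
  apply: (@segment_connected R 0 1).
  - by exists 0; split; rewrite /I/= ?in_itv/= ?lexx ?ler01// /g scale0r addr0.
  - exists (g @^-1` A°) => //; apply: open_comp => [t _|]; first exact: gc.
    exact: open_interior.
  - exists (g @^-1` closure A).
      by apply: closed_comp => [t _|]; [exact: gc|exact: closed_closure].
    apply/seteqP; split=> t [It At]; split=> //.
      by apply: subset_closure; exact: interior_subset At.
    apply: contrapT => nAt; move: It; rewrite /I/= in_itv/= => /pq; apply.
    by split.
have : I 1 by rewrite /I/= in_itv/= lexx ler01.
by rewrite -BI => -[_]; rewrite /g/= scale1r addrC subrK.
Qed.

(** The open half ball on one side of the hyperplane through [x]; the sign [s] treats both sides at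
    once. *)
Definition half xi x r s : set 'rV[R]_d :=
  [set y | ball x r y /\ 0 < s * (dot xi y - dot xi x)].

Lemma ball_line x r y z t : ball x r y -> ball x r z -> 0 <= t <= 1 ->
  ball x r (y + t *: (z - y)).
Proof.
rewrite -ball_normE/= => xy xz /andP[t0 t1].
have -> : x - (y + t *: (z - y)) = (1 - t) *: (x - y) + t *: (x - z).
  by rewrite scalerBl scale1r -addrA; apply/rowP => i; rewrite !mxE; ring.
apply: le_lt_trans (ler_normD _ _) _; rewrite !normrZ ger0_norm ?subr_ge0//.
rewrite (ger0_norm t0) -subr_gt0.
have -> : r - ((1 - t) * `|x - y| + t * `|x - z|) =
  (1 - t) * (r - `|x - y|) + t * (r - `|x - z|) by ring.
by apply: convex_gt0; rewrite ?subr_gt0// t0.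
Qed.

Lemma half_line xi x r s y z t : half xi x r s y -> half xi x r s z -> 0 <= t <= 1 ->
  half xi x r s (y + t *: (z - y)).
Proof.
move=> [xy sy] [xz sz] t01; split; first exact: ball_line.
rewrite dotDr dotZr dotDr dotNr.
have -> : s * (dot xi y + t * (dot xi z - dot xi y) - dot xi x) =
  (1 - t) * (s * (dot xi y - dot xi x)) + t * (s * (dot xi z - dot xi x)) by ring.
exact: convex_gt0.
Qed.

Lemma half_near xi x r s y : 0 < r -> xi != 0 -> s != 0 -> ball x r y -> dot xi y = dot xi x ->
  exists2 e, 0 < e & forall t, 0 < t <= e -> half xi x r s (y + (s * t) *: xi).
Proof.
move=> r0 xi0 s0 xy yx; have [e e0 eB] := near_line xi (open_nbhs_nbhs (conj (ball_open x r) xy)).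
exists (e / `|s|) => [|t /andP[t0 te]]; first by rewrite divr_gt0// normr_gt0.
split; first by apply: eB; rewrite normrM mulrC (gtr0_norm t0) -ler_pdivlMr ?normr_gt0.
rewrite dotDr dotZr yx addrC addKr mulrA mulrA -expr2.
have xx : 0 < dot xi xi by rewrite lt_def dot_eq0 xi0 dot_ge0.
have ss : 0 < s ^+ 2 by rewrite lt_def sqrf_eq0 s0 sqr_ge0.
exact: mulr_gt0 (mulr_gt0 ss t0) xx.
Qed.

(* Both half balls are free of boundary points, hence inside or outside [A] as a
   whole; regularity of [A] excludes that they lie on the same side. *)
Lemma flat_boundary A xi x r : closed A -> A `<=` closure A° -> xi != 0 -> 0 < r ->
  boundary A x -> (forall y, ball x r y -> boundary A y -> dot xi y = dot xi x) ->
  exists s, [/\ `|s| = 1, half xi x r (- s) `<=` A°, half xi x r s `<=` ~` A &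
    forall y, ball x r y -> dot xi y = dot xi x -> boundary A y].
Proof.
move=> Acl Areg xi0 r0 [Ax nAx] flat; have {}Ax := Acl x Ax.
have side s p q : half xi x r s p -> half xi x r s q -> A° p -> A° q.
  move=> hp hq; apply: segment_interior => t t01 /flat.
  have [B sgt] := half_line hp hq t01.
  by move=> /(_ B) E; move: sgt; rewrite E subrr mulr0 ltxx.
have dich s y : half xi x r s y -> ~ A° y -> ~ A y.
  move=> [xy sy] nAy Ay; move: sy; rewrite (flat y xy) ?subrr ?mulr0 ?ltxx//.
  by split=> //; exact: subset_closure.
have tri s y : `|s| = 1 -> ball x r y ->
    [\/ half xi x r s y, half xi x r (- s) y | dot xi y = dot xi x].
  move=> s1 xy; have [E|E|E] := ltgtP (s * (dot xi y - dot xi x)) 0.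
  - by constructor 2; split=> //; rewrite mulNr oppr_gt0.
  - by constructor 1.
  - constructor 3; apply: subr0_eq; move/eqP : E; rewrite mulf_eq0.
    by rewrite -normr_eq0 s1 oner_eq0 => /eqP.
have lim s y : `|s| = 1 -> ball x r y -> dot xi y = dot xi x -> forall B, nbhs y B ->
    exists2 z, half xi x r s z & B z.
  move=> s1 xy yx B yB; have s0 : s != 0 by rewrite -normr_eq0 s1 oner_eq0.
  have [e1 e10 h1] := half_near r0 xi0 s0 xy yx.
  have [e2 e20 h2] := near_line (s *: xi) yB.
  pose e := Num.min e1 e2; have e0 : 0 < e by rewrite lt_min e10.
  exists (y + (s * e) *: xi); first by apply: h1; rewrite e0 ge_min lexx.
  rewrite mulrC -scalerA; apply: h2.
  by rewrite gtr0_norm// ge_min lexx orbT.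
have [s [s1 In]] : exists s, `|s| = 1 /\ exists2 p, half xi x r (- s) p & A° p.
  have [p [Ap xp]] := Areg x Ax (ball x r) (nbhsx_ballx x r r0).
  have [h|h|E] := tri 1 p (normr1 _) xp.
  - by exists (- 1); rewrite normrN1 opprK; split=> //; exists p.
  - by exists 1; rewrite normr1; split=> //; exists p.
  - have [z hz Az] := lim 1 p (normr1 _) xp E _ (open_nbhs_nbhs (conj (open_interior A) Ap)).
    by exists (- 1); rewrite normrN1 opprK; split=> //; exists z.
have Ins : half xi x r (- s) `<=` A° by case: In => p hp Ap y hy; exact (side _ p y hp hy Ap).
have Ns1 : `|- s| = 1 by rewrite normrN.
have Out : half xi x r s `<=` ~` A.
  move=> y hy; apply: (dich s) => // Ay; apply: nAx.
  apply/nbhs_ballP; exists r => //= z xz.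
  have [h|h|E] := tri s z s1 xz.
  - exact: interior_subset (side s y z hy h Ay).
  - exact: interior_subset (Ins z h).
  - apply: Acl => B zB; have [w hw Bw] := lim _ _ Ns1 xz E B zB.
    by exists w; split=> //; exact (interior_subset (Ins w hw)).
exists s; split=> // y xy E; split.
  move=> B yB; have [w hw Bw] := lim _ _ Ns1 xy E B yB.
  by exists w; split=> //; exact (interior_subset (Ins w hw)).
move=> Ay; have [w /Out hw Bw] := lim _ _ s1 xy E _ (open_nbhs_nbhs (conj (open_interior A) Ay)).
exact (hw (interior_subset Bw)).
Qed.

End local_analysis.

(** * Faces through a generic point *)

Lemma nbhsT_in {T : topologicalType} (x : T) (P : set T) : (forall y, P y) -> nbhs x P.
Proof. by move=> h; exact: nearW. Qed.

Lemma near_seq {T : topologicalType} {I : eqType} (x : T) (s : seq I) (P : I -> set T) :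
  (forall i, i \in s -> \forall y \near x, P i y) ->
  \forall y \near x, forall i, i \in s -> P i y.
Proof.
elim: s => [_|a s IH Ps]; first by apply: nearW.
have h1 := Ps a (mem_head _ _).
have h2 : \forall y \near x, forall i, i \in s -> P i y.
  by apply: IH => i si; apply: Ps; rewrite inE si orbT.
apply: filterS2 h1 h2 => y h1 h2 i; rewrite inE => /predU1P[->//|].
exact: h2.
Qed.

Section generic_point.
Context {R : realType} {d : nat} {K : eqType} (cell : K -> set 'rV[R]_d)
  (nbr : K -> seq K) (xi : K -> K -> 'rV[R]_d).
Hypothesis hmesh : is_mesh cell nbr xi.
Local Notation F := (common_face cell).
Implicit Types (x y u : 'rV[R]_d).

Lemma cell_compact k : compact (cell k).
Proof. by have [] := polytope_solid (mesh_polytope hmesh k). Qed.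

Lemma cell_closed k : closed (cell k).
Proof. by have [] := polytope_solid (mesh_polytope hmesh k). Qed.

Lemma cell_regular k : cell k `<=` closure (cell k)°.
Proof. by have [] := polytope_solid (mesh_polytope hmesh k). Qed.

Lemma boundary_closed (A : set 'rV[R]_d) : closed (boundary A).
Proof.
rewrite /boundary setDE; apply: closedI; first exact: closed_closure.
by apply: open_closedC; exact: open_interior.
Qed.

Lemma face_closed k j : closed (F k j).
Proof. by apply: closedI; exact: boundary_closed. Qed.

Lemma boundary_cell k x : boundary (cell k) x -> cell k x.
Proof. by case=> /(@cell_closed k). Qed.

Lemma face_compact k j : compact (F k j).
Proof.
apply: (subclosed_compact _ (@cell_compact k)); first exact: face_closed.
by move=> x [/boundary_cell].
Qed.

Lemma boundary_face k x : boundary (cell k) x -> exists2 j, j \in nbr k & F k j x.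
Proof. by rewrite (mesh_boundary hmesh k) => -[j /= jk Fx]; exists j. Qed.

Lemma normal_neq0 k j : j \in nbr k -> xi k j != 0.
Proof.
move=> /(mesh_normal hmesh)[xi1 _ _]; apply/eqP => E; move: xi1.
by rewrite E enorm0 => /eqP; rewrite eq_sym oner_eq0.
Qed.

Lemma face_flat k j x y : j \in nbr k -> F k j x -> F k j y ->
  dot (xi k j) x = dot (xi k j) y.
Proof. by move=> /(mesh_normal hmesh)[_ + _]; apply. Qed.

(* All the faces through [x] of the cell [k] and of its neighbours are parallel. *)
Definition generic k x := forall i j i' j',
  i \in k :: nbr k -> j \in nbr i -> i' \in k :: nbr k -> j' \in nbr i' ->
  F i j x -> F i' j' x -> xi i' j' = xi i j \/ xi i' j' = - xi i j.

(** Faces through [x] have normals [xi k j] up to sign, hence lie in one hyperplane. The other faces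
    are closed and finite in number, so a small ball misses them. *)
Lemma generic_flat k j x : generic k x -> j \in nbr k -> F k j x ->
  exists2 r, 0 < r & forall i, i \in k :: nbr k -> forall y, ball x r y ->
    boundary (cell i) y -> dot (xi k j) y = dot (xi k j) x.
Proof.
move=> gx jk Fx.
have : \forall y \near x, forall i, i \in k :: nbr k -> forall l, l \in nbr i ->
    F i l y -> dot (xi k j) y = dot (xi k j) x.
  apply: near_seq => i ik; apply: near_seq => l li.
  have [Fil|nFil] := pselect (F i l x).
    apply: nbhsT_in => y Fy; have := face_flat li Fy Fil.
    have [->//|->] := gx k j i l (mem_head _ _) jk ik li Fx Fil.
    by rewrite !dotNl => /oppr_inj.
  have : nbhs x (~` F i l).
    by apply: open_nbhs_nbhs; split=> //; exact/closed_openC/face_closed.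
  by apply: filterS => y nFy /nFy.
move=> /nbhs_ballP[r /= r0 rP]; exists r => // i ik y xy.
by move=> /boundary_face[l li Fl]; exact: rP _ xy i ik l li Fl.
Qed.

Lemma norm1_case (s : R) : `|s| = 1 -> s = 1 \/ s = -1.
Proof.
by have [s0|s0] := leP 0 s; [rewrite ger0_norm//|rewrite ltr0_norm// => <-];
  [left|right; rewrite opprK].
Qed.

(** [flat_boundary] gives each of the two cells one side of the hyperplane, but not which one. Near
    [x] the common face fills the hyperplane, so the condition on the normal may be tested at [x],
    and short steps along [xi] and [- xi] decide both signs. *)
Lemma generic_sides k j x : generic k x -> j \in nbr k -> F k j x ->
  exists2 r, 0 < r & [/\ half (xi k j) x r (- 1) `<=` (cell k)°,
    half (xi k j) x r 1 `<=` ~` cell k & half (xi k j) x r 1 `<=` (cell j)°].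
Proof.
move=> gx jk Fx; have [r r0 flat] := generic_flat gx jk Fx.
have xi0 := normal_neq0 jk; exists r => //.
have [s [s1 inK outK onK]] := flat_boundary (@cell_closed k) (@cell_regular k) xi0 r0
  Fx.1 (flat k (mem_head _ _)).
have jL : j \in k :: nbr k by rewrite inE jk orbT.
have [s' [s'1 inJ outJ onJ]] := flat_boundary (@cell_closed j) (@cell_regular j) xi0 r0
  Fx.2 (flat j jL).
have [_ _ side] := mesh_normal hmesh jk.
have near0 : \forall t \near (0 : R)^'+, cell k (x - t *: xi k j) /\ cell j (x + t *: xi k j).
  apply: side => //; apply/nbhs_ballP; exists r => //= y xy E.
  by split; [exact: onK|exact: onJ].
have xx : ball x r x := ballxx x r0.
have [e1 e10 h1] := half_near r0 xi0 (oner_neq0 R) xx erefl.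
have n10 : -1 != 0 :> R by rewrite oppr_eq0 oner_neq0.
have [e2 e20 h2] := half_near r0 xi0 n10 xx erefl.
have : \forall t \near (0 : R)^'+, 0 < t <= Num.min e1 e2.
  near=> t; apply/andP; split=> //; near: t.
  by apply: nbhs_right_le; rewrite lt_min e10.
move=> /(filterI near0)/filter_ex[t [[kt jt] /andP[t0]]].
rewrite le_min => /andP[te1 te2].
have H1 : half (xi k j) x r 1 (x + t *: xi k j).
  by have := h1 t; rewrite mul1r; apply; rewrite t0.
have H2 : half (xi k j) x r (-1) (x - t *: xi k j).
  by have := h2 t; rewrite mulN1r scaleNr; apply; rewrite t0.
case: (norm1_case s1) => E; last by case: (outK (x - t *: xi k j)); rewrite ?E.
case: (norm1_case s'1) => E'; first by case: (outJ (x + t *: xi k j)); rewrite ?E'.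
by rewrite E in inK outK; rewrite E' opprK in inJ.
Unshelve. all: by end_near. Qed.

(** A point slightly beyond the face lies in the interior of [j]. If the two normals agree it also
    lies in the interior of [j'], against disjointness; if they are opposite it lies in the cell
    [k], which it has just left. *)
Lemma generic_unique k j j' x : generic k x -> j \in nbr k -> j' \in nbr k ->
  F k j x -> F k j' x -> j = j'.
Proof.
move=> gx jk j'k Fx F'x; have [r r0 [inK outK inJ]] := generic_sides gx jk Fx.
have [r' r'0 [inK' outK' inJ']] := generic_sides gx j'k F'x.
pose q := Num.min r r'; have q0 : 0 < q by rewrite lt_min r0.
have [e e0 h] := half_near q0 (normal_neq0 jk) (oner_neq0 R) (ballxx x q0) erefl.
have := h e; rewrite e0 lexx mul1r => /(_ isT); set z := x + _ => -[xz sz].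
have xzr : ball x r z by apply: le_ball xz; rewrite ge_min lexx.
have xzr' : ball x r' z by apply: le_ball xz; rewrite ge_min lexx orbT.
have zj := inJ z (conj xzr sz).
have [E|E] := gx k j k j' (mem_head _ _) jk (mem_head _ _) j'k Fx F'x.
  have zj' : (cell j')° z by apply: inJ'; split=> //; rewrite E.
  apply/eqP; apply: contrapT => /negP/(mesh_disjoint hmesh) D.
  have : ((cell j)° `&` (cell j')°) z by split.
  by rewrite D.
case: (outK z (conj xzr sz)); apply: interior_subset; apply: inK'; split=> //.
by move: sz; rewrite E !dotNl; lra.
Qed.

Lemma generic_crossing k j x u : generic k x -> j \in nbr k -> F k j x ->
  0 < dot (xi k j) u ->
  \forall t \near (0 : R)^'+, (cell k)° (x - t *: u) /\ ~ cell k (x + t *: u).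
Proof.
move=> gx jk Fx xu; have [r r0 [inK outK inJ]] := generic_sides gx jk Fx.
have [e e0 eB] := near_line u (nbhsx_ballx x r r0).
near=> t.
have t0 : 0 < t by [].
have te : `|t| <= e by rewrite gtr0_norm//; near: t; exact: nbhs_right_le.
split.
  apply: inK; split; first by rewrite -scaleNr; apply: eB; rewrite normrN.
  by rewrite dotDr dotNr dotZr addrAC subrr add0r mulrNN mul1r mulr_gt0.
apply: outK; split; first exact: eB.
by rewrite dotDr dotZr addrAC subrr add0r mul1r mulr_gt0.
Unshelve. all: by end_near. Qed.

End generic_point.

(** * Crossings of a line with the boundary of a cell *)

Lemma seq_max {R : realType} {K : eqType} (f : K -> R) (s : seq K) x : x \in s ->
  exists2 j, j \in s & forall i, i \in s -> f i <= f j.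
Proof.
elim: s x => // a [_ x _|b s IH x _].
  by exists a; rewrite ?mem_head// => i; rewrite inE => /eqP->.
have [j js jmax] := IH b (mem_head _ _).
have [ja|aj] := leP (f a) (f j).
  by exists j; rewrite ?(in_cons a) ?js ?orbT// => i; rewrite in_cons => /predU1P[->//|]; exact: jmax.
exists a; rewrite ?mem_head// => i; rewrite in_cons => /predU1P[->//|/jmax].
by move=> /le_trans; apply; exact: ltW.
Qed.

Lemma count_ltn {K : eqType} (a b : pred K) (s : seq K) j :
  (forall i, i \in s -> a i -> b i) -> j \in s -> b j -> ~~ a j ->
  (count a s < count b s)%N.
Proof.
move=> ab js bj aj; have le t : {subset t <= s} -> (count a t <= count b t)%N.
  elim: t => //= i t IH ts; rewrite leq_add//.
    by have := ab i (ts i (mem_head _ _)); case: (a i) => // ->.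
  by apply: IH => u ut; apply: ts; rewrite inE ut orbT.
case/splitPr : js le => s1 s2 le; rewrite !count_cat/= bj (negbTE aj) add0n add1n addnS ltnS.
by apply: leq_add; apply: le => u us; rewrite mem_cat ?inE us ?orbT.
Qed.

Lemma ltrBF {R : realType} (a t : R) : 0 < t -> (a < a - t) = false.
Proof. by move=> t0; apply/negbTE; rewrite -leNgt; lra. Qed.

Lemma ltr_trans_shift {R : realType} (a b c t : R) : 0 < t -> b + t < c -> a < b - t -> a < c.
Proof. by lra. Qed.

Lemma jump_sum {R : realType} (a b c g S : R) : a = c -> b - c = g -> b = - S -> a = - (g + S).
Proof. by lra. Qed.

Definition inside {R : realType} {d : nat} (A : set 'rV[R]_d) x : R :=
  if `[< A° x >] then 1 else 0.

Lemma inside1 {R : realType} {d : nat} (A : set 'rV[R]_d) x : A° x -> inside A x = 1.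
Proof. by move=> h; rewrite /inside; case: asboolP. Qed.

Lemma inside0 {R : realType} {d : nat} (A : set 'rV[R]_d) x : ~ A° x -> inside A x = 0.
Proof. by move=> h; rewrite /inside; case: asboolP. Qed.

Section line_scan.
Context {R : realType} {n : nat} {K : eqType} (cell : K -> set 'rV[R]_n.+2)
  (nbr : K -> seq K) (xi : K -> K -> 'rV[R]_n.+2).
Hypothesis hmesh : is_mesh cell nbr xi.
Local Notation F := (common_face cell).
Variable l : 'I_n.+2.
Implicit Types (y : 'rV[R]_n.+1) (s t : R).

Let e : 'rV[R]_n.+2 := delta_mx 0 l.

(** The line parallel to the axis [l] that projects to [y], parametrized by the coordinate [l]
    itself. *)
Definition line_pt y s : 'rV[R]_n.+2 := y *m graph_mx l 0 + s *: delta_mx 0 l.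

Lemma line_pt_add y s t : line_pt y s + t *: e = line_pt y (s + t).
Proof. by rewrite /line_pt scalerDl addrA. Qed.

Lemma line_pt_sub y s t : line_pt y s - t *: e = line_pt y (s - t).
Proof. by rewrite -line_pt_add scaleNr. Qed.

Lemma line_pt_segment y s s' t :
  line_pt y s + t *: (line_pt y s' - line_pt y s) = line_pt y (s + t * (s' - s)).
Proof.
by rewrite /line_pt opprD addrACA subrr add0r -scalerBl scalerA -addrA -scalerDl.
Qed.

Lemma dot_delta (v : 'rV[R]_n.+2) : dot v (delta_mx 0 l) = v 0 l.
Proof.
rewrite /dot (bigD1 l)//= mxE !eqxx mulr1 big1 ?addr0// => i il.
by rewrite mxE (negbTE il) andbF mulr0.
Qed.

Lemma dot_line_pt v y s : dot v (line_pt y s) = dot v (line_pt y 0) + s * v 0 l.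
Proof.
by rewrite /line_pt scale0r addr0 dotDr dotZr dot_delta.
Qed.

Lemma line_pt_l y s : line_pt y s 0 l = s.
Proof. by rewrite mxE graph_mxE unlift_none dot0l oppr0 add0r !mxE !eqxx mulr1. Qed.

Lemma col'_line_pt y s : col' l (line_pt y s) = y.
Proof.
apply/rowP => j; rewrite mxE [LHS]mxE graph_mxE liftK !mxE eqxx/=.
by rewrite eq_sym eq_liftF mulr0 addr0.
Qed.

Lemma line_ptE (x : 'rV[R]_n.+2) : line_pt (col' l x) (x 0 l) = x.
Proof.
apply/rowP => i; rewrite [LHS]mxE graph_mxE !mxE eqxx/=; case: unliftP => [j ->|->].
  by rewrite eq_sym eq_liftF mulr0 addr0 mxE.
by rewrite eqxx mulr1 dot0l oppr0 add0r.
Qed.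

Definition hit k j y := `[< exists s, F k j (line_pt y s) >].

Section line_scan_tau.
Variables (k : K) (y : 'rV[R]_n.+1).
Hypothesis gy : forall s, generic cell nbr xi k (line_pt y s).
Hypothesis transverse : forall j s, j \in nbr k -> F k j (line_pt y s) -> xi k j 0 l != 0.

Let hits := [seq j <- nbr k | hit k j y].

Variable tau : K -> R.
Hypothesis hit_timeP : forall j, j \in hits -> F k j (line_pt y (tau j)).

(** A transverse line meets the hyperplane of a face only once, so each face has at most one hitting
    time. *)
Let hitsP j s : j \in nbr k -> F k j (line_pt y s) -> j \in hits /\ tau j = s.
Proof.
move=> jk Fs; have jh : j \in hits by rewrite mem_filter jk andbT; apply/asboolP; exists s.
split=> //; have := face_flat hmesh jk (hit_timeP jh) Fs.
rewrite dot_line_pt [RHS]dot_line_pt => /addrI.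
by apply: mulIf; exact: transverse jk Fs.
Qed.

Let hits_nbr j : j \in hits -> j \in nbr k.
Proof. by rewrite mem_filter => /andP[]. Qed.

Let tau_inj i j : i \in hits -> j \in hits -> tau i = tau j -> i = j.
Proof.
move=> ih jh E; have Fj := hit_timeP jh; rewrite -E in Fj.
exact (generic_unique hmesh (@gy (tau i)) (hits_nbr ih) (hits_nbr jh) (hit_timeP ih) Fj).
Qed.

Let clear_interior s s' : s <= s' -> ~ boundary (cell k) (line_pt y s) ->
  ~ boundary (cell k) (line_pt y s') ->
  (forall j, j \in hits -> tau j <= s \/ s' <= tau j) ->
  (cell k)° (line_pt y s) <-> (cell k)° (line_pt y s').
Proof.
move=> ss' bs bs' H.
have clear t : s <= t <= s' -> ~ boundary (cell k) (line_pt y t).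
  move=> /andP[st ts'] /[dup] bt /(boundary_face hmesh)[j jk Fj].
  have [jh E] := hitsP jk Fj.
  have [|] := H j jh; rewrite E => h.
    have ts : t = s by apply: le_anti; rewrite st h.
    by apply: bs; rewrite -ts.
  have ts : t = s' by apply: le_anti; rewrite ts' h.
  by apply: bs'; rewrite -ts.
have between t : 0 <= t <= 1 -> s <= s + t * (s' - s) <= s'.
  move=> /andP[t0 t1]; rewrite lerDl mulr_ge0 ?subr_ge0//= -lerBrDl.
  by rewrite ler_piMl ?subr_ge0.
split; apply: segment_interior => t t01; rewrite line_pt_segment; apply: clear.
  exact: between.
rewrite (_ : s' + _ = s + (1 - t) * (s' - s)); last by ring.
by apply: between; lra.
Qed.

Local Notation inner s := (inside (cell k) (line_pt y s)).

Let inside_bounded : exists M, forall s, cell k (line_pt y s) -> `|s| <= M.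
Proof.
have [_ [M MP]] := compact_bound (@cell_compact _ _ _ _ _ _ hmesh k); exists M => s /MP.
by apply: le_trans; rewrite -{1}(line_pt_l y s); exact: normr_coord.
Qed.

Let uniq_hits : uniq hits.
Proof. exact/filter_uniq/(mesh_nbr_uniq hmesh). Qed.

Let crossing j : j \in hits -> \forall t \near (0 : R)^'+,
  [/\ ~ boundary (cell k) (line_pt y (tau j - t)),
      ~ boundary (cell k) (line_pt y (tau j + t)) &
      inner (tau j - t) - inner (tau j + t) = Num.sg (xi k j 0 l)].
Proof.
move=> jh; have Fj := hit_timeP jh; have jk := hits_nbr jh.
have nbI x : (cell k)° x -> ~ boundary (cell k) x by move=> ? [].
have nbO x : ~ cell k x -> ~ boundary (cell k) x by move=> ? /(boundary_cell hmesh).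
have dote : dot (xi k j) e = xi k j 0 l by exact: dot_delta.
have innerO s : ~ cell k (line_pt y s) -> inner s = 0.
  by move=> h; apply: inside0 => /interior_subset.
have := transverse jk Fj; rewrite neq_lt => /orP[x0|x0].
  have : 0 < dot (xi k j) (- e) by rewrite dotNr dote oppr_gt0.
  move=> /(generic_crossing hmesh (@gy _) jk Fj); apply: filterS => t.
  rewrite !scalerN opprK line_pt_sub line_pt_add => -[hi ho].
  by split; [exact: nbO|exact: nbI|rewrite innerO// inside1// sub0r ltr0_sg].
have : 0 < dot (xi k j) e by rewrite dote.
move=> /(generic_crossing hmesh (@gy _) jk Fj); apply: filterS => t.
rewrite line_pt_sub line_pt_add => -[hi ho].
by split; [exact: nbI|exact: nbO|rewrite inside1// innerO// subr0 gtr0_sg].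
Qed.

(** Normals point outwards, so at each hit the indicator of the interior drops by the sign of
    [xi_l]. The induction is on the number of hits below [s] and removes the last of them. *)
Let inner_sum s : ~ boundary (cell k) (line_pt y s) ->
  inner s = - \sum_(j <- hits | tau j < s) Num.sg (xi k j 0 l).
Proof.
have [m] := ubnP (count (fun j => tau j < s) hits); elim: m s => // m IH s cm bs.
have [/hasP[j0 j0h j0s]|/hasPn none] := boolP (has (fun j => tau j < s) hits); last first.
  rewrite big_seq_cond big1 ?oppr0; last first.
    by move=> j /andP[jh js]; have := none j jh; rewrite js.
  (* Without hits below [s] the indicator is constant down to a parameter beyond the bound of the
     cell, where it is 0. *)
  have [M MP] := inside_bounded; pose s' := Num.min s (- (M + 1)).
  have out : ~ cell k (line_pt y s').
    move=> /MP; rewrite leNgt => /negP; apply; rewrite lter_normr.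
    by apply/orP; right; rewrite ltrNr gt_min; apply/orP; right; lra.
  have s's : s' <= s by rewrite ge_min lexx.
  have bs' : ~ boundary (cell k) (line_pt y s') by move=> /(boundary_cell hmesh).
  have clear j : j \in hits -> tau j <= s' \/ s <= tau j.
    by move=> jh; right; have := none j jh; rewrite -leNgt.
  rewrite /inside; case: asboolP => // sI; exfalso; apply: out; apply: interior_subset.
  exact (proj2 (clear_interior s's bs' bs clear) sI).
have [j [jh js jmax]] : exists j, [/\ j \in hits, tau j < s &
    forall i, i \in hits -> tau i < s -> tau i <= tau j].
  have j0f : j0 \in [seq j <- hits | tau j < s] by rewrite mem_filter j0s.
  have [j] := seq_max tau j0f; rewrite mem_filter => /andP[js jh] jmax.
  by exists j; split=> // i ih is_; apply: jmax; rewrite mem_filter is_.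
(* The step [t] must be short enough that no other hit falls between [tau j - t] and [tau j]; hits
   beyond [tau j] are at least [s] by the choice of [j]. *)
have others : \forall t \near (0 : R)^'+, forall i, i \in hits -> tau i < tau j -> tau i < tau j - t.
  have : \forall t \near (0 : R), forall i, i \in hits -> tau i < tau j -> tau i < tau j - t.
    apply: near_seq => i ih; have [ij|ij] := pselect (tau i < tau j); last by apply: nbhsT_in => t /ij.
    near=> t => _; rewrite ltrBrDl -ltrBrDr; near: t; apply: lt_nbhsl.
    by rewrite subr_gt0.
  exact: cvg_at_right_filter.
have small : \forall t \near (0 : R)^'+, 0 < t /\ tau j + t < s.
  near=> t; split=> //; rewrite -ltrBrDl; near: t; apply: nbhs_right_lt.
  by rewrite subr_gt0.
have [t [[[b1 b2 jump] oth] [t0 ts]]] := filter_ex (filterI (filterI (crossing jh) others) small).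
have E1 : inner s = inner (tau j + t).
  have [io oi] : (cell k)° (line_pt y (tau j + t)) <-> (cell k)° (line_pt y s).
    apply: (clear_interior (ltW ts) b2 bs) => i ih.
    have [is_|] := ltP (tau i) s; last by right.
    by left; apply: le_trans (jmax i ih is_) _; rewrite lerDl ltW.
  have [h|h] := pselect ((cell k)° (line_pt y s)).
    by rewrite (inside1 h) (inside1 (oi h)).
  by rewrite (inside0 h) (inside0 (fun h' => h (io h'))).
have cnt : (count (fun i => tau i < tau j - t)%R hits < m)%N.
  rewrite ltnS in cm; apply: leq_trans cm.
  apply: (count_ltn _ jh js _); last exact (negbT (ltrBF (tau j) t0)).
  move=> i _; exact (ltr_trans_shift t0 ts).
have := IH _ cnt b1.
have -> : \sum_(i <- hits | tau i < s) Num.sg (xi k i 0 l) =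
    Num.sg (xi k j 0 l) + \sum_(i <- hits | tau i < tau j - t) Num.sg (xi k i 0 l).
  rewrite big_mkcond [in RHS]big_mkcond/= (bigD1_seq j jh uniq_hits)/= js; congr (_ + _).
  rewrite [RHS](bigD1_seq j jh uniq_hits)/= (ltrBF (tau j) t0) add0r.
  rewrite big_seq_cond [RHS]big_seq_cond; apply: eq_bigr => i /andP[ih ij].
  suff -> : (tau i < s) = (tau i < tau j - t) by [].
  apply/idP/idP => [is_|]; last exact (ltr_trans_shift t0 ts).
  apply: (oth i ih); rewrite lt_neqAle (jmax i ih is_) andbT; apply: contra ij => /eqP E.
  by apply/eqP; exact (tau_inj ih jh E).
move=> IHj; exact (jump_sum E1 jump IHj).
Unshelve. all: by end_near. Qed.

Lemma line_scan_tau : \sum_(j <- nbr k | hit k j y) Num.sg (xi k j 0 l) = 0.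
Proof.
have [M MP] := inside_bounded.
have big_out s : M < s -> ~ cell k (line_pt y s).
  by move=> Ms /MP; rewrite leNgt => /negP; apply; rewrite lter_normr Ms.
(* Beyond the bound [M] the line is outside the cell and all hits lie below [s]. *)
pose s := M + 1; have sM : M < s by rewrite ltrDl.
have := @inner_sum s; rewrite /inside.
case: asboolP => [/interior_subset/(big_out _ sM)//|_].
move=> /(_ (fun h => big_out _ sM (boundary_cell hmesh h)))/esym/eqP.
rewrite oppr_eq0 => /eqP sum0; rewrite -big_filter -/hits -[RHS]sum0.
rewrite [RHS]big_mkcond/=; apply: eq_big_seq => j jh.
suff -> : tau j < s by [].
apply: le_lt_trans sM; apply: le_trans (ler_norm _) _; apply: MP.
by apply: (boundary_cell hmesh); case: (hit_timeP jh).
Qed.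

End line_scan_tau.

(* Each transversal crossing of the boundary toggles membership in the cell, and the
   line starts and ends outside of it. *)
Lemma line_scan k y : (forall s, generic cell nbr xi k (line_pt y s)) ->
  (forall j s, j \in nbr k -> F k j (line_pt y s) -> xi k j 0 l != 0) ->
  \sum_(j <- nbr k | hit k j y) Num.sg (xi k j 0 l) = 0.
Proof.
move=> gy transverse.
apply: (@line_scan_tau k y gy transverse (fun j => xget 0 [set s | F k j (line_pt y s)])).
move=> j; rewrite mem_filter => /andP[/asboolP ex _].
exact: (xgetPex 0 (ex : exists s, [set s | F k j (line_pt y s)] s)).
Qed.

End line_scan.

(** * Closure of the faces of a cell *)

Lemma sum_measureI {dd : measure_display} {T : measurableType dd} {R : realType}
    (m : {measure set T -> \bar R}) {J : Type} (s : seq J) {D : set T} {G : J -> set T} :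
  measurable D -> (forall j, measurable (G j)) ->
  (\sum_(j <- s) m (G j `&` D) = \int[m]_(y in D) \sum_(j <- s) (\1_(G j) y)%:E)%E.
Proof.
move=> mD mG; rewrite ge0_integral_sum//.
- by apply: eq_bigr => j _; rewrite integral_indic.
- by move=> j; apply/measurable_realfun.measurable_EFinP; exact: measurable_realfun.measurable_indic.
Qed.

Section closure.
Context {R : realType} {n : nat} {K : eqType} (cell : K -> set 'rV[R]_n.+2)
  (nbr : K -> seq K) (xi : K -> K -> 'rV[R]_n.+2).
Hypothesis hmesh : is_mesh cell nbr xi.
Local Notation F := (common_face cell).
Variables (k : K) (l : 'I_n.+2).

Let mu : {outer_measure set 'rV[R]_n.+1 -> \bar R} := hausdorff_lin (1%:M : 'M[R]_n.+1).

Let mu_haar : haar_outer mu.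
Proof. by apply: haar_hausdorff_lin; rewrite row_free_unit unitmx1. Qed.

Let faces : seq (K * K) := [seq (i, j) | i <- k :: nbr k, j <- nbr i].

Let facesP i j : i \in k :: nbr k -> j \in nbr i -> (i, j) \in faces.
Proof. by move=> ik ji; apply/allpairsPdep; exists i, j. Qed.

Let nu (f : K * K) := xi f.1 f.2.
(** An empty face gets the offset of the origin, which at worst adds further hyperplanes to the null
    set [Z]. *)
Let offset (f : K * K) : R := dot (nu f) (xget 0 (F f.1 f.2)).

Let offsetP i j x : j \in nbr i -> F i j x -> dot (xi i j) x = offset (i, j).
Proof.
move=> ji Fx; apply: (face_flat hmesh ji Fx) => /=.
exact: (xgetPex 0 (ex_intro _ x Fx)).
Qed.

Let nu_split (f : K * K) x : dot (nu f) x = nu f 0 l * x 0 l + dot (col' l (nu f)) (col' l x).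
Proof.
rewrite /dot (bigD1_ord l)//=; congr (_ + _).
by apply: eq_bigr => j _; rewrite !mxE.
Qed.

(* The hyperplanes of lines parallel to a face, and of lines through a point common to
   two nonparallel faces. *)
Let bad : seq ('rV[R]_n.+1 * R) :=
  [seq (if nu f 0 l == 0 then col' l (nu f) else 0, offset f) | f <- faces] ++
  [seq (nu f 0 l *: col' l (nu g) - nu g 0 l *: col' l (nu f),
        nu f 0 l * offset g - nu g 0 l * offset f) | f <- faces, g <- faces].

Let plane (h : 'rV[R]_n.+1 * R) := [set y | dot h.1 y = h.2].

Let Z : set 'rV[R]_n.+1 := \bigcup_(h in [set` [seq h <- bad | h.1 != 0]]) plane h.

Let nZ_transverse y i j s : ~ Z y -> i \in k :: nbr k -> j \in nbr i ->
  F i j (line_pt l y s) -> xi i j 0 l != 0.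
Proof.
move=> nZ ik ji Fy; apply/negP => /eqP x0; apply: nZ.
exists (col' l (xi i j), offset (i, j)); last first.
  have := offsetP ji Fy; rewrite (nu_split (i, j)) /nu/= x0 mul0r add0r.
  by rewrite col'_line_pt.
rewrite /= mem_filter mem_cat; apply/andP; split=> /=; last first.
  apply/orP; left; apply/mapP; exists (i, j); first exact: facesP.
  by rewrite /nu/= x0 eqxx.
have := normal_neq0 hmesh ji; apply: contra => /eqP c0; apply/eqP/rowP => a.
rewrite mxE; case: (unliftP l a) => [b ->|->//].
by have /rowP/(_ b) := c0; rewrite !mxE.
Qed.

(** The vector [w] arises by eliminating the coordinate [l] from the equations of two planes. A
    common point on the line over [y] would put [y] into the corresponding hyperplane unless
    [w = 0]; then the normals are proportional and, being unit vectors, equal up to sign. *)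
Let nZ_generic y s : ~ Z y -> generic cell nbr xi k (line_pt l y s).
Proof.
move=> nZ i j i' j' ik ji ik' ji' Fx Fx'.
have t := nZ_transverse nZ ik ji Fx.
pose w := nu (i, j) 0 l *: col' l (nu (i', j')) - nu (i', j') 0 l *: col' l (nu (i, j)).
have w0 : w = 0.
  apply: contrapT => /eqP w0; apply: nZ.
  exists (w, nu (i, j) 0 l * offset (i', j') - nu (i', j') 0 l * offset (i, j)).
    rewrite /= mem_filter w0 mem_cat; apply/orP; right; apply/allpairsP.
    by exists ((i, j), (i', j')); split=> //=; exact: facesP.
  rewrite /plane/= /w dotDl dotNl !dotZl.
  have := offsetP ji Fx; have := offsetP ji' Fx'.
  rewrite (nu_split (i, j)) (nu_split (i', j')) col'_line_pt => <- <-; ring.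
pose c := nu (i', j') 0 l / nu (i, j) 0 l.
have E : xi i' j' = c *: xi i j.
  apply/rowP => a; rewrite mxE; case: (unliftP l a) => [b ->|->].
    have /rowP/(_ b) := w0; rewrite !mxE /c /nu/= => /subr0_eq E.
    by apply: (mulfI t); rewrite E; field.
  by rewrite /c /nu/= divfK.
have [n1 _ _] := mesh_normal hmesh ji; have [n2 _ _] := mesh_normal hmesh ji'.
have : `|c| = 1 by rewrite -n2 E enormZ n1 mulr1.
by rewrite E; case/norm1_case => ->; rewrite ?scale1r ?scaleN1r; [left|right].
Qed.

Let Z_closed : closed Z.
Proof.
rewrite /Z; elim: [seq h <- bad | h.1 != 0] => [|h s IH].
  rewrite (_ : [set` [::]] = set0); last by apply/seteqP; split.
  by rewrite bigcup_set0; exact: closed0.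
rewrite (_ : [set` h :: s] = h |` [set` s]); last first.
  by apply/seteqP; split=> u /=; rewrite inE => /predU1P.
rewrite bigcup_setU1; apply: closedU => //.
apply: (@closed_comp _ _ (dot h.1) [set r : R | r = h.2]) => [x _|].
  exact: dot_continuous.
exact: closed_eq.
Qed.

Let muZ G M : (forall y, G y -> `|y| <= M) -> mu (G `&` Z) = 0%E.
Proof.
move=> GM; apply/eqP; rewrite eq_le outer_measure_ge0 andbT.
rewrite /Z setI_bigcupr.
have : all (fun h => h.1 != 0) [seq h <- bad | h.1 != 0] by exact: filter_all.
elim: [seq h <- bad | h.1 != 0] => [_|h s IH /= /andP[h0 /IH {}IH]].
  rewrite (_ : [set` [::]] = set0); last by apply/seteqP; split.
  by rewrite bigcup_set0 outer_measure0.
rewrite (_ : [set` h :: s] = h |` [set` s]); last first.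
  by apply/seteqP; split=> u /=; rewrite inE => /predU1P.
rewrite bigcup_setU1; apply: le_trans (outer_measureU2 _ _ _) _.
rewrite -[leRHS]adde0; apply: leeD IH.
rewrite -(haar_hyperplane mu_haar h.2 M h0); apply: le_outer_measure => y [Gy hy].
by split=> //; exact: GM.
Qed.

Let G j := col' l @` F k j.

Let G_compact j : compact (G j).
Proof.
apply: continuous_compact; last exact (@face_compact _ _ _ _ _ _ hmesh k j).
by apply: continuous_subspaceT; exact: col'_continuous.
Qed.

Let hitE j y : hit cell l k j y = `[< G j y >].
Proof.
apply: asbool_equiv_eq; split=> [[s Fs]|[x Fx <-]].
  by exists (line_pt l y s) => //; exact: col'_line_pt.
by exists (x 0 l); rewrite line_ptE.
Qed.

Let muG j : mu (G j) = mu (G j `\` Z) /\ mu (G j) \is a fin_num.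
Proof.
have [Gcl [M GM]] := compact_bound (@G_compact j).
split; last by rewrite ge0_fin_numE ?outer_measure_ge0//; exact: haar_bounded mu_haar _ _ GM.
rewrite (closed_caratheodory (haar_metric mu_haar) Z_closed (G j)) (muZ GM).
by rewrite add0e.
Qed.

(** The identity of [line_scan] is integrated over the complement of the null set [Z]. Faces with
    positive and negative [xi_l] are kept on opposite sides of the equation, so that only
    nonnegative functions are integrated. *)
Lemma projected_faces : \sum_(j <- nbr k) Num.sg (xi k j 0 l) * fine (mu (G j)) = 0.
Proof.
pose T := caratheodory_type mu.
pose m : {measure set T -> \bar R} := mu : set T -> \bar R.
have mZ : measurable (~` Z : set T).
  by apply: measurableC; exact: (closed_caratheodory (haar_metric mu_haar) Z_closed).
have mG j : measurable (G j : set T).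
  apply: (closed_caratheodory (haar_metric mu_haar)).
  by have [] := compact_bound (@G_compact j).
have int (s : seq K) : (\sum_(j <- s) mu (G j) =
    \int[m]_(y in ~` Z) \sum_(j <- s) (\1_(G j : set T) y)%:E)%E.
  rewrite -[RHS](sum_measureI m s mZ mG).
  by apply: eq_bigr => j _; rewrite [LHS](muG j).1 setDE.
have key : (\sum_(j <- nbr k | (0 < xi k j 0 l)%R) mu (G j) =
    \sum_(j <- nbr k | (xi k j 0 l < 0)%R) mu (G j))%E.
  rewrite -big_filter -[RHS]big_filter !int; apply: eq_integral => y; rewrite inE => nZ.
  have scan := @line_scan _ _ _ _ _ _ hmesh l k y (fun s => @nZ_generic y s nZ)
    (fun j s jk Fy => nZ_transverse nZ (mem_head _ _) jk Fy).
  rewrite !sumEFin !big_filter; congr _%:E; apply/eqP; rewrite -subr_eq0; apply/eqP.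
  rewrite -[RHS]scan big_mkcond [X in _ - X]big_mkcond -sumrB [RHS]big_mkcond.
  apply: eq_bigr => j _; rewrite hitE indicE.
  rewrite (_ : (y \in (G j : set T)) = `[< G j y >]) //.
  case: asboolP => _; have [x0|x0|x0] := ltrgt0P (xi k j 0 l); rewrite ?subrr//.
  - by rewrite gtr0_sg// subr0.
  - by rewrite ltr0_sg// sub0r.
  - by rewrite x0 sgr0.
have fin (P : pred K) : fine (\sum_(j <- nbr k | P j) mu (G j))%E =
    \sum_(j <- nbr k | P j) fine (mu (G j)).
  by rewrite -sum_fine// => j _; exact: (muG j).2.
have := congr1 fine key; rewrite !fin => {}key.
rewrite (bigID (fun j => 0 < xi k j 0 l))/=.
rewrite (eq_bigr (fun j => fine (mu (G j)))) => [|j x0]; last by rewrite gtr0_sg ?mul1r.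
rewrite key (bigID (fun j => xi k j 0 l < 0) (fun j => ~~ _))/=.
rewrite [X in _ + (_ + X)]big1 => [|j /andP[]]; last first.
  by rewrite -!leNgt => x0 x1; rewrite (le_anti (introT andP (conj x0 x1))) sgr0 mul0r.
rewrite addr0 [X in _ + X](_ : _ = \sum_(j <- nbr k | xi k j 0 l < 0) - fine (mu (G j))).
  by rewrite sumrN subrr.
apply: eq_big => [j|j /andP[_ x0]]; last by rewrite ltr0_sg ?mulN1r.
by rewrite -leNgt andb_idl// => /ltW.
Qed.

Lemma faces_closed_l : \sum_(j <- nbr k) face_size cell k j * xi k j 0 l = 0.
Proof.
rewrite -[RHS]projected_faces big_seq [RHS]big_seq; apply: eq_bigr => j jk.
have [->|x0] := eqVneq (xi k j 0 l) 0; first by rewrite mulr0 sgr0 mul0r.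
have [n1 flat _] := mesh_normal hmesh jk.
have -> : fine (mu (G j)) = face_size cell k j * `|xi k j 0 l|.
  apply/esym; apply: (@hausdorff_flat _ _ l (xi k j) (offset (k, j))) => //.
    exact (@face_compact _ _ _ _ _ _ hmesh k j).
  by move=> x; exact: offsetP.
by rewrite mulrCA -numEsg.
Qed.

End closure.

Lemma faces_closed {R : realType} {n : nat} {K : eqType} (cell : K -> set 'rV[R]_n.+2)
    (nbr : K -> seq K) (xi : K -> K -> 'rV[R]_n.+2) k : is_mesh cell nbr xi ->
  \sum_(j <- nbr k) face_size cell k j *: xi k j = 0.
Proof.
move=> hmesh; apply/rowP => l; rewrite summxE mxE -[RHS](faces_closed_l hmesh k l).
by apply: eq_bigr => j _; rewrite mxE.
Qed.

(** * Causality inequalities *)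

Section em.
Context {R : realType}.
Implicit Types (x y v n : 'rV[R]_3).

Lemma dot3E x y : dot x y =
  x 0 ord0 * y 0 ord0 + x 0 (lift ord0 ord0) * y 0 (lift ord0 ord0) +
  x 0 (lift ord0 (lift ord0 ord0)) * y 0 (lift ord0 (lift ord0 ord0)).
Proof. by rewrite /dot !big_ord_recl big_ord0 addr0 addrA. Qed.

Definition cross x y : 'rV[R]_3 := \row_(i < 3)
  [:: x 0 (lift ord0 ord0) * y 0 (lift ord0 (lift ord0 ord0))
        - x 0 (lift ord0 (lift ord0 ord0)) * y 0 (lift ord0 ord0);
      x 0 (lift ord0 (lift ord0 ord0)) * y 0 ord0
        - x 0 ord0 * y 0 (lift ord0 (lift ord0 ord0));
      x 0 ord0 * y 0 (lift ord0 ord0) - x 0 (lift ord0 ord0) * y 0 ord0]`_i.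

Lemma addr_ge0_sqr (a b : R) : 0 <= a -> b ^+ 2 <= a ^+ 2 -> 0 <= a + b.
Proof.
move=> a0; rewrite -ler_sqrt ?sqr_ge0// !sqrtr_sqr (ger0_norm a0) ler_norml.
by move=> /andP[? _]; lra.
Qed.

Definition em_energy x y : R := 2^-1 * (dot x x + dot y y).

(* Minus the contraction of the stress-energy tensor of an electromagnetic field with
   the causal vectors (1, v) and (1, -n). *)
Definition em_flux x y v n : R := em_energy x y * (1 - dot v n) - dot (cross x y) v
  + dot (cross x y) n + dot x v * dot x n + dot y v * dot y n.

(** [(J0, J)] is the energy-momentum current seen along [(1, v)]. By the Lagrange identity the
    Poynting vector [S] satisfies [|S| <= e], and the Rainich identity turns this into [|J| <= J0].
    The current is thus causal, and Cauchy-Schwarz bounds its pairing with [n]. *)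
Lemma em_flux_ge0 x y v n : dot v v < 1 -> dot n n <= 1 -> 0 <= em_flux x y v n.
Proof.
move=> v1 n1; pose S := cross x y; pose e := em_energy x y.
pose J0 := e - dot S v; pose J := S + dot x v *: x + dot y v *: y - e *: v.
have lagrange : dot S S = dot x x * dot y y - dot x y ^+ 2.
  by rewrite /S !dot3E !mxE /=; ring.
have dotx0 := dot_ge0 x; have doty0 := dot_ge0 y.
have e0 : 0 <= e by rewrite /e /em_energy; lra.
have eS : 0 <= e ^+ 2 - dot S S.
  rewrite lagrange /e /em_energy.
  have := sqr_ge0 (dot x x - dot y y); have := sqr_ge0 (dot x y); nra.
have rainich : J0 ^+ 2 - dot J J = (e ^+ 2 - dot S S) * (1 - dot v v).
  by rewrite /J0 /J /e /em_energy /S !dot3E !mxE /=; field.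
have J00 : 0 <= J0.
  rewrite /J0; apply: addr_ge0_sqr => //; rewrite sqrrN.
  apply: le_trans (cauchy_dot _ _) _; have := dot_ge0 S; have := dot_ge0 v; nra.
have -> : em_flux x y v n = J0 + dot J n.
  rewrite /em_flux /J0 /J !dotDl dotNl !dotZl -/e -/S; ring.
apply: addr_ge0_sqr => //; apply: le_trans (cauchy_dot _ _) _.
have JJ : dot J J <= J0 ^+ 2.
  by rewrite -subr_ge0 rainich mulr_ge0// subr_ge0 ltW.
by have := dot_ge0 J; have := dot_ge0 n; nra.
Qed.

(** The expression is [em_flux] of the difference of two ideal fields: an ideal field with velocity
    [v] and magnetic part [B] has electric part [- v x B], and the field of [(vs, Bs)] is subtracted
    from that of [(v, B)]. *)
Lemma magnetic_ge0 (v B vs Bs n : 'rV[R]_3) : dot vs vs < 1 -> dot n n <= 1 ->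
  0 <= - (dot B B * dot vs v - dot v B * dot vs B) * (1 + dot n v)
    + dot n B * ((1 - dot v v) * dot vs B + dot v B * dot vs v)
    - 2^-1 * ((1 - dot v v) * dot B B + dot v B ^+ 2) * (1 + dot n vs)
    + (1 - dot vs vs) * (dot n B * dot Bs v - dot Bs B * (1 + dot n v))
    + dot vs Bs * (dot n B * dot vs v - dot vs B * (1 + dot n v))
    + dot B B + dot B B * dot n v - dot v B * dot n B
    + 2^-1 * ((1 - dot vs vs) * dot Bs Bs + dot vs Bs ^+ 2) * (1 + dot n vs)
    - dot n B * dot vs Bs.
Proof.
move=> vs1 n1; have := em_flux_ge0 (cross vs Bs - cross v B) (B - Bs) vs1 n1.
move=> em; apply: (le_trans em); rewrite le_eqVlt; apply/orP; left; apply/eqP; clear em.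
rewrite /em_flux /em_energy !dot3E !mxE /=.
move: (v 0 _) (v 0 _) (v 0 _) (B 0 _) (B 0 _) (B 0 _) => v0 v1 v2 B0 B1 B2.
move: (vs 0 _) (vs 0 _) (vs 0 _) (Bs 0 _) (Bs 0 _) (Bs 0 _) => u0 u1 u2 C0 C1 C2.
move: (n 0 _) (n 0 _) (n 0 _) => n0 n1' n2.
by field.
Qed.

End em.

(** * Causality of the fluid part *)

Section hydro.
Context {R : realType}.
Implicit Types (v vs n : 'rV[R]_3).

(* [A vs - C v] with [A = 1 + n.v], [C = 1 + n.vs] is, up to a factor, the spatial part
   of a spacelike vector. *)
Lemma causal_ineq v vs n : dot n n <= 1 ->
  (1 + dot n vs) ^+ 2 * (1 - dot v v)
    - 2 * (1 + dot n vs) * (1 + dot n v) * (1 - dot v vs)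
    + (1 - dot vs vs) * (1 + dot n v) ^+ 2 <= 0.
Proof.
move=> n1; set A := 1 + dot n v; set C := 1 + dot n vs.
pose X := A *: vs - C *: v.
have Xn : dot X n = C - A.
  by rewrite /X dotDl dotNl !dotZl (dotC vs) (dotC v) /A /C; ring.
have XX : dot X X = A ^+ 2 * dot vs vs - 2 * A * C * dot v vs + C ^+ 2 * dot v v.
  by rewrite /X !(dotDl, dotDr, dotNl, dotNr, dotZl, dotZr) (dotC vs v); ring.
have := cauchy_dot X n; rewrite Xn XX.
have := dot_ge0 X; rewrite XX.
set a := dot vs vs; set b := dot v vs; set c := dot v v; set q := dot n n => h0 h1.
have : (A ^+ 2 * a - 2 * A * C * b + C ^+ 2 * c) * q <=
    A ^+ 2 * a - 2 * A * C * b + C ^+ 2 * c by rewrite ler_piMr.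
by lra.
Qed.

Lemma ler_of_sqr (a b : R) : 0 <= b -> a ^+ 2 <= b ^+ 2 -> a <= b.
Proof.
move=> b0; rewrite -ler_sqrt ?sqr_ge0// !sqrtr_sqr (ger0_norm b0).
by apply: le_trans; exact: ler_norm.
Qed.

Lemma ltr_of_sqr (a b : R) : 0 <= b -> a ^+ 2 < b ^+ 2 -> a < b.
Proof.
move=> b0 ab; have := ler_of_sqr b0 (ltW ab); rewrite le_eqVlt => /predU1P[E|//].
by rewrite E ltxx in ab.
Qed.

Lemma dot_unit_gt v n : dot v v < 1 -> dot n n <= 1 -> 0 < 1 + dot n v.
Proof.
move=> v1 n1; suff : - dot n v < 1 by lra.
apply: ltr_of_sqr => //; rewrite sqrrN expr1n; apply: le_lt_trans (cauchy_dot _ _) _.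
apply: le_lt_trans v1; rewrite ler_piMl//; exact: dot_ge0.
Qed.

Lemma dot_unit_lt v n : dot v v < 1 -> dot n n <= 1 -> 0 < 1 - dot n v.
Proof. by move=> v1 n1; have := @dot_unit_gt v (- n) v1; rewrite dotNl dotNr opprK dotNl => /(_ n1). Qed.

Variables (rho p eta : R).
Hypotheses (rho0 : 0 < rho) (p0 : 0 < p) (hrho : Num.sqrt (rho ^+ 2 + p ^+ 2) + p <= eta).

Let q := Num.sqrt (rho ^+ 2 + p ^+ 2).
Let q2 : q ^+ 2 = rho ^+ 2 + p ^+ 2.
Proof. by rewrite sqr_sqrtr// addr_ge0// sqr_ge0. Qed.
Let q0 : 0 < q.
Proof. by rewrite sqrtr_gt0 addr_gt0// exprn_gt0. Qed.

Let cauchy2 (a b : R) : (p * a + rho * b) ^+ 2 <= q ^+ 2 * (a ^+ 2 + b ^+ 2).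
Proof.
rewrite q2 -subr_ge0.
by have -> : (rho ^+ 2 + p ^+ 2) * (a ^+ 2 + b ^+ 2) - (p * a + rho * b) ^+ 2 =
  (p * b - rho * a) ^+ 2; [ring|exact: sqr_ge0].
Qed.

(** [eta] stands for [rho * h], and [hrho] is bound (i) times [rho]. After replacing [eta] by
    [q + p], Cauchy-Schwarz for [(p, rho)], a vector of length [q], leaves
    [(C w - b A)^2 + (g A)^2 <= (b A)^2], which is [causal_ineq] times [w]. *)
Lemma hydro_ge0 v vs n : dot v v < 1 -> dot vs vs < 1 -> dot n n <= 1 ->
  0 <= eta * (1 - dot v vs) * (1 + dot n v) - p * (1 + dot n vs) * (1 - dot v v)
     - rho * (Num.sqrt (1 - dot v v) * Num.sqrt (1 - dot vs vs)) * (1 + dot n v).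
Proof.
move=> v1 vs1 n1; have causal := causal_ineq v vs n1.
have A0 := dot_unit_gt v1 n1; have C0 := dot_unit_gt vs1 n1.
have b0 := dot_unit_lt vs1 (ltW v1).
set A := 1 + dot n v in causal A0 *; set C := 1 + dot n vs in causal C0 *.
set b := 1 - dot v vs in causal b0 *.
have w0 : 0 < 1 - dot v v by lra.
have s0 : 0 < 1 - dot vs vs by lra.
set w := 1 - dot v v in causal w0 *; set s := 1 - dot vs vs in causal s0 *.
pose g := Num.sqrt w * Num.sqrt s.
have g2 : g ^+ 2 = w * s by rewrite exprMn !sqr_sqrtr ?ltW.
have bA0 : 0 < b * A by rewrite mulr_gt0.
have E : p * (C * w - b * A) + rho * (g * A) <= q * (b * A).
  apply: ler_of_sqr; first by rewrite mulr_ge0 ?ltW.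
  apply: le_trans (cauchy2 _ _) _; rewrite [leRHS]exprMn ler_wpM2l ?sqr_ge0//.
  rewrite [(g * A) ^+ 2]exprMn g2.
  have := mulr_ge0_le0 (ltW w0) causal.
  by lra.
have : (q + p) * (b * A) <= eta * (b * A) by rewrite ler_wpM2r// ltW.
by rewrite -/g; lra.
Qed.

(** The case [n = 0] made strict. The defect in the last inequality is [w * |vs - v|^2], positive
    unless [vs = v]; in that case strictness comes from [rho < q]. *)
Lemma hydro_gt0 v vs : dot v v < 1 -> dot vs vs < 1 ->
  0 < eta * (1 - dot v vs) - p * (1 - dot v v)
     - rho * (Num.sqrt (1 - dot v v) * Num.sqrt (1 - dot vs vs)).
Proof.
move=> v1 vs1; have b0 := dot_unit_lt vs1 (ltW v1).
have XX := dot_ge0 (vs - v); have XX0 := dot_eq0 (vs - v).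
have XE : dot (vs - v) (vs - v) = dot vs vs - 2 * dot v vs + dot v v.
  by rewrite !(dotDl, dotDr, dotNl, dotNr) (dotC vs v); ring.
set X := dot (vs - v) (vs - v) in XX XX0 XE *.
set b := 1 - dot v vs in b0 *.
have w0 : 0 < 1 - dot v v by lra.
have s0 : 0 < 1 - dot vs vs by lra.
set w := 1 - dot v v in w0 *; set s := 1 - dot vs vs in s0 *.
pose g := Num.sqrt w * Num.sqrt s.
have g2 : g ^+ 2 = w * s by rewrite exprMn !sqr_sqrtr ?ltW.
have E : p * (w - b) + rho * g < q * b.
  have [X0|X0] := eqVneq X 0.
    have := XX0; rewrite X0 eqxx => /esym/eqP/subr0_eq E.
    have bw : b = w by rewrite /b /w E.
    have gw : g = w by rewrite /g /w /s E -expr2 sqr_sqrtr// ltW.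
    rewrite bw gw subrr mulr0 add0r ltr_pM2r//.
    apply: ltr_of_sqr; rewrite ?(ltW q0)// q2 ltrDl; exact: exprn_gt0.
  apply: ltr_of_sqr; first by rewrite mulr_ge0 ?ltW.
  apply: le_lt_trans (cauchy2 _ _) _; rewrite [ltRHS]exprMn ltr_pM2l ?exprn_gt0// g2.
  have Xpos : 0 < X by rewrite lt_def X0.
  have := mulr_gt0 w0 Xpos; rewrite XE /b /w /s; lra.
have : (q + p) * b <= eta * b by rewrite ler_wpM2r// ltW.
by rewrite -/g; lra.
Qed.

End hydro.

(** * Conservative states and fluxes *)

Section state.
Context {R : realType}.
Implicit Types (U V : state R) (v B vs Bs n : 'rV[R]_3).

Definition stE U : R := rsubmx (rsubmx (rsubmx U)) 0 0.

Lemma stD_mk D m B E : stD (mkstate D m B E : state R) = D.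
Proof. by rewrite /stD /mkstate row_mxKl mxE eqxx. Qed.

Lemma stm_mk D m B E : stm (mkstate D m B E : state R) = m.
Proof. by rewrite /stm /mkstate row_mxKr row_mxKl. Qed.

Lemma stB_mk D m B E : stB (mkstate D m B E : state R) = B.
Proof. by rewrite /stB /mkstate !row_mxKr row_mxKl. Qed.

Lemma stE_mk D m B E : stE (mkstate D m B E : state R) = E.
Proof. by rewrite /stE /mkstate !row_mxKr mxE eqxx. Qed.

Definition mkE := (stD_mk, stm_mk, stB_mk, stE_mk).

Lemma stateE U : U = mkstate (stD U) (stm U) (stB U) (stE U).
Proof.
have scalar (M : 'M[R]_1) : M = (M 0 0)%:M by rewrite -mx11_scalar.
by rewrite /mkstate /stD /stm /stB /stE -!scalar !hsubmxK.
Qed.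

Lemma state_linear c U V : [/\ stD (c *: U + V) = c * stD U + stD V,
  stm (c *: U + V) = c *: stm U + stm V, stB (c *: U + V) = c *: stB U + stB V &
  stE (c *: U + V) = c * stE U + stE V].
Proof. by rewrite /stD /stm /stB /stE !linearP/= !mxE. Qed.

Definition pmag v B : R := 2^-1 * ((1 - dot v v) * dot B B + dot v B ^+ 2).

Definition functional vs Bs U : R := stE U - dot vs (stm U) -
  Num.sqrt (1 - dot vs vs) * stD U -
  dot ((1 - dot vs vs) *: Bs + dot vs Bs *: vs) (stB U).

Lemma functional_linear vs Bs c U V :
  functional vs Bs (c *: U + V) = c * functional vs Bs U + functional vs Bs V.
Proof.
have [D m B E] := state_linear c U V.
by rewrite /functional D m B E !(dotDr, dotZr); ring.
Qed.

Lemma functional0 vs Bs : functional vs Bs 0 = 0.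
Proof.
have := functional_linear vs Bs (-1) 0 0.
by rewrite scaleN1r oppr0 addr0 mulN1r addNr.
Qed.

(** The flux along an arbitrary vector [n] of R^3, linear in [n]. It allows the scaled direction
    [- xi / alpha] as well as [n = 0]. *)
Definition gen_flux p v U n : state R := let B := stB U in
  mkstate (stD U * dot n v)
    (dot n v *: stm U - dot n B *: ((lorentz v) ^- 2 *: B + dot v B *: v) + ptot p v B *: n)
    (dot n v *: B - dot n B *: v) (dot n (stm U)).

Lemma mkstate_linear c D m B E D' m' B' E' :
  c *: (mkstate D m B E : state R) + mkstate D' m' B' E' =
  mkstate (c * D + D') (c *: m + m') (c *: B + B') (c * E + E').
Proof.
have [h1 h2 h3 h4] := state_linear c (mkstate D m B E) (mkstate D' m' B' E').
by rewrite [LHS]stateE h1 h2 h3 h4 !mkE.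
Qed.

Lemma gen_flux_linear p v U c n n' :
  gen_flux p v U (c *: n + n') = c *: gen_flux p v U n + gen_flux p v U n'.
Proof.
rewrite /gen_flux mkstate_linear !dotDl !dotZl; congr mkstate.
- ring.
- by apply/rowP => i; rewrite !mxE; ring.
- by apply/rowP => i; rewrite !mxE; ring.
Qed.

Lemma gen_flux0 p v U : gen_flux p v U 0 = 0.
Proof.
have := gen_flux_linear p v U (-1) 0 0.
by rewrite scaleN1r oppr0 addr0 scaleN1r addNr.
Qed.

Lemma enorm_lt1 v : (enorm v < 1) = (dot v v < 1).
Proof. by rewrite -sqr_enorm expr_lt1// enorm_ge0. Qed.

Lemma lorentzV2 v : dot v v < 1 -> (lorentz v) ^- 2 = 1 - dot v v.
Proof.
move=> v1; rewrite /lorentz exprVn invrK sqr_enorm sqr_sqrtr//.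
by rewrite subr_ge0 ltW.
Qed.

Section primitive.
Variables (h : R -> R -> R) (heos : eos h) (U : state R) (rho p : R) (v : 'rV[R]_3).
Hypothesis hprim : is_prim h U (rho, p, v).

Local Notation w := (1 - dot v v).
Local Notation B := (stB U).

Lemma prim_speed : dot v v < 1.
Proof. by case: hprim => _ _ + _; rewrite enorm_lt1. Qed.

Lemma prim_cons : [/\ stD U = rho / Num.sqrt w,
  stm U = (rho * h p rho / w) *: v + dot B B *: v - dot v B *: B &
  stE U = rho * h p rho / w - (p + pmag v B) + dot B B].
Proof.
have v1 := prim_speed; case: hprim => rho0 p0 _ UE.
have W2 : lorentz v ^+ 2 = w^-1 by rewrite -(lorentzV2 v1) invrK.
split; rewrite {1}UE /cons_of_prim !mkE.
- by rewrite /lorentz sqr_enorm.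
- by rewrite W2 sqr_enorm.
- by rewrite /ptot lorentzV2// W2 sqr_enorm.
Qed.

Lemma prim_enthalpy : Num.sqrt (rho ^+ 2 + p ^+ 2) + p <= rho * h p rho.
Proof.
case: hprim => rho0 p0 _ _; have := eos_lower heos p0 rho0.
rewrite -(ler_pM2l rho0); apply: le_trans.
rewrite mulrDr (mulrCA rho) divff ?gt_eqF// mulr1 lerD2r.
rewrite -[X in X * _](ger0_norm (ltW rho0)) -sqrtr_sqr -sqrtrM ?sqr_ge0//.
rewrite mulrDr mulr1 (mulrCA (rho ^+ 2)) divff ?mulr1// expf_neq0// gt_eqF//.
Qed.

Lemma prim_D_gt0 : 0 < stD U.
Proof.
have [-> _ _] := prim_cons; case: hprim => rho0 _ _ _.
by rewrite divr_gt0// sqrtr_gt0 subr_gt0 prim_speed.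
Qed.

(** The terms with density and pressure are collected in the expression of [hydro_ge0], divided by
    [W^-2]; the remaining terms, quadratic in [B] and [Bs], are those of [magnetic_ge0]. *)
Let expansion vs Bs n : functional vs Bs U + functional vs Bs (gen_flux p v U n)
    + pmag vs Bs * (1 + dot n vs) - dot n B * dot vs Bs =
  (rho * h p rho * (1 - dot v vs) * (1 + dot n v) - p * (1 + dot n vs) * w
     - rho * (Num.sqrt w * Num.sqrt (1 - dot vs vs)) * (1 + dot n v)) / w +
  (- (dot B B * dot vs v - dot v B * dot vs B) * (1 + dot n v)
    + dot n B * ((1 - dot v v) * dot vs B + dot v B * dot vs v)
    - 2^-1 * ((1 - dot v v) * dot B B + dot v B ^+ 2) * (1 + dot n vs)
    + (1 - dot vs vs) * (dot n B * dot Bs v - dot Bs B * (1 + dot n v))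
    + dot vs Bs * (dot n B * dot vs v - dot vs B * (1 + dot n v))
    + dot B B + dot B B * dot n v - dot v B * dot n B
    + 2^-1 * ((1 - dot vs vs) * dot Bs Bs + dot vs Bs ^+ 2) * (1 + dot n vs)
    - dot n B * dot vs Bs).
Proof.
have v1 := prim_speed; have [D m E] := prim_cons.
have w0 : w != 0 by rewrite subr_eq0 gt_eqF.
(* Writing [W^-2] as the square of a named root leaves a rational identity, which [field] can
   decide. *)
have [r [r0 rE r2]] : exists r, [/\ r != 0, Num.sqrt w = r & w = r ^+ 2].
  have r2 : w = Num.sqrt w ^+ 2 by rewrite sqr_sqrtr// subr_ge0 ltW.
  by exists (Num.sqrt w); split=> //; apply: contraNneq w0 => r0; rewrite r2 r0 expr0n.
rewrite /functional /gen_flux !mkE /ptot sqr_enorm (lorentzV2 v1) -/(pmag v B) D m E.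
rewrite !(dotDl, dotDr, dotNl, dotNr, dotZl, dotZr) (dotC vs n) (dotC v vs) /pmag.
move: (h p rho) => eta; rewrite rE r2.
move: (Num.sqrt (1 - dot vs vs)) => s.
by field.
Qed.

Lemma split_ge0 vs Bs n : dot vs vs < 1 -> dot n n <= 1 ->
  0 <= functional vs Bs U + functional vs Bs (gen_flux p v U n)
    + pmag vs Bs * (1 + dot n vs) - dot n B * dot vs Bs.
Proof.
move=> vs1 n1; have v1 := prim_speed; rewrite expansion.
case: hprim => rho0 p0 _ _.
apply: addr_ge0; last exact: magnetic_ge0.
apply: divr_ge0; last by rewrite subr_ge0 ltW.
exact: (hydro_ge0 rho0 p0 prim_enthalpy).
Qed.

Lemma functional_gt0 vs Bs : dot vs vs < 1 -> 0 < functional vs Bs U + pmag vs Bs.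
Proof.
move=> vs1; have v1 := prim_speed.
have f0 : functional vs Bs (gen_flux p v U 0) = 0 by rewrite gen_flux0 functional0.
have := expansion vs Bs 0; rewrite f0 !dot0l !addr0 !mul0r !subr0 !mulr1 => ->.
case: hprim => rho0 p0 _ _.
have hg := hydro_gt0 rho0 p0 prim_enthalpy v1 vs1.
apply: ltr_pwDl; first by rewrite divr_gt0// subr_gt0.
have := @magnetic_ge0 R v B vs Bs 0 vs1; rewrite dot0l ler01 => /(_ isT).
by rewrite !dot0l !addr0 !mul0r !subr0 !mulr1 addr0.
Qed.

Lemma split_D_ge0 n : dot n n <= 1 -> 0 <= stD U + stD (gen_flux p v U n).
Proof.
move=> n1; rewrite /gen_flux mkE -[X in X + _]mulr1 -mulrDr.
by rewrite mulr_ge0 ?(ltW prim_D_gt0)// ltW// dot_unit_gt// prim_speed.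
Qed.

End primitive.

Section direction.
Context {d : nat}.
Hypothesis hd : (d <= 3)%N.
Implicit Types xi : 'rV[R]_d.

Definition emb3 xi : 'rV[R]_3 := \sum_(l < d) xi 0 l *: delta_mx 0 (inord l).

Lemma dot_delta3 (x : 'rV[R]_3) i : dot (delta_mx 0 i) x = x 0 i.
Proof.
rewrite /dot (bigD1 i)//= mxE !eqxx mul1r big1 ?addr0// => j ji.
by rewrite mxE (negbTE ji) andbF mul0r.
Qed.

Lemma dot_emb3 xi x : dot (emb3 xi) x = \sum_(l < d) xi 0 l * x 0 (inord l).
Proof.
rewrite /emb3; elim/big_ind2: _ => [|a b a' b' <- <-|l _]; first exact: dot0l.
  by rewrite dotDl.
by rewrite dotZl dot_delta3.
Qed.

Lemma emb3_dot xi : dot (emb3 xi) (emb3 xi) = dot xi xi.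
Proof.
rewrite dot_emb3; apply: eq_bigr => l _; congr (_ * _).
rewrite -[LHS]dot_delta3 dotC dot_emb3 (bigD1 l)//= mxE !eqxx mulr1 big1 ?addr0// => i il.
rewrite mxE eqxx/= -val_eqE/= !inordK ?(leq_trans (ltn_ord _))//.
by rewrite val_eqE (negbTE il) mulr0.
Qed.

Lemma emb3_linear c xi xi' : emb3 (c *: xi + xi') = c *: emb3 xi + emb3 xi'.
Proof.
rewrite /emb3 scaler_sumr -big_split/=; apply: eq_bigr => l _.
by rewrite !mxE scalerDl scalerA.
Qed.

Lemma dirB_emb3 xi B : dirB xi B = dot (emb3 xi) B.
Proof. by rewrite dot_emb3. Qed.

Lemma dirF_gen_flux h xi U rho p v : prim_of h U = (rho, p, v) ->
  dirF h xi U = gen_flux p v U (emb3 xi).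
Proof.
move=> UE; have fluxE i : flux h i U = gen_flux p v U (delta_mx 0 i).
  by rewrite /flux UE /gen_flux !dot_delta3.
rewrite /emb3 /dirF; elim/big_rec2: _ => [|l a b _ ->]; first by rewrite gen_flux0.
by rewrite gen_flux_linear fluxE.
Qed.

End direction.

End state.

(** * Recovery of the primitive variables *)

Lemma ivt {R : realType} (f : R -> R) a b y : a <= b ->
  (forall z, a <= z <= b -> {for z, continuous f}) -> f a <= y <= f b ->
  exists2 z, a <= z <= b & f z = y.
Proof.
move=> ab fc /andP[fa fb].
have fc' : {within `[a, b], continuous f}.
  by apply: continuous_in_subspaceT => z; rewrite inE/= in_itv/=; exact: fc.
have fy : Num.min (f a) (f b) <= y <= Num.max (f a) (f b).
  by rewrite ge_min fa/= le_max fb orbT.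
by have [z] := IVT ab fc' fy; rewrite in_itv => zab E; exists z.
Qed.

Section eos_theory.
Context {R : realType} {h : R -> R -> R} (heos : eos h).

Lemma eos_continuous (f g : R -> R) z : {for z, continuous f} -> {for z, continuous g} ->
  0 < f z -> 0 < g z -> {for z, continuous (fun t => h (f t) (g t))}.
Proof.
move=> fc gc f0 g0.
apply: (@continuous_comp _ _ _ (fun t => (f t, g t)) (fun x : R * R => h x.1 x.2)).
  exact (cvg_pair fc gc).
by apply: differentiable_continuous; exact: eos_differentiable.
Qed.

Lemma eos_density_derivable p r : 0 < p -> 0 < r -> derivable (h p) r 1.
Proof.
move=> p0 r0; apply/derivable1_diffP.
have -> : h p = (fun x : R * R => h x.1 x.2) \o (fun t => (p, t)) by [].
apply: differentiable_comp; last exact: eos_differentiable.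
by apply: differentiable_pair; [exact: differentiable_cst|exact: ex_diff].
Qed.

Lemma eos_antitone p r1 r2 : 0 < p -> 0 < r1 -> r1 <= r2 -> h p r2 <= h p r1.
Proof.
move=> p0 r10 r12; have [E|r12'] := eqVneq r1 r2; first by rewrite E.
have {r12' r12}r12 : r1 < r2 by rewrite lt_def eq_sym r12'.
have der x : x \in `]r1, r2[%R -> 0 < x.
  by rewrite in_itv/= => /andP[/(lt_trans r10)].
apply: (@ler0_derive1_le_cc R (h p) r1 r2) => [x|x||||].
- by move=> /der; exact: eos_density_derivable.
- by move=> /der x0; exact/ltW/(eos_deriv_neg heos).
- apply: continuous_in_subspaceT => x; rewrite inE/= in_itv/= => /andP[rx _].
  apply: differentiable_continuous; apply/derivable1_diffP.
  by apply: eos_density_derivable => //; exact: lt_le_trans rx.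
- by rewrite in_itv/= lexx ltW.
- by rewrite in_itv/= lexx ltW.
- exact: ltW.
Qed.

Lemma eos_gt0 p r : 0 < p -> 0 < r -> 0 < h p r.
Proof.
move=> p0 r0; apply: lt_le_trans (eos_lower heos p0 r0).
by rewrite ltr_wpDl ?sqrtr_ge0// divr_gt0.
Qed.

Lemma eos_pressure p r : 0 < p -> 0 < r -> 2 * p <= r * h p r.
Proof.
move=> p0 r0; have hl := eos_lower heos p0 r0; rewrite -(ler_pM2l r0) in hl.
apply: le_trans hl; have pr : p / r <= Num.sqrt (1 + p ^+ 2 / r ^+ 2).
  have pr0 : 0 <= p / r by rewrite divr_ge0 ?ltW.
  rewrite -[leLHS](ger0_norm pr0) -sqrtr_sqr ler_wsqrtr// expr_div_n.
  by rewrite lerDr.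
have -> : 2 * p = r * (p / r + p / r) by field; rewrite gt_eqF.
by rewrite ler_pM2l// lerD2r.
Qed.

End eos_theory.

(* The unknown is [z = rho h W^2]: the velocity, hence [sigma z = |v|^2], and then the
   pressure are explicit functions of [z]. *)
Section recovery_scalar.
Context {R : realType} {h : R -> R -> R} (heos : eos h) (M b c D E : R).
Hypotheses (M0 : 0 <= M) (b0 : 0 <= b) (cMb : c ^+ 2 <= M * b) (D0 : 0 < D).

(** The squared length of [v = (m + (c / z) B) / (z + b)], the solution of the momentum equation,
    with [M = |m|^2], [b = |B|^2], [c = m.B]. The form with inverses makes it visibly decreasing in
    [z]. *)
Definition sigma z := M * (z + b)^-1 ^+ 2 +
  c ^+ 2 * (z^-1 * (z + b)^-1 * (z^-1 + (z + b)^-1)).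

(** The energy equation solved for the pressure, with [v.B = c / z]. *)
Definition pressure z := z - E + b - 2^-1 * ((1 - sigma z) * b + (c / z) ^+ 2).

Let zb z : 0 < z -> 0 < z + b. Proof. by move=> z0; rewrite ltr_wpDr. Qed.

Lemma sigmaE z : 0 < z ->
  sigma z * z ^+ 2 * (z + b) ^+ 2 = M * z ^+ 2 + c ^+ 2 * (2 * z + b).
Proof.
by move=> z0; rewrite /sigma; field; rewrite (gt_eqF (zb z0)) (gt_eqF z0).
Qed.

Lemma sigma_ge0 z : 0 < z -> 0 <= sigma z.
Proof.
move=> z0; have a0 : 0 <= z^-1 by rewrite invr_ge0 ltW.
have e0 : 0 <= (z + b)^-1 by rewrite invr_ge0 ltW// zb.
apply: addr_ge0; first by apply: mulr_ge0 => //; exact: sqr_ge0.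
apply: mulr_ge0; first exact: sqr_ge0.
by apply: mulr_ge0; [exact: mulr_ge0|exact: addr_ge0].
Qed.

Lemma sigma_antitone z z' : 0 < z -> z <= z' -> sigma z' <= sigma z.
Proof.
move=> z0 zz'; have z'0 := lt_le_trans z0 zz'; have zb0 := zb z0; have zb0' := zb z'0.
have a0 : 0 <= z'^-1 by rewrite invr_ge0 ltW.
have e0 : 0 <= (z' + b)^-1 by rewrite invr_ge0 ltW.
have aa : z'^-1 <= z^-1 by rewrite lef_pV2.
have ee : (z' + b)^-1 <= (z + b)^-1 by rewrite lef_pV2 ?posrE// lerD2r.
rewrite /sigma lerD// ler_wpM2l ?sqr_ge0//; first by rewrite ler_sqr ?nnegrE// (le_trans e0).
by rewrite ler_pM ?mulr_ge0 ?addr_ge0// ?ler_pM ?lerD.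
Qed.

Lemma sigma_upper z : 0 < z -> z ^+ 2 * sigma z <= M.
Proof.
move=> z0; have zb2 : 0 < (z + b) ^+ 2 by rewrite exprn_gt0// zb.
rewrite -(ler_pM2r zb2) [z ^+ 2 * _]mulrC sigmaE// -subr_ge0.
have -> : M * (z + b) ^+ 2 - (M * z ^+ 2 + c ^+ 2 * (2 * z + b)) =
  (M * b - c ^+ 2) * (2 * z + b) by ring.
by rewrite mulr_ge0 ?subr_ge0// addr_ge0// mulr_ge0// ltW.
Qed.

Lemma inv_continuous_at (z : R) : 0 < z -> {for z, continuous (fun t : R => t^-1)}.
Proof. by move=> z0; apply: inv_continuous; rewrite gt_eqF. Qed.

Lemma inv_shift_continuous_at z : 0 < z -> {for z, continuous (fun t : R => (t + b)^-1)}.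
Proof.
move=> z0; apply: (@cvgV _ _ _ _ (fun t => t + b)); first by rewrite gt_eqF ?zb.
by apply: cvgD; [exact: cvg_id|exact: cvg_cst].
Qed.

Lemma sigma_continuous z : 0 < z -> {for z, continuous sigma}.
Proof.
move=> z0; have ic := inv_continuous_at z0; have sc := inv_shift_continuous_at z0.
rewrite /sigma; apply: cvgD; apply: cvgM; try exact: cvg_cst.
  exact: cvgM.
by apply: cvgM; [exact: cvgM|exact: cvgD].
Qed.

Lemma pressure_continuous z : 0 < z -> {for z, continuous pressure}.
Proof.
move=> z0; have ic := inv_continuous_at z0; have sc := sigma_continuous z0.
have cz : {for z, continuous (fun t : R => c / t)} by apply: cvgM => //; exact: cvg_cst.
rewrite /pressure; apply: cvgB.
  by apply: cvgD; [apply: cvgB; [exact: cvg_id|exact: cvg_cst]|exact: cvg_cst].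
apply: cvgM; first exact: cvg_cst.
apply: cvgD; last exact: cvgM.
by apply: cvgM; [apply: cvgB => //|]; exact: cvg_cst.
Qed.

(** With zero pressure and [h = 1] the unknown [rho h W^2] equals [D W], whose square is this
    equation. The value at [D / 2] is at most [D^2 / 4]; at [M + D + 1] it is at least
    [(M + D + 1)^2 - M]. *)
Lemma pressureless_root : exists2 z, 0 < z & z ^+ 2 * (1 - sigma z) = D ^+ 2.
Proof.
have D20 : 0 < D / 2 by rewrite divr_gt0.
pose f z := z ^+ 2 * (1 - sigma z).
have le : D / 2 <= M + D + 1 by move: M0 D0; lra.
have fc z : D / 2 <= z <= M + D + 1 -> {for z, continuous f}.
  move=> /andP[/(lt_le_trans D20) z0 _].
  apply: cvgM; first by apply: cvgM; exact: cvg_id.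
  by apply: cvgB; [exact: cvg_cst|exact: sigma_continuous].
have fy : f (D / 2) <= D ^+ 2 <= f (M + D + 1).
  apply/andP; split; rewrite /f mulrBr mulr1.
    have := mulr_ge0 (sqr_ge0 (D / 2)) (sigma_ge0 D20).
    have : (D / 2) ^+ 2 <= D ^+ 2 by rewrite ler_sqr ?nnegrE ?ltW//; move: D0; lra.
    lra.
  have z0 : 0 < M + D + 1 by move: M0 D0; lra.
  have := sigma_upper z0; have := mulr_ge0 M0 (ltW D0); have := sqr_ge0 M; nra.
by have [z /andP[/(lt_le_trans D20) z0 _] zE] := ivt le fc fy; exists z.
Qed.

Section root.
Variable z1 : R.
Hypotheses (z10 : 0 < z1) (z1E : z1 ^+ 2 * (1 - sigma z1) = D ^+ 2) (Pz1 : pressure z1 < 0).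

Let sigma_lt1 z : z1 <= z -> sigma z < 1.
Proof.
move=> zz1; apply: le_lt_trans (sigma_antitone z10 zz1) _.
rewrite -subr_gt0 -(pmulr_rgt0 _ (exprn_gt0 2 z10)) z1E; exact: exprn_gt0.
Qed.

Let r z := Num.sqrt (1 - sigma z).

Let r_gt0 z : z1 <= z -> 0 < r z.
Proof. by move=> zz1; rewrite sqrtr_gt0 subr_gt0 sigma_lt1. Qed.

Let r_homo z z' : z1 <= z -> z <= z' -> r z <= r z'.
Proof.
move=> zz1 zz'; rewrite ler_wsqrtr// lerB// sigma_antitone//; exact: lt_le_trans zz1.
Qed.

Let Dr z : z1 <= z -> D / r z <= z1.
Proof.
move=> zz1; rewrite ler_pdivrMr ?r_gt0//.
have -> : D = z1 * r z1.
  rewrite -[D]gtr0_norm// -sqrtr_sqr -z1E sqrtrM ?sqr_ge0// sqrtr_sqr gtr0_norm//.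
by rewrite ler_pM2l// r_homo.
Qed.

Let gap_bound z : 0 < z -> sigma z < 1 -> b * M - c ^+ 2 <= b * (z + b) ^+ 2.
Proof.
move=> z0 s1; rewrite -(ler_pM2r (exprn_gt0 2 z0)).
have -> : (b * M - c ^+ 2) * z ^+ 2 =
    b * (sigma z * z ^+ 2 * (z + b) ^+ 2) - c ^+ 2 * (z + b) ^+ 2.
  by rewrite sigmaE//; ring.
have h1 : 0 <= c ^+ 2 * (z + b) ^+ 2 by rewrite mulr_ge0 ?sqr_ge0.
have h2 : 0 <= b * (z + b) ^+ 2 * z ^+ 2 * (1 - sigma z).
  apply: mulr_ge0; last by rewrite subr_ge0 ltW.
  by apply: mulr_ge0; [apply: mulr_ge0 => //|]; exact: sqr_ge0.
by rewrite -subr_ge0; apply: le_trans (addr_ge0 h1 h2) _; rewrite le_eqVlt; apply/orP; left;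
  apply/eqP; ring.
Qed.

Let pressureE z : 0 < z -> pressure z = z - E + 2^-1 * b +
  2^-1 * (b * M - c ^+ 2) / (z + b) ^+ 2.
Proof.
by move=> z0; rewrite /pressure /sigma; field; rewrite (gt_eqF (zb z0)) (gt_eqF z0).
Qed.

(** The only decreasing term of [pressureE] has slope [- (b M - c^2) / (z + b)^3], which is at least
    [- b / (z + b) > -1] by [gap_bound]. The proof uses difference quotients instead of
    derivatives. *)
Let pressure_lt z z' : z1 <= z -> z < z' -> pressure z < pressure z'.
Proof.
move=> zz1 zz'; have z0 := lt_le_trans z10 zz1; have z'0 := lt_trans z0 zz'.
rewrite !pressureE//; have K := gap_bound z0 (sigma_lt1 zz1).
have x0 := zb z0; have xx' : z + b < z' + b by rewrite ltrD2r.
have bx : b < z' + b by rewrite ltrDr.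
have zE : z' - z = (z' + b) - (z + b) by ring.
rewrite -subr_gt0.
have -> : z' - E + 2^-1 * b + 2^-1 * (b * M - c ^+ 2) / (z' + b) ^+ 2 -
  (z - E + 2^-1 * b + 2^-1 * (b * M - c ^+ 2) / (z + b) ^+ 2) =
  (z' - z) - 2^-1 * (b * M - c ^+ 2) * ((z + b) ^- 2 - (z' + b) ^- 2) by ring.
rewrite zE; set k := b * M - c ^+ 2 in K *; move: (z + b) (z' + b) x0 xx' bx K => x x' x0 xx' bx K.
have x'0 := lt_trans x0 xx'.
have -> : x' - x - 2^-1 * k * (x ^- 2 - x' ^- 2) =
    (x' - x) * (2 * x ^+ 2 * x' ^+ 2 - k * (x + x')) / (2 * x ^+ 2 * x' ^+ 2).
  by field; rewrite !gt_eqF.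
apply: divr_gt0; last by rewrite !mulr_gt0// exprn_gt0.
apply: mulr_gt0; first by rewrite subr_gt0.
rewrite subr_gt0; apply: (@le_lt_trans _ _ (b * x ^+ 2 * (x + x'))).
  by rewrite ler_wpM2r// addr_ge0// ltW.
apply: (@le_lt_trans _ _ (b * x ^+ 2 * (2 * x'))).
  rewrite ler_wpM2l ?mulr_ge0 ?sqr_ge0//; lra.
have -> : b * x ^+ 2 * (2 * x') = (2 * x ^+ 2 * x') * b by ring.
have -> : 2 * x ^+ 2 * x' ^+ 2 = (2 * x ^+ 2 * x') * x' by ring.
by rewrite ltr_pM2l// !mulr_gt0// exprn_gt0.
Qed.

(** Zero exactly when [z = rho h W^2] for the density [rho = D * r z] and [W = 1 / r z]. *)
Let residual z := D * h (pressure z) (D * r z) / r z - z.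

Let residual_continuous z : z1 <= z -> 0 < pressure z -> {for z, continuous residual}.
Proof.
move=> zz1 P0; have z0 := lt_le_trans z10 zz1.
have rc : {for z, continuous r}.
  apply: (@continuous_comp _ _ _ (fun t => 1 - sigma t) Num.sqrt); last exact: sqrt_continuous.
  by apply: cvgB; [exact: cvg_cst|exact: sigma_continuous].
apply: cvgB; last exact: cvg_id.
apply: cvgM; last by apply: cvgV => //; rewrite gt_eqF// r_gt0.
apply: cvgM; first exact: cvg_cst.
apply: (eos_continuous heos (pressure_continuous z0) _ P0); last by rewrite mulr_gt0// r_gt0.
by apply: cvgM => //; exact: cvg_cst.
Qed.

Lemma recovery_root : exists z, [/\ 0 < z, sigma z < 1, 0 < pressure z &
  D * h (pressure z) (D * Num.sqrt (1 - sigma z)) / Num.sqrt (1 - sigma z) = z].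
Proof.
(* [pressure z >= z - E], so [2 * pressure z >= z] as soon as [z >= 2 * E]. *)
pose zu := z1 + `|2 * E| + 1; have Eu := ler_norm (2 * E); have Eu0 := normr_ge0 (2 * E).
have zu1 : z1 < zu by rewrite /zu; lra.
have zu0 : 0 < zu by exact: lt_trans zu1.
have Puz : zu <= 2 * pressure zu.
  rewrite pressureE//; have kk : 0 <= 2^-1 * (b * M - c ^+ 2) / (zu + b) ^+ 2.
    by rewrite divr_ge0 ?sqr_ge0// mulr_ge0// subr_ge0 mulrC.
  by move: kk b0 z10; rewrite /zu; lra.
have Pu : 0 < pressure zu by lra.
have [z0 /andP[z01 z0u] Pz0] : exists2 z, z1 <= z <= zu & pressure z = 0.
  apply: ivt; [exact: ltW| |by rewrite !ltW].
  by move=> z /andP[/(lt_le_trans z10) ? _]; exact: pressure_continuous.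
have {z01}z01 : z1 < z0.
  by rewrite lt_def z01 andbT; apply/eqP => zz; move: Pz1; rewrite -zz Pz0 ltxx.
have {z0u}z0u : z0 < zu.
  by rewrite lt_def z0u andbT; apply/eqP => zz; move: Pu; rewrite zz Pz0 ltxx.
have z00 := lt_trans z10 z01.
have Ppos z : z0 < z -> 0 < pressure z by move=> zz; rewrite -Pz0 pressure_lt// ltW.
pose rho0 := D * r z0; have rho00 : 0 < rho0 by rewrite mulr_gt0// r_gt0// ltW.
(* The ratio [z0 / z1] exceeds 1, the cold limit of [h] at the fixed density [rho0]. Together with
   [D / r za <= z1] it will bound [D h / r] at [za] by [z0 < za]. *)
have cold : \forall q \near (0 : R)^'+, h q rho0 < z0 / z1.
  have := eos_cold heos rho00; move=> /(_ [set y | y < z0 / z1]); apply.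
  by apply: lt_nbhsl; rewrite ltr_pdivlMr// mul1r.
have [d /= d0 cold'] := cold.
have [za [za0 zau Pza]] : exists za, [/\ z0 < za, za < zu & pressure za < d].
  have near1 : \forall z \near z0, pressure z < d.
    have := pressure_continuous z00; move=> /(_ [set y | y < d]); apply.
    by rewrite Pz0; exact: lt_nbhsl.
  have near2 : \forall z \near z0^'+, pressure z < d by move: near1; exact: cvg_at_right_filter.
  have near3 : \forall z \near z0^'+, z0 < z /\ z < zu.
    by near=> z; split=> //; near: z; exact: nbhs_right_lt.
  by have [za [? [? ?]]] := filter_ex (filterI near2 near3); exists za.
have za1 : z1 <= za by rewrite ltW// (lt_trans z01).
have ra : residual za <= 0.
  rewrite subr_le0; have Pa := Ppos za za0.
  have ha : h (pressure za) (D * r za) < z0 / z1.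
    (* The density at [za] varies with [za], whereas the cold limit is taken at fixed density; as
       [h] decreases with the density, the smaller value [rho0] serves for all [za]. *)
    apply: (@le_lt_trans _ _ (h (pressure za) rho0)).
      apply: eos_antitone => //; rewrite ler_pM2l// r_homo// ltW//.
    apply: cold' => //; rewrite /ball/= sub0r normrN gtr0_norm//.
  have h0 : 0 < h (pressure za) (D * r za) by rewrite eos_gt0// mulr_gt0// r_gt0.
  rewrite mulrAC; apply: (@le_trans _ _ (z1 * (z0 / z1))).
    by apply: ler_pM; rewrite ?divr_ge0 ?(ltW D0) ?(ltW (r_gt0 _)) ?(ltW h0) ?(ltW ha)// Dr.
  by rewrite mulrCA divff ?mulr1 ?ltW// gt_eqF.
(* As [r zu <= 1], the product [rho h W^2] is at least [rho h], hence at least [2 * pressure zu]. *)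
have ru : 0 <= residual zu.
  rewrite subr_ge0; apply: le_trans Puz _.
  have rzu := r_gt0 (ltW zu1).
  have eu := eos_pressure heos Pu (mulr_gt0 D0 rzu).
  rewrite ler_pdivlMr//.
  have r1 : r zu <= 1 by rewrite -sqrtr1 ler_wsqrtr// gerBl sigma_ge0.
  have : D * r zu * h (pressure zu) (D * r zu) <= D * h (pressure zu) (D * r zu).
    rewrite ler_wpM2r ?ler_piMr ?(ltW D0)//.
    by rewrite ltW// eos_gt0// mulr_gt0.
  move=> eu'; apply: le_trans (le_trans eu eu').
  by rewrite ler_piMr// mulr_ge0// ltW.
have resc z : za <= z <= zu -> {for z, continuous residual}.
  move=> /andP[zza _]; apply: residual_continuous; first exact: le_trans zza.
  by apply: Ppos; exact: lt_le_trans zza.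
have res0 : residual za <= 0 <= residual zu by rewrite ra ru.
have [z /andP[zza zzu] rz] := ivt (ltW zau) resc res0.
have zz1 : z1 <= z by exact: le_trans zza.
exists z; split; [exact: lt_le_trans zz1|exact: sigma_lt1| |exact: subr0_eq].
by apply: Ppos; exact: lt_le_trans zza.
Unshelve. all: by end_near. Qed.

End root.
End recovery_scalar.

Section recovery.
Context {R : realType} {h : R -> R -> R} (heos : eos h) (U : state R).
Local Notation m := (stm U).
Local Notation B := (stB U).
Hypothesis D0 : 0 < stD U.
Hypothesis pos : forall v, dot v v < 1 -> 0 < functional v B U + pmag v B.

Let b := dot B B.
Let c := dot m B.
Let sig := sigma (dot m m) b c.

Let b0 : 0 <= b. Proof. exact: dot_ge0. Qed.
Let zb z : 0 < z -> z + b != 0. Proof. by move=> z0; rewrite gt_eqF// ltr_wpDr. Qed.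

Let velocity z : 0 < z -> exists v,
  [/\ dot v v = sig z, dot v B = c / z & m = (z + b) *: v - (c / z) *: B].
Proof.
move=> z0; exists ((z + b)^-1 *: (m + (c / z) *: B)); split.
- rewrite !(dotZl, dotZr, dotDl, dotDr) (dotC B m) -/b -/c /sig /sigma.
  by field; rewrite zb// gt_eqF.
- by rewrite !(dotZl, dotDl) -/b -/c; field; rewrite zb// gt_eqF.
- by rewrite scalerA divff ?zb// scale1r addrK.
Qed.

Lemma admissible_of_functional : admissible h U.
Proof.
have cMb : c ^+ 2 <= dot m m * b := cauchy_dot m B.
have [z1 z10 z1E] := pressureless_root (dot_ge0 m) b0 cMb D0.
have s1 : sig z1 < 1.
  by rewrite -subr_gt0 -(pmulr_rgt0 _ (exprn_gt0 2 z10)) z1E exprn_gt0.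
(* For the velocity belonging to [z1], the positive quantity in [pos] is exactly [- pressure z1],
   because [sqrt (1 - |v|^2) * D = z1 * (1 - |v|^2)]. *)
have Pz1 : pressure (dot m m) b c (stE U) z1 < 0.
  have [v [vv vB mv]] := velocity z10.
  have v1 : dot v v < 1 by rewrite vv.
  have rE : Num.sqrt (1 - sig z1) = stD U / z1.
    apply/(mulIf (lt0r_neq0 z10)); rewrite divfK ?lt0r_neq0//.
    rewrite -[X in _ * X]gtr0_norm// -sqrtr_sqr -sqrtrM ?subr_ge0 ?(ltW s1)// mulrC z1E.
    by rewrite sqrtr_sqr gtr0_norm.
  have := pos v1; rewrite /functional /pmag vv rE.
  have vm : dot v m = (z1 + b) * sig z1 - (c / z1) ^+ 2.
    by rewrite mv dotDr dotNr !dotZr vv vB expr2.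
  rewrite vm dotDl !dotZl vB -/b /pressure -/sig => pos1.
  have D2 : stD U / z1 * stD U = z1 * (1 - sig z1).
    by rewrite mulrAC -expr2 -z1E /sig; field; rewrite gt_eqF.
  by move: pos1; rewrite D2; move: (sig z1) (c / z1) => s t; nra.
have [z [z0 sz Pz zE]] := recovery_root heos (dot_ge0 m) b0 cMb D0 z10 z1E Pz1.
set p := pressure _ _ _ _ z in Pz zE; set r := Num.sqrt (1 - sigma (dot m m) b c z) in zE.
have [v [vv vB mv]] := velocity z0.
have r0 : 0 < r by rewrite sqrtr_gt0 subr_gt0.
have v1 : dot v v < 1 by rewrite vv.
exists (stD U * r, p, v); split=> //; [exact: mulr_gt0|by rewrite enorm_lt1|].
rewrite [LHS]stateE /cons_of_prim.
have WE : lorentz v = r^-1 by rewrite /lorentz sqr_enorm vv.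
have hE : stD U * r * h p (stD U * r) * lorentz v ^+ 2 = z.
  by rewrite WE -[RHS]zE; field; rewrite gt_eqF.
rewrite hE WE mulfK ?gt_eqF// vB sqr_enorm -/b; congr mkstate.
- by rewrite {1}mv scalerDl.
- by rewrite /ptot lorentzV2// vv vB sqr_enorm -/b /p /pressure -/sig; ring.
Qed.

End recovery.

(** * The scheme *)

Lemma faces_closed23 {R : realType} {d : nat} {K : eqType} (cell : K -> set 'rV[R]_d)
    (nbr : K -> seq K) (xi : K -> K -> 'rV[R]_d) k : d = 2%N \/ d = 3%N ->
  is_mesh cell nbr xi -> \sum_(j <- nbr k) face_size cell k j *: xi k j = 0.
Proof. by case=> E; subst d => hmesh; exact: faces_closed. Qed.

Section scheme.
Context {R : realType} {d : nat} {h : R -> R -> R} (heos : eos h).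
Hypothesis hd : (d <= 3)%N.
Implicit Types (U : state R) (xi : 'rV[R]_d).

Lemma dirF_linear c xi xi' U : dirF h (c *: xi + xi') U = c *: dirF h xi U + dirF h xi' U.
Proof.
rewrite /dirF scaler_sumr -big_split/=; apply: eq_bigr => l _.
by rewrite !mxE scalerDl scalerA.
Qed.

Lemma dirF0 U : dirF h (0 : 'rV[R]_d) U = 0.
Proof. by rewrite /dirF big1// => l _; rewrite mxE scale0r. Qed.

Lemma dirFZ c xi U : dirF h (c *: xi) U = c *: dirF h xi U.
Proof. by rewrite -[c *: xi]addr0 dirF_linear dirF0 addr0. Qed.

Lemma dirFD xi xi' U : dirF h (xi + xi') U = dirF h xi U + dirF h xi' U.
Proof. by rewrite -[xi]scale1r dirF_linear !scale1r. Qed.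

Lemma stD_linear c U V : stD (c *: U + V) = c * stD U + stD V.
Proof. by have [] := state_linear c U V. Qed.

Lemma stD0 : stD (0 : state R) = 0.
Proof. by rewrite /stD !mxE. Qed.

Lemma prim_ofP U : admissible h U -> is_prim h U (prim_of h U).
Proof. by move=> adm; exact: (xgetPex _ adm). Qed.

Section split.
Variables (U : state R) (xi : 'rV[R]_d) (alpha : R).
Hypotheses (adm : admissible h U) (xi1 : enorm xi = 1) (alpha1 : 1 <= alpha).

(** The vector of length [1 / alpha] that turns [U - F_xi(U) / alpha] into [U] plus a generalized
    flux. *)
Let n : 'rV[R]_3 := - (alpha^-1 *: emb3 xi).

Let n_le1 : dot n n <= 1.
Proof.
rewrite /n dotNl dotNr opprK dotZl dotZr emb3_dot// -sqr_enorm xi1 expr1n mulr1.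
by rewrite mulr_ile1 ?invr_ge0 ?(le_trans ler01)// invf_le1// (lt_le_trans ltr01).
Qed.

Let gen_fluxE p v rho : prim_of h U = (rho, p, v) ->
  gen_flux p v U n = - alpha^-1 *: dirF h xi U.
Proof.
move=> UE; rewrite (dirF_gen_flux _ UE) /n -scaleNr -[X in gen_flux _ _ _ X]addr0.
by rewrite gen_flux_linear gen_flux0 addr0.
Qed.

Lemma functional_split vs Bs : dot vs vs < 1 ->
  alpha^-1 * (pmag vs Bs * dot (emb3 xi) vs - dot (emb3 xi) (stB U) * dot vs Bs) <=
  functional vs Bs U - alpha^-1 * functional vs Bs (dirF h xi U) + pmag vs Bs.
Proof.
move=> vs1; have := prim_ofP adm; case E : (prim_of h U) => [[rho p] v] hprim.
have := split_ge0 heos hprim Bs vs1 n_le1.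
rewrite (gen_fluxE E) -[X in functional _ _ X + _]addr0 -[- alpha^-1 *: _]addr0.
rewrite !functional_linear functional0 addr0 /n !dotNl !dotZl.
lra.
Qed.

Lemma D_split : 0 <= stD U - alpha^-1 * stD (dirF h xi U).
Proof.
have := prim_ofP adm; case E : (prim_of h U) => [[rho p] v] hprim.
have := split_D_ge0 hprim n_le1; rewrite (gen_fluxE E).
by rewrite -[- alpha^-1 *: _]addr0 (stD_linear _ _ 0) stD0 addr0 mulNr.
Qed.

End split.

Section average.
Context {K : eqType} (s : seq K) (xi : K -> 'rV[R]_d) (w : K -> R).
Variables (alpha a : R) (U : state R) (V : K -> state R).
Hypotheses (closed : \sum_(j <- s) w j *: xi j = 0) (alpha0 : 0 < alpha).

(** The fluxes of the cell's own state cancel because they are linear in [xi] and the weighted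
    normals sum to zero. Stated for any linear [f], the identity serves both [stD] and
    [functional]. *)
Lemma scheme_linear (f : state R -> R) : (forall c X Y, f (c *: X + Y) = c * f X + f Y) ->
  f (U - a *: \sum_(j <- s) w j *: num_flux h alpha (xi j) U (V j)) =
  (1 - alpha * a / 2 * \sum_(j <- s) w j) * f U + alpha * a / 2 *
    \sum_(j <- s) w j * (f (V j) - alpha^-1 * f (dirF h (xi j) (V j))).
Proof.
move=> fP; have f0 : f 0 = 0.
  by have := fP (-1) 0 0; rewrite scaleN1r oppr0 addr0 mulN1r addNr.
have fD X Y : f (X + Y) = f X + f Y by rewrite -[X]scale1r fP mul1r !scale1r.
have fZ c X : f (c *: X) = c * f X by rewrite -[c *: X]addr0 fP f0 addr0.
have fN X : f (- X) = - f X by rewrite -scaleN1r fZ mulN1r.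
have flow : \sum_(j <- s) w j * f (dirF h (xi j) U) = 0.
  rewrite -f0 -[X in _ = f X](dirF0 U) -closed.
  elim/big_ind2: _ => [|x x' y y' -> ->|j _]; rewrite ?dirF0 ?dirFD ?dirFZ ?fD ?fZ//.
have sum (G : K -> state R) : f (\sum_(j <- s) w j *: G j) = \sum_(j <- s) w j * f (G j).
  by elim/big_rec2: _ => // j x X _ <-; rewrite fP.
rewrite -scaleN1r addrC scalerA fP mulN1r sum.
transitivity (f U - a / 2 * \sum_(j <- s) w j * f (dirF h (xi j) U) -
    a / 2 * \sum_(j <- s) (w j * (alpha * f U) -
      alpha * (w j * (f (V j) - alpha^-1 * f (dirF h (xi j) (V j)))))).
  rewrite addrC -addrA; congr (_ + _); rewrite -opprD -mulrDr -big_split/= mulNr; congr (- _).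
  rewrite -mulrA; congr (_ * _); rewrite mulr_sumr; apply: eq_bigr => j _.
  rewrite /num_flux !(fZ, fD, fN).
  by field; rewrite gt_eqF.
by rewrite flow sumrB -mulr_suml -mulr_sumr; field.
Qed.

End average.
End scheme.

Lemma emb3_0 {R : realType} {d : nat} : emb3 (0 : 'rV[R]_d) = 0.
Proof. by rewrite /emb3 big1// => l _; rewrite mxE scale0r. Qed.

Lemma dot_emb3_sum {R : realType} {d : nat} {K : Type} (s : seq K) (w : K -> R)
    (xi : K -> 'rV[R]_d) x :
  \sum_(j <- s) w j * dot (emb3 (xi j)) x = dot (emb3 (\sum_(j <- s) w j *: xi j)) x.
Proof.
elim/big_rec2: _ => [|j y y' _ ->]; first by rewrite emb3_0 dot0l.
by rewrite emb3_linear dotDl dotZl.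
Qed.

(** The field of the cell itself is constant over its faces, so closure removes it and only the
    neighbours' fields remain. *)
Lemma discrete_divE {R : realType} {d : nat} {K : eqType} (cell : K -> set 'rV[R]_d)
    (nbr : K -> seq K) (xi : K -> K -> 'rV[R]_d) (B : K -> 'rV[R]_3) k :
  \sum_(j <- nbr k) face_size cell k j *: xi k j = 0 ->
  discrete_div cell nbr xi B k =
  2^-1 * \sum_(j <- nbr k) face_size cell k j * dot (emb3 (xi k j)) (B j).
Proof.
move=> closed; rewrite /discrete_div.
transitivity (2^-1 * \sum_(j <- nbr k) face_size cell k j * dot (emb3 (xi k j)) (B k) +
    2^-1 * \sum_(j <- nbr k) face_size cell k j * dot (emb3 (xi k j)) (B j)).
  rewrite -mulrDr -big_split/= mulr_sumr; apply: eq_bigr => j _.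
  by rewrite dirB_emb3 dotZr dotDr; ring.
by rewrite dot_emb3_sum closed emb3_0 dot0l mulr0 add0r.
Qed.

Lemma functional_lower {R : realType} {d : nat} {h : R -> R -> R} (heos : eos h)
    (hd : (d <= 3)%N) {K : eqType} (s : seq K) (xi : K -> 'rV[R]_d) (w : K -> R)
    (alpha : R) (V : K -> state R) vs Bs :
  1 <= alpha -> dot vs vs < 1 -> (forall j, 0 <= w j) -> (forall j, admissible h (V j)) ->
  (forall j, j \in s -> enorm (xi j) = 1) ->
  \sum_(j <- s) w j *: xi j = 0 -> \sum_(j <- s) w j * dot (emb3 (xi j)) (stB (V j)) = 0 ->
  - (pmag vs Bs * \sum_(j <- s) w j) <= \sum_(j <- s) w j *
    (functional vs Bs (V j) - alpha^-1 * functional vs Bs (dirF h (xi j) (V j))).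
Proof.
move=> alpha1 vs1 w0 adm n1 closed div.
rewrite -subr_ge0 opprK.
have div0 : \sum_(j <- s) w j * (alpha^-1 * (pmag vs Bs * dot (emb3 (xi j)) vs -
    dot (emb3 (xi j)) (stB (V j)) * dot vs Bs)) = 0.
  transitivity (alpha^-1 * (pmag vs Bs * \sum_(j <- s) w j * dot (emb3 (xi j)) vs -
      (\sum_(j <- s) w j * dot (emb3 (xi j)) (stB (V j))) * dot vs Bs)).
    rewrite mulr_sumr mulr_suml -sumrB mulr_sumr; apply: eq_bigr => j _; ring.
  by rewrite div dot_emb3_sum closed emb3_0 dot0l mulr0 mul0r subr0 mulr0.
rewrite -[leLHS]div0 mulr_sumr -big_split/= big_seq [leRHS]big_seq; apply: ler_sum => j js.
rewrite [pmag vs Bs * w j]mulrC -mulrDr; apply: ler_wpM2l => //.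
exact (functional_split heos hd (adm j) (n1 j js) alpha1 Bs vs1).
Qed.

(** At the lower bound [S = - (g * T)] the expression is [(1 - c * T) * (f + g)]. *)
Lemma average_gt0 {R : realDomainType} {c T f g S : R} :
  0 < c -> c * T < 1 -> 0 < f + g -> - (g * T) <= S -> 0 < (1 - c * T) * f + c * S + g.
Proof.
move=> c0 cT fg; rewrite -(ler_pM2l c0) => gS.
have : 0 < (1 - c * T) * (f + g) by rewrite mulr_gt0// subr_gt0.
lra.
Qed.

Theorem theorem3p2 (R : realType) (d : nat) (hd : d = 2%N \/ d = 3%N)
    (h : R -> R -> R) (heos : eos h)
    (K : eqType) (cell : K -> set 'rV[R]_d) (nbr : K -> seq K)
    (xi : K -> K -> 'rV[R]_d) (hmesh : is_mesh cell nbr xi)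
    (alpha dt : R) (halpha : 1 <= alpha) (hdt : 0 < dt)
    (U Unext : K -> state R)
    (scheme : forall k, Unext k =
       U k - (dt / cell_size cell k) *:
         \sum_(j <- nbr k)
           face_size cell k j *: num_flux h alpha (xi k j) (U k) (U j))
    (hU : forall k, admissible h (U k))
    (hdiv : forall k, discrete_div cell nbr xi (fun j => stB (U j)) k = 0)
    (hCFL : forall k,
       0 < alpha * dt / (2 * cell_size cell k) *
           \sum_(j <- nbr k) face_size cell k j < 1) :
  forall k, admissible h (Unext k).
Proof.
move=> k.
have d3 : (d <= 3)%N by case: hd => ->.
have closed := faces_closed23 k hd hmesh.
have n1 j : j \in nbr k -> enorm (xi k j) = 1 by move=> /(mesh_normal hmesh)[].
have w0 j : 0 <= face_size cell k j by apply: fine_ge0; exact: hausdorff_ge0.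
have alpha0 : 0 < alpha by exact: lt_le_trans ltr01 halpha.
set a := dt / cell_size cell k.
set total := \sum_(j <- nbr k) face_size cell k j.
have total0 : 0 <= total by exact: sumr_ge0.
have [lam0 lam1] : 0 < alpha * a / 2 * total /\ alpha * a / 2 * total < 1.
  by apply/andP; have := hCFL k; rewrite invfM [_^-1 * _]mulrC !mulrA.
(* The lower half of the CFL condition excludes a cell of measure zero or infinity, for which [fine]
   and the division would make [a] zero. *)
have c0 : 0 < alpha * a / 2.
  by rewrite ltNge; apply: contraTN lam0 => c0; rewrite -leNgt mulr_le0_ge0.
have step := scheme_linear (h := h) a (U k) U closed alpha0.
have div : \sum_(j <- nbr k) face_size cell k j * dot (emb3 (xi k j)) (stB (U j)) = 0.
  have := hdiv k; rewrite (discrete_divE _ closed) => /eqP.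
  by rewrite mulf_eq0 invr_eq0 pnatr_eq0/= => /eqP.
have prim := prim_ofP (hU k).
case E : (prim_of h (U k)) prim => [[rho p] v] prim.
rewrite scheme; apply: (admissible_of_functional heos) => [|vs vs1].
  rewrite (step _ stD_linear); apply: ltr_pwDl.
    by rewrite mulr_gt0 ?subr_gt0//; exact: (prim_D_gt0 prim).
  rewrite mulr_ge0 ?(ltW c0)// big_seq; apply: sumr_ge0 => j jk; rewrite mulr_ge0//.
  exact (D_split d3 (hU j) (n1 j jk) halpha).
(* The magnetic field of the updated state is frozen as an arbitrary [Bs]; only then is the
   functional linear in the state. *)
move: (stB _) => Bs.
rewrite (step _ (functional_linear vs Bs)).
have lower := functional_lower heos d3 Bs halpha vs1 w0 hU n1 closed div.
have pos := functional_gt0 heos prim Bs vs1.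
exact (average_gt0 c0 lam1 pos lower).
Qed.
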